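(* Consider five bodies in the plane: two heavy bodies $q_1,q_2$ with masses $m_1=m_2=\frac12\left(1-\frac34\cdot10^{-7}\right)$ and three light bodies $p_1,p_2,p_3$, each of mass $\mu=\frac14\cdot10^{-7}$. Then there are exactly $24=4\cdot3!$ normalized central configurations $(p_1,p_2,p_3,q_1,q_2)$ (bodies labelled) such that $p_j\in[-0.2,0.2]\times[0.7,1.0]$ for $j=1,2,3$ and $q_1\in[0.49,0.65]\times\{0\}$.
   Context: A normalized central configuration of $n$ bodies in the plane with positive masses $M_1,\dots,M_n$ at pairwise distinct positions $z_1,\dots,z_n\in\mathbb{R}^2$ is a solution of $$z_i=\sum_{j\ne i}\frac{M_j}{|z_i-z_j|^3}(z_i-z_j),\qquad i=1,\dots,n.$$ It satisfies $\sum_iM_iz_i=0$; accordingly the position of the second heavy body $q_2$ is determined by the other bodies. *)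

(* Defs.v *)
From Stdlib Require Export Reals List Arith.
Import ListNotations.
Open Scope R_scope.

Definition point : Type := (R * R)%type.

Definition padd (p q : point) : point := (fst p + fst q, snd p + snd q).
Definition psub (p q : point) : point := (fst p - fst q, snd p - snd q).
Definition pscale (c : R) (p : point) : point := (c * fst p, c * snd p).

Definition pdist (p q : point) : R := dist_euc (fst p) (snd p) (fst q) (snd q).

Definition psum (l : list point) : point := fold_right padd (0, 0) l.

(* The sum over j <> i of M_j / |z_i - z_j|^3 (z_i - z_j), bodies being indexed
   by 0, ..., n - 1. *)
Definition attraction (n : nat) (M : nat -> R) (z : nat -> point) (i : nat) : point :=
  psum (map (fun j => pscale (M j / pdist (z i) (z j) ^ 3) (psub (z i) (z j)))
            (filter (fun j => negb (Nat.eqb j i)) (seq 0 n))).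

(* Only the values of M and z at indices below n matter. *)
Definition normalized_central_configuration
    (n : nat) (M : nat -> R) (z : nat -> point) : Prop :=
  (forall i, (i < n)%nat -> 0 < M i) /\
  (forall i j, (i < n)%nat -> (j < n)%nat -> i <> j -> z i <> z j) /\
  (forall i, (i < n)%nat -> z i = attraction n M z i).

Record config5 : Type := Config5 {
  p1 : point; p2 : point; p3 : point; q1 : point; q2 : point }.

(* Light bodies come first: indices 0, 1, 2 are p1, p2, p3 and 3, 4 are q1, q2. *)
Definition position (c : config5) (i : nat) : point :=
  nth i [p1 c; p2 c; p3 c; q1 c; q2 c] (0, 0).

Definition mu : R := 1 / 4 * / 10 ^ 7.
Definition m1 : R := 1 / 2 * (1 - 3 / 4 * / 10 ^ 7).
Definition m2 : R := m1.

Definition mass (i : nat) : R := nth i [mu; mu; mu; m1; m2] 0.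

Definition in_box (a b c d : R) (p : point) : Prop :=
  a <= fst p <= b /\ c <= snd p <= d.

Definition has_exactly {T : Type} (P : T -> Prop) (k : nat) : Prop :=
  exists l : list T, NoDup l /\ length l = k /\ forall x, In x l <-> P x.

(* Main.v *)
From Stdlib Require Import ZArith Reals Lra Lia Psatz List Bool.
From Coquelicot Require Import Coquelicot.
Require Import Defs.
Import ListNotations.
Open Scope R_scope.

(* The equation of q1 and the centre of mass put the heavy bodies within 10^-6 of
   (1/2, 0) and (-1/2, 0), so each light body moves in the almost fixed field G of
   the heavy bodies.  Its potential is strongly convex on the box, with minimum at the
   Lagrange point L.  An upper bound of the Hessian bounds the shortest distance between
   light bodies from below; then convexity and the virial identity confine them to a
   neighbourhood of L of size mu^(1/3).

   There G differs little from the linear map diag(3/4, 9/4), and the differences of the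
   equations form a system for the sides of the light triangle.  Choose as apex the body
   whose two sides are closest in length.  In the Jacobi coordinates of that labelling,
   an exhaustive subdivision, using enclosures of the equations and of the torque balance,
   leaves only small boxes around four triangles: collinear along either axis, and
   isosceles with the axis along the first axis, pointing either way.  On each box a
   Newton map with constant diagonal preconditioner is a contraction of the seven
   unknowns (the light bodies and the abscissa of q1), so the box holds exactly one
   solution.  The labellings of the light bodies give 4 * 3! solutions. *)

(** * Interval arithmetic with integer endpoints *)

(** The limit system explains the shapes. In thousandths, with k1 = 25 / r^3 for the base and k2 for
    two equal legs, symmetric triangles uncouple. Collinear ones give 250 / x^3 = 3/4 or 250 / y^3 =
    9/4. An isosceles one with its axis along the first axis gives 3 k2 = 3/4 and 2 k1 + k2 = 9/4,
    so k1 = 1 and the base is the cube root of 25; along the second axis, 3 k2 = 9/4 and 2 k1 + k2 =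
    3/4 would force k1 = 0. Triangles without symmetry admit no such reduction; they are what the
    subdivision has to exclude. The subdivision cannot finish alone. It works with inequalities in
    four unknowns, whose errors come from the variation of the derivative of G and from the
    imprecisely known heavy bodies, so a box of fixed size survives around each solution. Inside it
    only the exact equations decide, hence the Newton map in all seven unknowns. The lower bound of
    the distances keeps the collision singularities out of the search, and the virial identity makes
    its domain bounded. The choice of an apex leaves only the exchange of the base bodies as
    ambiguity of labelling, up to ties. *)

Definition itv : Type := (Z * Z)%type.

(* The integer interval (a, b) at precision p stands for the reals between
   a / 2^p and b / 2^p. *)
Definition cont (p : Z) (I : itv) (x : R) : Prop :=
  IZR (fst I) <= x * IZR (2 ^ p) <= IZR (snd I).

Section IntervalArithmetic.

Variable p : Z.
Hypothesis p_ge0 : (0 <= p)%Z.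

Lemma scale_gt0 : 0 < IZR (2 ^ p).
Proof. apply (IZR_lt 0), Z.pow_pos_nonneg; lia. Qed.

Definition fdiv (x d : Z) : Z := (x / d)%Z.
Definition cdiv (x d : Z) : Z := (- ((- x) / d))%Z.
Definition fshift (x : Z) : Z := Z.shiftr x p.
Definition cshift (x : Z) : Z := (- Z.shiftr (- x) p)%Z.

Lemma fdiv_le x d : (0 < d)%Z -> IZR (fdiv x d) * IZR d <= IZR x.
Proof.
  intros Hd; rewrite <- mult_IZR; apply IZR_le; unfold fdiv.
  rewrite Z.mul_comm; apply Z.mul_div_le; lia.
Qed.

Lemma cdiv_ge x d : (0 < d)%Z -> IZR x <= IZR (cdiv x d) * IZR d.
Proof.
  intros Hd; rewrite <- mult_IZR; apply IZR_le; unfold cdiv.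
  assert (H := Z.mul_div_le (- x) d Hd); lia.
Qed.

Lemma fshift_le x : IZR (fshift x) * IZR (2 ^ p) <= IZR x.
Proof.
  unfold fshift; rewrite Z.shiftr_div_pow2 by exact p_ge0.
  apply fdiv_le, Z.pow_pos_nonneg; lia.
Qed.

Lemma cshift_ge x : IZR x <= IZR (cshift x) * IZR (2 ^ p).
Proof.
  unfold cshift; rewrite Z.shiftr_div_pow2 by exact p_ge0.
  apply cdiv_ge, Z.pow_pos_nonneg; lia.
Qed.

Definition iadd (I J : itv) : itv := (fst I + fst J, snd I + snd J)%Z.
Definition iopp (I : itv) : itv := (- snd I, - fst I)%Z.
Definition isub (I J : itv) : itv := (fst I - snd J, snd I - fst J)%Z.

(* Product of exact integer intervals, by cases on the signs so that two
   multiplications are enough unless both factors straddle 0. *)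
Definition zimul (I J : itv) : itv :=
  let (a, b) := I in
  let (c, d) := J in
  (if 0 <=? a then
     if 0 <=? c then (a * c, b * d)
     else if d <=? 0 then (b * c, a * d) else (b * c, b * d)
   else if b <=? 0 then
     if 0 <=? c then (a * d, b * c)
     else if d <=? 0 then (b * d, a * c) else (a * d, a * c)
   else
     if 0 <=? c then (a * d, b * d)
     else if d <=? 0 then (b * c, a * c)
     else (Z.min (a * d) (b * c), Z.max (a * c) (b * d)))%Z.

Definition imul (I J : itv) : itv :=
  let K := zimul I J in (fshift (fst K), cshift (snd K)).

Definition isqr (I : itv) : itv :=
  let (a, b) := I in
  (if 0 <=? a then (fshift (a * a), cshift (b * b))
   else if b <=? 0 then (fshift (b * b), cshift (a * a))
   else (0, cshift (Z.max (a * a) (b * b))))%Z.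

Definition iscal (n d : Z) (I : itv) : itv :=
  (if 0 <=? n then (fdiv (n * fst I) d, cdiv (n * snd I) d)
   else (fdiv (n * snd I) d, cdiv (n * fst I) d))%Z.

Definition iint (n : Z) (I : itv) : itv :=
  (if 0 <=? n then (n * fst I, n * snd I) else (n * snd I, n * fst I))%Z.

Definition icst (n d : Z) : itv :=
  let m := (n * 2 ^ p)%Z in (fdiv m d, cdiv m d).

(** Scaling by [2 ^ p] before the root gives the root at precision [p]. [Z.sqrt] rounds down, so the
    upper end needs the [+ 1]. *)
Definition isqrt (I : itv) : itv :=
  (Z.sqrt (fst I * 2 ^ p), Z.sqrt (snd I * 2 ^ p) + 1)%Z.

Definition iinv (n : Z) (I : itv) : itv :=
  let m := (n * 2 ^ (p + p))%Z in (fdiv m (snd I), cdiv m (fst I)).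

Definition imag (I : itv) : Z := Z.max (Z.abs (fst I)) (Z.abs (snd I)).

Lemma cont_iadd {I J x y} : cont p I x -> cont p J y -> cont p (iadd I J) (x + y).
Proof. unfold cont, iadd; cbn [fst snd]; rewrite !plus_IZR; lra. Qed.

Lemma cont_iopp I x : cont p I x -> cont p (iopp I) (- x).
Proof. unfold cont, iopp; cbn [fst snd]; rewrite !opp_IZR; lra. Qed.

Lemma cont_isub {I J x y} : cont p I x -> cont p J y -> cont p (isub I J) (x - y).
Proof. unfold cont, isub; cbn [fst snd]; rewrite !minus_IZR; lra. Qed.

Lemma zimul_correct I J x y :
  IZR (fst I) <= x <= IZR (snd I) -> IZR (fst J) <= y <= IZR (snd J) ->
  IZR (fst (zimul I J)) <= x * y <= IZR (snd (zimul I J)).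
Proof.
  destruct I as [a b], J as [c d]; cbn [fst snd zimul]; intros Hx Hy.
  destruct (Z.leb_spec 0 a) as [Ha|Ha]; [apply IZR_le in Ha | apply IZR_lt in Ha];
  (destruct (Z.leb_spec 0 c) as [Hc|Hc]; [apply IZR_le in Hc | apply IZR_lt in Hc]);
  try (destruct (Z.leb_spec d 0) as [Hd|Hd]; [apply IZR_le in Hd | apply IZR_lt in Hd]);
  try (destruct (Z.leb_spec b 0) as [Hb|Hb]; [apply IZR_le in Hb | apply IZR_lt in Hb]);
  cbn [fst snd]; rewrite ?mult_IZR; try (split; nra).
  assert (H1 := IZR_le _ _ (Z.le_min_l (a * d) (b * c))).
  assert (H2 := IZR_le _ _ (Z.le_min_r (a * d) (b * c))).
  assert (H3 := IZR_le _ _ (Z.le_max_l (a * c) (b * d))).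
  assert (H4 := IZR_le _ _ (Z.le_max_r (a * c) (b * d))).
  rewrite mult_IZR in H1, H2, H3, H4.
  destruct (Rle_dec 0 x); destruct (Rle_dec 0 y); split; nra.
Qed.

Lemma cont_imul {I J x y} : cont p I x -> cont p J y -> cont p (imul I J) (x * y).
Proof.
  intros Hx Hy; assert (H := zimul_correct _ _ _ _ Hx Hy); assert (Hs := scale_gt0).
  unfold cont, imul; cbn [fst snd].
  assert (H1 := fshift_le (fst (zimul I J))); assert (H2 := cshift_ge (snd (zimul I J))).
  split; apply Rmult_le_reg_r with (1 := Hs); nra.
Qed.

Lemma cont_isqr {I x} : cont p I x -> cont p (isqr I) (x * x).
Proof.
  destruct I as [a b]; unfold cont, isqr; cbn [fst snd]; intros Hx.
  assert (Hs := scale_gt0).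
  destruct (Z.leb_spec 0 a) as [Ha|Ha]; [apply IZR_le in Ha | apply IZR_lt in Ha];
  [|destruct (Z.leb_spec b 0) as [Hb|Hb]; [apply IZR_le in Hb | apply IZR_lt in Hb]];
  cbn [fst snd].
  - assert (H1 := fshift_le (a * a)); assert (H2 := cshift_ge (b * b)).
    rewrite mult_IZR in H1, H2.
    split; apply Rmult_le_reg_r with (1 := Hs); nra.
  - assert (H1 := fshift_le (b * b)); assert (H2 := cshift_ge (a * a)).
    rewrite mult_IZR in H1, H2.
    split; apply Rmult_le_reg_r with (1 := Hs); nra.
  - assert (H2 := cshift_ge (Z.max (a * a) (b * b))).
    assert (H3 := IZR_le _ _ (Z.le_max_l (a * a) (b * b))).
    assert (H4 := IZR_le _ _ (Z.le_max_r (a * a) (b * b))).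
    rewrite mult_IZR in H3, H4.
    split; [nra|]; apply Rmult_le_reg_r with (1 := Hs).
    replace (x * x * IZR (2 ^ p) * IZR (2 ^ p)) with ((x * IZR (2 ^ p)) * (x * IZR (2 ^ p))) by ring.
    destruct (Rle_dec 0 (x * IZR (2 ^ p))); nra.
Qed.

Lemma cont_iscal n d I x :
  (0 < d)%Z -> cont p I x -> cont p (iscal n d I) (IZR n / IZR d * x).
Proof.
  intros Hd [H1 H2]; unfold cont, iscal.
  assert (Hd' := IZR_lt _ _ Hd).
  assert (E : IZR n / IZR d * x * IZR (2 ^ p) * IZR d = IZR n * (x * IZR (2 ^ p)))
    by (field; lra).
  destruct (Z.leb_spec 0 n) as [Hn|Hn]; [apply IZR_le in Hn | apply IZR_lt in Hn];
  cbn [fst snd].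
  - assert (H3 := fdiv_le (n * fst I) d Hd); assert (H4 := cdiv_ge (n * snd I) d Hd).
    rewrite mult_IZR in H3, H4.
    split; apply Rmult_le_reg_r with (1 := Hd'); rewrite E; nra.
  - assert (H3 := fdiv_le (n * snd I) d Hd); assert (H4 := cdiv_ge (n * fst I) d Hd).
    rewrite mult_IZR in H3, H4.
    split; apply Rmult_le_reg_r with (1 := Hd'); rewrite E; nra.
Qed.

Lemma cont_iint n {I x} : cont p I x -> cont p (iint n I) (IZR n * x).
Proof.
  intros [H1 H2]; unfold cont, iint.
  destruct (Z.leb_spec 0 n) as [Hn|Hn]; [apply IZR_le in Hn | apply IZR_lt in Hn];
  cbn [fst snd]; rewrite !mult_IZR; split; nra.
Qed.

Lemma cont_icst n d : (0 < d)%Z -> cont p (icst n d) (IZR n / IZR d).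
Proof.
  intros Hd; unfold cont, icst; cbn [fst snd].
  assert (H1 := fdiv_le (n * 2 ^ p) d Hd); assert (H2 := cdiv_ge (n * 2 ^ p) d Hd).
  assert (Hd' := IZR_lt _ _ Hd).
  rewrite mult_IZR in H1, H2.
  assert (E : IZR n / IZR d * IZR (2 ^ p) * IZR d = IZR n * IZR (2 ^ p)) by (field; lra).
  split; apply Rmult_le_reg_r with (1 := Hd'); lra.
Qed.

Lemma cont_isqrt I x :
  (0 <= fst I)%Z -> cont p I x -> cont p (isqrt I) (sqrt x).
Proof.
  intros H0 [H1 H2]; unfold cont, isqrt; cbn [fst snd].
  assert (Hs := scale_gt0); apply IZR_le in H0 as H0'.
  assert (Hx : 0 <= x) by nra.
  assert (Hq := sqrt_pos x); assert (Hqq := sqrt_sqrt x Hx).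
  assert (Hb : (0 <= snd I)%Z) by (apply le_IZR; lra).
  assert (Ha2 : (0 <= fst I * 2 ^ p)%Z) by (apply Z.mul_nonneg_nonneg; lia).
  assert (Hb2 : (0 <= snd I * 2 ^ p)%Z) by (apply Z.mul_nonneg_nonneg; lia).
  destruct (Z.sqrt_spec _ Ha2) as [L _]; destruct (Z.sqrt_spec _ Hb2) as [_ U].
  assert (La := Z.sqrt_nonneg (fst I * 2 ^ p)); assert (Ub := Z.sqrt_nonneg (snd I * 2 ^ p)).
  apply IZR_le in L, La, Ub; apply IZR_lt in U.
  rewrite <- Z.add_1_r in U; rewrite plus_IZR.
  rewrite !mult_IZR in L, U; rewrite !plus_IZR in U.
  set (q := sqrt x) in *; set (s := IZR (2 ^ p)) in *.
  assert (Eq : (q * s) * (q * s) = x * s * s) by (rewrite <- Hqq; ring).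
  assert (Hqs : 0 <= q * s) by nra.
  assert (M1 := Rmult_le_compat_r s _ _ ltac:(lra) H1).
  assert (M2 := Rmult_le_compat_r s _ _ ltac:(lra) H2).
  split; apply Rsqr_incr_0_var; unfold Rsqr; lra.
Qed.

Lemma cont_iinv n I x :
  (0 <= n)%Z -> (0 < fst I)%Z -> cont p I x -> cont p (iinv n I) (IZR n / x).
Proof.
  intros Hn H0 [H1 H2]; unfold cont, iinv; cbn [fst snd].
  assert (Hs := scale_gt0); assert (H0' := IZR_lt _ _ H0); apply IZR_le in Hn.
  assert (Hx : 0 < x) by nra.
  assert (Hb : (0 < snd I)%Z) by (apply lt_IZR; lra).
  assert (H3 := fdiv_le (n * 2 ^ (p + p)) _ Hb); assert (H4 := cdiv_ge (n * 2 ^ (p + p)) _ H0).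
  assert (E2 : IZR (n * 2 ^ (p + p)) = IZR n * (IZR (2 ^ p) * IZR (2 ^ p)))
    by (rewrite Z.pow_add_r, !mult_IZR by exact p_ge0; ring).
  rewrite E2 in H3, H4.
  set (s := IZR (2 ^ p)) in *.
  assert (Hb' := IZR_lt _ _ Hb).
  assert (E : IZR n / x * s * (x * s) = IZR n * (s * s)) by (field; lra).
  assert (Hxs : 0 < x * s) by nra.
  assert (Hv : 0 <= IZR n / x * s).
  { apply Rmult_le_pos; [|lra]; apply Rmult_le_pos; [exact Hn|]; left; apply Rinv_0_lt_compat; lra. }
  split.
  - assert (M := Rmult_le_compat_l _ _ _ Hv H2).
    apply Rmult_le_reg_r with (1 := Hb'); lra.
  - assert (M := Rmult_le_compat_l _ _ _ Hv H1).
    apply Rmult_le_reg_r with (1 := H0'); lra.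
Qed.

Lemma cont_imag I x : cont p I x -> Rabs x * IZR (2 ^ p) <= IZR (imag I).
Proof.
  intros [H1 H2]; unfold imag.
  assert (H3 := IZR_le _ _ (Z.le_max_l (Z.abs (fst I)) (Z.abs (snd I)))).
  assert (H4 := IZR_le _ _ (Z.le_max_r (Z.abs (fst I)) (Z.abs (snd I)))).
  rewrite abs_IZR in H3, H4.
  assert (Hs := scale_gt0).
  unfold Rabs in *; repeat destruct Rcase_abs; nra.
Qed.

End IntervalArithmetic.

(** * The force field and its derivatives *)

Definition rad (x y : R) : R := sqrt (x * x + y * y).

(** The field z / |z|^3 is minus the gradient of 1 / |z|. Its derivatives are symmetric tensors, so
    one name stands for each set of equal mixed partials. *)
Definition fx (x y : R) : R := x / rad x y ^ 3.
Definition fy (x y : R) : R := y / rad x y ^ 3.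

Definition hxx (x y : R) : R := (y * y - 2 * (x * x)) / rad x y ^ 5.
Definition hxy (x y : R) : R := - 3 * (x * y) / rad x y ^ 5.
Definition hyy (x y : R) : R := (x * x - 2 * (y * y)) / rad x y ^ 5.

Definition txxx (x y : R) : R := x * (6 * (x * x) - 9 * (y * y)) / rad x y ^ 7.
Definition txxy (x y : R) : R := y * (12 * (x * x) - 3 * (y * y)) / rad x y ^ 7.
Definition txyy (x y : R) : R := x * (12 * (y * y) - 3 * (x * x)) / rad x y ^ 7.
Definition tyyy (x y : R) : R := y * (6 * (y * y) - 9 * (x * x)) / rad x y ^ 7.

Lemma rad_gt0 x y : 0 < x * x + y * y -> 0 < rad x y.
Proof. apply sqrt_lt_R0. Qed.

Lemma rad_ge0 x y : 0 <= rad x y.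
Proof. apply sqrt_pos. Qed.

Lemma rad_sqr x y : rad x y * rad x y = x * x + y * y.
Proof. apply sqrt_sqrt; nra. Qed.

(** All derivatives of the field are polynomials over odd powers of [rad], so one quotient rule
    along a line serves for every order. The derivative of [rad] is a scalar product over [rad];
    clearing it raises the exponent by two and multiplies [dN] by the squared radius. *)
Lemma is_derive_div_rad (N : R -> R) (dN a h b k t : R) (n : nat) :
  0 < (a + t * h) * (a + t * h) + (b + t * k) * (b + t * k) ->
  is_derive N t dN ->
  is_derive (fun t => N t / rad (a + t * h) (b + t * k) ^ S n) t
    ((dN * ((a + t * h) * (a + t * h) + (b + t * k) * (b + t * k))
      - INR (S n) * N t * ((a + t * h) * h + (b + t * k) * k))
     / rad (a + t * h) (b + t * k) ^ S (S (S n))).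
Proof.
  intros Hz HN.
  assert (HD : is_derive (fun t => rad (a + t * h) (b + t * k)) t
    (((a + t * h) * h + (b + t * k) * k) / rad (a + t * h) (b + t * k))).
  { assert (Hr := rad_gt0 _ _ Hz).
    unfold rad in *; auto_derive; [exact Hz|]. field; lra. }
  assert (Hr := rad_gt0 _ _ Hz); assert (Hr2 := rad_sqr (a + t * h) (b + t * k)).
  evar_last.
  - apply @is_derive_div; [exact HN | apply is_derive_pow, HD | apply pow_nonzero; lra].
  - rewrite <- Hr2; set (r := rad _ _) in *.
    assert (Hrn : r ^ n <> 0) by (apply pow_nonzero; lra).
    simpl pred; simpl pow.
    unfold Rdiv; field; split; [exact Hrn | lra].
Qed.

Section Line.

Variables a h b k t : R.
Hypothesis Hz : 0 < (a + t * h) * (a + t * h) + (b + t * k) * (b + t * k).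

Let X := a + t * h.
Let Y := b + t * k.

Lemma is_derive_fx :
  is_derive (fun t => fx (a + t * h) (b + t * k)) t (hxx X Y * h + hxy X Y * k).
Proof.
  evar_last.
  - apply (is_derive_div_rad (fun t => a + t * h) h); [exact Hz | auto_derive; [trivial|ring]].
  - assert (Hr := rad_gt0 _ _ Hz); simpl INR.
    unfold hxx, hxy, X, Y; field; lra.
Qed.

Lemma is_derive_fy :
  is_derive (fun t => fy (a + t * h) (b + t * k)) t (hxy X Y * h + hyy X Y * k).
Proof.
  evar_last.
  - apply (is_derive_div_rad (fun t => b + t * k) k); [exact Hz | auto_derive; [trivial|ring]].
  - assert (Hr := rad_gt0 _ _ Hz); simpl INR.
    unfold hyy, hxy, X, Y; field; lra.
Qed.

Lemma is_derive_hxx :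
  is_derive (fun t => hxx (a + t * h) (b + t * k)) t (txxx X Y * h + txxy X Y * k).
Proof.
  evar_last.
  - apply (is_derive_div_rad
      (fun t => (b + t * k) * (b + t * k) - 2 * ((a + t * h) * (a + t * h)))
      (2 * Y * k - 4 * X * h)); [exact Hz | unfold X, Y; auto_derive; [trivial|ring]].
  - assert (Hr := rad_gt0 _ _ Hz); simpl INR.
    unfold txxx, txxy, X, Y; field; lra.
Qed.

Lemma is_derive_hxy :
  is_derive (fun t => hxy (a + t * h) (b + t * k)) t (txxy X Y * h + txyy X Y * k).
Proof.
  evar_last.
  - apply (is_derive_div_rad
      (fun t => - 3 * ((a + t * h) * (b + t * k)))
      (- 3 * (h * Y + X * k))); [exact Hz | unfold X, Y; auto_derive; [trivial|ring]].
  - assert (Hr := rad_gt0 _ _ Hz); simpl INR.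
    unfold txxy, txyy, X, Y; field; lra.
Qed.

Lemma is_derive_hyy :
  is_derive (fun t => hyy (a + t * h) (b + t * k)) t (txyy X Y * h + tyyy X Y * k).
Proof.
  evar_last.
  - apply (is_derive_div_rad
      (fun t => (a + t * h) * (a + t * h) - 2 * ((b + t * k) * (b + t * k)))
      (2 * X * h - 4 * Y * k)); [exact Hz | unfold X, Y; auto_derive; [trivial|ring]].
  - assert (Hr := rad_gt0 _ _ Hz); simpl INR.
    unfold txyy, tyyy, X, Y; field; lra.
Qed.

End Line.

Lemma mean_value_01 (g dg : R -> R) :
  (forall t, 0 <= t <= 1 -> is_derive g t (dg t)) ->
  exists t, 0 <= t <= 1 /\ g 1 - g 0 = dg t.
Proof.
  intros H.
  destruct (MVT_cor2 g dg 0 1 Rlt_0_1) as [t [E Ht]].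
  { intros c Hc; apply is_derive_Reals, H, Hc. }
  exists t; split; [lra|]; rewrite E; ring.
Qed.

Lemma fx_mean_value x y x' y' :
  (forall t, 0 <= t <= 1 ->
     0 < (x' + t * (x - x')) * (x' + t * (x - x')) + (y' + t * (y - y')) * (y' + t * (y - y'))) ->
  exists t, 0 <= t <= 1 /\
    fx x y - fx x' y'
    = hxx (x' + t * (x - x')) (y' + t * (y - y')) * (x - x')
      + hxy (x' + t * (x - x')) (y' + t * (y - y')) * (y - y').
Proof.
  intros H.
  destruct (mean_value_01 _ _ (fun t Ht => is_derive_fx x' (x - x') y' (y - y') t (H t Ht)))
    as [t [Ht E]].
  exists t; split; [exact Ht|]; rewrite <- E; f_equal; f_equal; ring.
Qed.

Lemma fy_mean_value x y x' y' :
  (forall t, 0 <= t <= 1 ->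
     0 < (x' + t * (x - x')) * (x' + t * (x - x')) + (y' + t * (y - y')) * (y' + t * (y - y'))) ->
  exists t, 0 <= t <= 1 /\
    fy x y - fy x' y'
    = hxy (x' + t * (x - x')) (y' + t * (y - y')) * (x - x')
      + hyy (x' + t * (x - x')) (y' + t * (y - y')) * (y - y').
Proof.
  intros H.
  destruct (mean_value_01 _ _ (fun t Ht => is_derive_fy x' (x - x') y' (y - y') t (H t Ht)))
    as [t [Ht E]].
  exists t; split; [exact Ht|]; rewrite <- E; f_equal; f_equal; ring.
Qed.

(** * Bisection, and enclosures of the force field *)

Definition width (I : itv) : Z := (snd I - fst I)%Z.

Fixpoint max_width (B : list itv) : Z :=
  match B with
  | [] => 0%Z
  | J :: B' => Z.max (width J) (max_width B')
  end.

(** With [w] the maximal width this halves the first of the widest intervals. The halves share the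
    midpoint, so every point of the box stays covered. *)
Fixpoint split_at_width (w : Z) (B : list itv) : list itv * list itv :=
  match B with
  | [] => ([], [])
  | J :: B' =>
      if (w <=? width J)%Z then
        let m := Z.div2 (fst J + snd J) in ((fst J, m) :: B', (m, snd J) :: B')
      else
        let (B1, B2) := split_at_width w B' in (J :: B1, J :: B2)
  end.

(** [fuel] bounds the depth of the tree, not its size. The [if] in place of a conjunction skips the
    second half under call by value once the first has failed. *)
Fixpoint bisect (test : list itv -> bool) (fuel : nat) (B : list itv) : bool :=
  if test B then true
  else match fuel with
       | O => false
       | S n =>
           let (B1, B2) := split_at_width (max_width B) B in
           if bisect test n B1 then bisect test n B2 else false
       end.

Lemma split_at_width_cover p w B v :
  Forall2 (cont p) B v ->
  Forall2 (cont p) (fst (split_at_width w B)) v \/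
  Forall2 (cont p) (snd (split_at_width w B)) v.
Proof.
  intros H; induction H as [|I x B v Hx HB IH]; [left; constructor|].
  cbn [split_at_width]; destruct (w <=? width I)%Z.
  - cbn [fst snd]; destruct Hx as [H1 H2].
    destruct (Rle_dec (x * IZR (2 ^ p)) (IZR (Z.div2 (fst I + snd I)))) as [Hl|Hl];
      [left | right]; constructor; trivial; split; cbn [fst snd]; lra.
  - destruct (split_at_width w B) as [B1 B2]; cbn [fst snd] in *.
    destruct IH; [left | right]; constructor; trivial.
Qed.

Lemma bisect_sound (p : Z) (test : list itv -> bool) (P : list R -> Prop) :
  (forall B v, test B = true -> Forall2 (cont p) B v -> P v) ->
  forall fuel B v, bisect test fuel B = true -> Forall2 (cont p) B v -> P v.
Proof.
  intros Htest; induction fuel as [|n IH]; intros B v; cbn [bisect];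
    destruct (test B) eqn:E; intros Hb HB; try (now apply (Htest B)); try discriminate.
  assert (C := split_at_width_cover p (max_width B) B v HB).
  destruct (split_at_width (max_width B) B) as [B1 B2]; cbn [fst snd] in C.
  destruct (bisect test n B1) eqn:E1; [|discriminate].
  destruct C as [C|C]; [apply (IH B1) | apply (IH B2)]; assumption.
Qed.

Section Kernels.

Variable p : Z.
Hypothesis p_ge0 : (0 <= p)%Z.

Definition irng (a b d : Z) : itv := (fst (icst p a d), snd (icst p b d)).

Lemma cont_irng a b d x :
  (0 < d)%Z -> IZR a / IZR d <= x <= IZR b / IZR d -> cont p (irng a b d) x.
Proof.
  intros Hd Hx.
  destruct (cont_icst p a d Hd) as [H1 _]; destruct (cont_icst p b d Hd) as [_ H2].
  assert (Hs := scale_gt0 p p_ge0).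
  split; unfold irng; cbn [fst snd] in *; nra.
Qed.

Definition irad2 (I J : itv) : itv := iadd (isqr p I) (isqr p J).
Definition iinvrad (I J : itv) : itv := iinv p 1 (isqrt p (irad2 I J)).

Lemma cont_irad2 I J x y :
  cont p I x -> cont p J y -> cont p (irad2 I J) (x * x + y * y).
Proof. intros; apply cont_iadd; now apply cont_isqr. Qed.

Lemma irad2_gt0 I J x y :
  (0 < fst (irad2 I J))%Z -> cont p I x -> cont p J y -> 0 < x * x + y * y.
Proof.
  intros H0 Hx Hy; destruct (cont_irad2 _ _ _ _ Hx Hy) as [H _].
  apply IZR_lt in H0; assert (Hs := scale_gt0 p p_ge0); nra.
Qed.

Lemma cont_iinvrad I J x y :
  (0 < fst (irad2 I J))%Z -> cont p I x -> cont p J y ->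
  cont p (iinvrad I J) (1 / rad x y).
Proof.
  intros H0 Hx Hy; apply cont_iinv; trivial; [lia| |].
  - cbn [fst isqrt]; apply Z.sqrt_pos.
    apply Z.mul_pos_pos; [exact H0|]; apply Z.pow_pos_nonneg; lia.
  - apply cont_isqrt; [exact p_ge0 | lia | now apply cont_irad2].
Qed.

Definition ikern (I J : itv) : itv * itv :=
  let i1 := iinvrad I J in
  let i3 := imul p i1 (isqr p i1) in
  (imul p I i3, imul p J i3).

Definition ihess (I J : itv) : itv * itv * itv :=
  let x2 := isqr p I in
  let y2 := isqr p J in
  let i1 := iinv p 1 (isqrt p (iadd x2 y2)) in
  let i2 := isqr p i1 in
  let i5 := imul p i2 (imul p i2 i1) in
  (imul p (isub y2 (iint 2 x2)) i5,
   imul p (iint (-3) (imul p I J)) i5,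
   imul p (isub x2 (iint 2 y2)) i5).

Definition ithird (I J : itv) : itv * itv * itv * itv :=
  let x2 := isqr p I in
  let y2 := isqr p J in
  let i1 := iinv p 1 (isqrt p (iadd x2 y2)) in
  let i2 := isqr p i1 in
  let i7 := imul p (isqr p i2) (imul p i2 i1) in
  (imul p (imul p I (isub (iint 6 x2) (iint 9 y2))) i7,
   imul p (imul p J (isub (iint 12 x2) (iint 3 y2))) i7,
   imul p (imul p I (isub (iint 12 y2) (iint 3 x2))) i7,
   imul p (imul p J (isub (iint 6 y2) (iint 9 x2))) i7).

Lemma cont_ikern {I J x y} :
  (0 < fst (irad2 I J))%Z -> cont p I x -> cont p J y ->
  cont p (fst (ikern I J)) (fx x y) /\ cont p (snd (ikern I J)) (fy x y).
Proof.
  intros H0 Hx Hy; assert (H1 := cont_iinvrad _ _ _ _ H0 Hx Hy).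
  assert (Hr := rad_gt0 _ _ (irad2_gt0 _ _ _ _ H0 Hx Hy)).
  unfold fx, fy.
  replace (x / rad x y ^ 3) with (x * (1 / rad x y * (1 / rad x y * (1 / rad x y)))) by (field; lra).
  replace (y / rad x y ^ 3) with (y * (1 / rad x y * (1 / rad x y * (1 / rad x y)))) by (field; lra).
  split; repeat first [assumption | apply cont_imul | apply cont_isqr].
Qed.

Lemma cont_ihess {I J x y} :
  (0 < fst (irad2 I J))%Z -> cont p I x -> cont p J y ->
  cont p (fst (fst (ihess I J))) (hxx x y) /\
  cont p (snd (fst (ihess I J))) (hxy x y) /\
  cont p (snd (ihess I J)) (hyy x y).
Proof.
  intros H0 Hx Hy; assert (H1 := cont_iinvrad _ _ _ _ H0 Hx Hy).
  assert (Hr := rad_gt0 _ _ (irad2_gt0 _ _ _ _ H0 Hx Hy)).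
  unfold hxx, hxy, hyy; change (iinvrad I J) with (iinv p 1 (isqrt p (iadd (isqr p I) (isqr p J)))) in H1.
  set (i := 1 / rad x y) in *.
  assert (E : / rad x y ^ 5 = (i * i) * ((i * i) * i)) by (unfold i; field; lra).
  unfold Rdiv; rewrite E.
  repeat split; cbn [fst snd ihess];
    repeat first [assumption | apply cont_isqr | apply cont_imul | apply cont_isub | apply cont_iint].
Qed.

Lemma cont_ithird {I J x y} :
  (0 < fst (irad2 I J))%Z -> cont p I x -> cont p J y ->
  cont p (fst (fst (fst (ithird I J)))) (txxx x y) /\
  cont p (snd (fst (fst (ithird I J)))) (txxy x y) /\
  cont p (snd (fst (ithird I J))) (txyy x y) /\
  cont p (snd (ithird I J)) (tyyy x y).
Proof.
  intros H0 Hx Hy; assert (H1 := cont_iinvrad _ _ _ _ H0 Hx Hy).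
  assert (Hr := rad_gt0 _ _ (irad2_gt0 _ _ _ _ H0 Hx Hy)).
  unfold txxx, txxy, txyy, tyyy;
    change (iinvrad I J) with (iinv p 1 (isqrt p (iadd (isqr p I) (isqr p J)))) in H1.
  set (i := 1 / rad x y) in *.
  assert (E : / rad x y ^ 7 = ((i * i) * (i * i)) * ((i * i) * i)) by (unfold i; field; lra).
  unfold Rdiv; rewrite E.
  repeat split; cbn [fst snd ithird];
    repeat first [assumption | apply cont_isqr | apply cont_imul | apply cont_isub | apply cont_iint].
Qed.

End Kernels.

(** * The field of the heavy bodies *)

Lemma m1_eq : m1 = 999999925 / 2000000000.
Proof. unfold m1; field. Qed.

Lemma mu_eq : mu = 25 / 1000000000.
Proof. unfold mu; field. Qed.

(** G is the gradient of |z|^2 / 2 + m1 / |z - q1| + m1 / |z - q2| with q1 = (Q, 0) and q2 = (E, F).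
    The equation of a light body equates G with the sum of the terms of the other light bodies. *)
Definition Gx (Q E F x y : R) : R := x - m1 * (fx (x - Q) y + fx (x - E) (y - F)).
Definition Gy (Q E F x y : R) : R := y - m1 * (fy (x - Q) y + fy (x - E) (y - F)).

Definition Gxx (Q E F x y : R) : R := 1 - m1 * (hxx (x - Q) y + hxx (x - E) (y - F)).
Definition Gxy (Q E F x y : R) : R := - (m1 * (hxy (x - Q) y + hxy (x - E) (y - F))).
Definition Gyy (Q E F x y : R) : R := 1 - m1 * (hyy (x - Q) y + hyy (x - E) (y - F)).

Definition Gxxx (Q E F x y : R) : R := - (m1 * (txxx (x - Q) y + txxx (x - E) (y - F))).
Definition Gxxy (Q E F x y : R) : R := - (m1 * (txxy (x - Q) y + txxy (x - E) (y - F))).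
Definition Gxyy (Q E F x y : R) : R := - (m1 * (txyy (x - Q) y + txyy (x - E) (y - F))).
Definition Gyyy (Q E F x y : R) : R := - (m1 * (tyyy (x - Q) y + tyyy (x - E) (y - F))).

Definition heavy_near (Q E F : R) : Prop :=
  4999995 / 10000000 <= Q <= 5000005 / 10000000 /\
  -5000006 / 10000000 <= E <= -4999994 / 10000000 /\
  -2 / 10000000 <= F <= 0.

Section SegmentDerivatives.

Variables Q E F a b h k : R.
Hypothesis HF : F <= 0.

(** For F <= 0 both heavy bodies lie outside the open upper half-plane. That half-plane is convex,
    so a segment between two of its points meets no singularity of G. *)
Local Lemma seg_pos t :
  0 < b + t * k -> 0 < (a - Q + t * h) * (a - Q + t * h) + (b + t * k) * (b + t * k).
Proof.
  intros H; apply Rplus_le_lt_0_compat; [apply Rle_0_sqr | now apply Rmult_lt_0_compat].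
Qed.

Local Lemma seg_pos' t :
  0 < b + t * k -> 0 < (a - E + t * h) * (a - E + t * h) + (b - F + t * k) * (b - F + t * k).
Proof.
  intros H; apply Rplus_le_lt_0_compat; [apply Rle_0_sqr | apply Rmult_lt_0_compat; lra].
Qed.

Lemma is_derive_two_body (f : R -> R -> R) (c d1 d2 t : R) (l : R -> R) (dl : R) :
  is_derive l t dl ->
  is_derive (fun t => f (a - Q + t * h) (b + t * k)) t d1 ->
  is_derive (fun t => f (a - E + t * h) (b - F + t * k)) t d2 ->
  is_derive (fun t => l t - c * (f (a + t * h - Q) (b + t * k) + f (a + t * h - E) (b + t * k - F)))
    t (dl - c * (d1 + d2)).
Proof.
  intros H0 H1 H2.
  apply (is_derive_ext
    (fun t => l t - c * (f (a - Q + t * h) (b + t * k) + f (a - E + t * h) (b - F + t * k)))).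
  { intros s; f_equal; f_equal; f_equal; f_equal; ring. }
  apply @is_derive_minus; [exact H0|].
  apply is_derive_scal, @is_derive_plus; assumption.
Qed.

Lemma is_derive_G (u v t : R) : 0 < b + t * k ->
  is_derive (fun t => u * Gx Q E F (a + t * h) (b + t * k) + v * Gy Q E F (a + t * h) (b + t * k)) t
    (u * (Gxx Q E F (a + t * h) (b + t * k) * h + Gxy Q E F (a + t * h) (b + t * k) * k)
     + v * (Gxy Q E F (a + t * h) (b + t * k) * h + Gyy Q E F (a + t * h) (b + t * k) * k)).
Proof.
  intros Ht; assert (P1 := seg_pos t Ht); assert (P2 := seg_pos' t Ht).
  apply @is_derive_plus; apply is_derive_scal.
  - unfold Gx; evar_last.
    + apply is_derive_two_body with (dl := h);
        [auto_derive; [trivial|ring] | apply is_derive_fx, P1 | apply is_derive_fx, P2].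
    + unfold Gxx, Gxy.
      replace (a + t * h - Q) with (a - Q + t * h) by ring.
      replace (a + t * h - E) with (a - E + t * h) by ring.
      replace (b + t * k - F) with (b - F + t * k) by ring.
      ring.
  - unfold Gy; evar_last.
    + apply is_derive_two_body with (dl := k);
        [auto_derive; [trivial|ring] | apply is_derive_fy, P1 | apply is_derive_fy, P2].
    + unfold Gxy, Gyy.
      replace (a + t * h - Q) with (a - Q + t * h) by ring.
      replace (a + t * h - E) with (a - E + t * h) by ring.
      replace (b + t * k - F) with (b - F + t * k) by ring.
      ring.
Qed.

Ltac second_derivative L t :=
  let Ht := fresh in
  intros Ht;
  evar_last;
  [ apply is_derive_two_body with (dl := 0);
      [apply @is_derive_const | apply L, seg_pos, Ht | apply L, seg_pos', Ht]
  | replace (a + t * h - Q) with (a - Q + t * h) by ring;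
    replace (a + t * h - E) with (a - E + t * h) by ring;
    replace (b + t * k - F) with (b - F + t * k) by ring;
    ring ].

Lemma is_derive_Gxx t : 0 < b + t * k ->
  is_derive (fun t => Gxx Q E F (a + t * h) (b + t * k)) t
    (Gxxx Q E F (a + t * h) (b + t * k) * h + Gxxy Q E F (a + t * h) (b + t * k) * k).
Proof. unfold Gxx, Gxxx, Gxxy; second_derivative is_derive_hxx t. Qed.

Lemma is_derive_Gxy t : 0 < b + t * k ->
  is_derive (fun t => Gxy Q E F (a + t * h) (b + t * k)) t
    (Gxxy Q E F (a + t * h) (b + t * k) * h + Gxyy Q E F (a + t * h) (b + t * k) * k).
Proof.
  intros Ht.
  apply (is_derive_ext (fun t => 0 - m1 * (hxy (a + t * h - Q) (b + t * k)
    + hxy (a + t * h - E) (b + t * k - F)))).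
  { intros s; apply Rminus_0_l. }
  revert Ht; unfold Gxxy, Gxyy; second_derivative is_derive_hxy t.
Qed.

Lemma is_derive_Gyy t : 0 < b + t * k ->
  is_derive (fun t => Gyy Q E F (a + t * h) (b + t * k)) t
    (Gxyy Q E F (a + t * h) (b + t * k) * h + Gyyy Q E F (a + t * h) (b + t * k) * k).
Proof. unfold Gyy, Gxyy, Gyyy; second_derivative is_derive_hyy t. Qed.

End SegmentDerivatives.

Lemma seg_in l u x x' t : l <= x <= u -> l <= x' <= u -> 0 <= t <= 1 -> l <= x' + t * (x - x') <= u.
Proof. intros; split; nra. Qed.

Lemma seg_gt0 x x' t : 0 < x -> 0 < x' -> 0 <= t <= 1 -> 0 < x' + t * (x - x').
Proof. intros; nra. Qed.

(** A vector-valued map has no mean value equality, so the theorem is applied to the scalar u Gx + v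
    Gy. With (u, v) the displacement, the right side is the Hessian form at one point; with (1, 0)
    or (0, 1) it is one row of the Hessian applied to the displacement. *)
Lemma G_mean_value Q E F u v x y x' y' :
  F <= 0 -> 0 < y -> 0 < y' ->
  exists t, 0 <= t <= 1 /\
    let X := x' + t * (x - x') in
    let Y := y' + t * (y - y') in
    u * (Gx Q E F x y - Gx Q E F x' y') + v * (Gy Q E F x y - Gy Q E F x' y')
    = u * (Gxx Q E F X Y * (x - x') + Gxy Q E F X Y * (y - y'))
      + v * (Gxy Q E F X Y * (x - x') + Gyy Q E F X Y * (y - y')).
Proof.
  intros HF Hy Hy'.
  destruct (mean_value_01 _ _ (fun t Ht => is_derive_G Q E F x' y' (x - x') (y - y') HF u v t
    (seg_gt0 _ _ _ Hy Hy' Ht))) as [t [Ht Et]].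
  exists t; split; [exact Ht|]; cbv zeta; rewrite <- Et.
  replace (x' + 1 * (x - x')) with x by ring; replace (y' + 1 * (y - y')) with y by ring.
  replace (x' + 0 * (x - x')) with x' by ring; replace (y' + 0 * (y - y')) with y' by ring.
  ring.
Qed.

Lemma G2_mean_value (H Hx Hy : R -> R -> R -> R -> R -> R) Q E F x y x' y' :
  (forall a b h k t, 0 < b + t * k ->
    is_derive (fun t => H Q E F (a + t * h) (b + t * k)) t
      (Hx Q E F (a + t * h) (b + t * k) * h + Hy Q E F (a + t * h) (b + t * k) * k)) ->
  0 < y -> 0 < y' ->
  exists t, 0 <= t <= 1 /\
    let X := x' + t * (x - x') in
    let Y := y' + t * (y - y') in
    H Q E F x y - H Q E F x' y' = Hx Q E F X Y * (x - x') + Hy Q E F X Y * (y - y').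
Proof.
  intros HD H0 H0'.
  destruct (mean_value_01 _ _ (fun t Ht => HD x' y' (x - x') (y - y') t
    (seg_gt0 _ _ _ H0 H0' Ht))) as [t [Ht Et]].
  exists t; split; [exact Ht|]; cbv zeta; rewrite <- Et.
  replace (x' + 1 * (x - x')) with x by ring; replace (y' + 1 * (y - y')) with y by ring.
  replace (x' + 0 * (x - x')) with x' by ring; replace (y' + 0 * (y - y')) with y' by ring.
  ring.
Qed.

(* The ordinate of the Lagrange point, sqrt 3 / 2 up to 10^-13. *)
Definition Y0 : R := 8660254037844 / 10000000000000.

(** * Interval enclosures of the heavy bodies' field and its derivatives *)

Section HeavyField.

Variable p : Z.
Hypothesis p_ge0 : (0 <= p)%Z.

Definition iQ : itv := irng p 4999995 5000005 10000000.
Definition iE : itv := irng p (-5000006) (-4999994) 10000000.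
Definition iF : itv := irng p (-2) 0 10000000.
Definition im1 : itv := icst p 999999925 2000000000.
Definition iY0 : itv := icst p 8660254037844 10000000000000.

Lemma cont_heavy Q E F : heavy_near Q E F -> cont p iQ Q /\ cont p iE E /\ cont p iF F.
Proof.
  intros [HQ [HE HF]]; repeat split; apply (cont_irng p p_ge0); try lia; lra.
Qed.

Lemma cont_im1 : cont p im1 m1.
Proof. rewrite m1_eq; apply cont_icst; lia. Qed.

Lemma cont_iY0 : cont p iY0 Y0.
Proof. apply cont_icst; lia. Qed.

Definition away_from_heavy (X Y : itv) : bool :=
  ((0 <? fst (irad2 p (isub X iQ) Y)) && (0 <? fst (irad2 p (isub X iE) (isub Y iF))))%Z.

Definition iG (X Y : itv) : itv * itv :=
  let k1 := ikern p (isub X iQ) Y in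
  let k2 := ikern p (isub X iE) (isub Y iF) in
  (isub X (imul p im1 (iadd (fst k1) (fst k2))), isub Y (imul p im1 (iadd (snd k1) (snd k2)))).

Definition iGhess (X Y : itv) : itv * itv * itv :=
  let h1 := ihess p (isub X iQ) Y in
  let h2 := ihess p (isub X iE) (isub Y iF) in
  let one := (2 ^ p, 2 ^ p)%Z in
  (isub one (imul p im1 (iadd (fst (fst h1)) (fst (fst h2)))),
   iopp (imul p im1 (iadd (snd (fst h1)) (snd (fst h2)))),
   isub one (imul p im1 (iadd (snd h1) (snd h2)))).

Definition iGthird (X Y : itv) : itv * itv * itv * itv :=
  let t1 := ithird p (isub X iQ) Y in
  let t2 := ithird p (isub X iE) (isub Y iF) in
  (iopp (imul p im1 (iadd (fst (fst (fst t1))) (fst (fst (fst t2))))),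
   iopp (imul p im1 (iadd (snd (fst (fst t1))) (snd (fst (fst t2))))),
   iopp (imul p im1 (iadd (snd (fst t1)) (snd (fst t2)))),
   iopp (imul p im1 (iadd (snd t1) (snd t2)))).

Lemma cont_one : cont p (2 ^ p, 2 ^ p)%Z 1.
Proof. unfold cont; cbn [fst snd]; lra. Qed.

Section Evaluation.

Variables (X Y : itv) (Q E F x y : R).
Hypothesis Hq : heavy_near Q E F.
Hypothesis Hx : cont p X x.
Hypothesis Hy : cont p Y y.
Hypothesis Haway : away_from_heavy X Y = true.

Local Lemma away_pos :
  (0 < fst (irad2 p (isub X iQ) Y))%Z /\ (0 < fst (irad2 p (isub X iE) (isub Y iF)))%Z.
Proof. apply andb_prop in Haway as [H1 H2]; split; now apply Z.ltb_lt. Qed.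

Ltac enclose_relative_positions :=
  destruct (cont_heavy _ _ _ Hq) as [HQ [HE HF]]; destruct away_pos as [A1 A2];
  assert (HxQ := cont_isub p Hx HQ); assert (HxE := cont_isub p Hx HE);
  assert (HyF := cont_isub p Hy HF); assert (Hm := cont_im1); assert (H1 := cont_one).

Ltac enclose_by_operations :=
  cbn [fst snd]; repeat split;
  repeat first [assumption | apply cont_imul | apply cont_isub | apply cont_iadd | apply cont_iopp].

Lemma cont_iG : cont p (fst (iG X Y)) (Gx Q E F x y) /\ cont p (snd (iG X Y)) (Gy Q E F x y).
Proof.
  enclose_relative_positions.
  destruct (cont_ikern p p_ge0 A1 HxQ Hy) as [B1 B2].
  destruct (cont_ikern p p_ge0 A2 HxE HyF) as [C1 C2].
  unfold Gx, Gy, iG; enclose_by_operations.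
Qed.

Lemma cont_iGhess :
  cont p (fst (fst (iGhess X Y))) (Gxx Q E F x y) /\
  cont p (snd (fst (iGhess X Y))) (Gxy Q E F x y) /\
  cont p (snd (iGhess X Y)) (Gyy Q E F x y).
Proof.
  enclose_relative_positions.
  destruct (cont_ihess p p_ge0 A1 HxQ Hy) as [B1 [B2 B3]].
  destruct (cont_ihess p p_ge0 A2 HxE HyF) as [C1 [C2 C3]].
  unfold Gxx, Gxy, Gyy, iGhess; enclose_by_operations.
Qed.

Lemma cont_iGthird :
  cont p (fst (fst (fst (iGthird X Y)))) (Gxxx Q E F x y) /\
  cont p (snd (fst (fst (iGthird X Y)))) (Gxxy Q E F x y) /\
  cont p (snd (fst (iGthird X Y))) (Gxyy Q E F x y) /\
  cont p (snd (iGthird X Y)) (Gyyy Q E F x y).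
Proof.
  enclose_relative_positions.
  destruct (cont_ithird p p_ge0 A1 HxQ Hy) as [B1 [B2 [B3 B4]]].
  destruct (cont_ithird p p_ge0 A2 HxE HyF) as [C1 [C2 [C3 C4]]].
  unfold Gxxx, Gxxy, Gxyy, Gyyy, iGthird; enclose_by_operations.
Qed.

End Evaluation.

Definition lower (n d : Z) (J : itv) : bool := (n * 2 ^ p <=? d * fst J)%Z.
Definition upper (n d : Z) (J : itv) : bool := (d * snd J <=? n * 2 ^ p)%Z.

Lemma lower_correct n d J x : (0 < d)%Z -> lower n d J = true -> cont p J x -> IZR n / IZR d <= x.
Proof.
  intros Hd H [H1 _]; apply Z.leb_le, IZR_le in H; rewrite !mult_IZR in H.
  apply IZR_lt in Hd; assert (Hs := scale_gt0 p p_ge0).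
  apply Rmult_le_reg_r with (1 := Hd), Rmult_le_reg_r with (1 := Hs).
  replace (IZR n / IZR d * IZR d) with (IZR n) by (field; lra); nra.
Qed.

Lemma upper_correct n d J x : (0 < d)%Z -> upper n d J = true -> cont p J x -> x <= IZR n / IZR d.
Proof.
  intros Hd H [_ H1]; apply Z.leb_le, IZR_le in H; rewrite !mult_IZR in H.
  apply IZR_lt in Hd; assert (Hs := scale_gt0 p p_ge0).
  apply Rmult_le_reg_r with (1 := Hd), Rmult_le_reg_r with (1 := Hs).
  replace (IZR n / IZR d * IZR d) with (IZR n) by (field; lra); nra.
Qed.

Definition iabs (J : itv) : itv := (0, imag J)%Z.

Lemma cont_iabs J x : cont p J x -> cont p (iabs J) (Rabs x).
Proof.
  intros H; split; [|now apply cont_imag].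
  cbn [fst iabs]; apply Rmult_le_pos; [apply Rabs_pos | left; now apply scale_gt0].
Qed.

(** Definiteness by weighted diagonal dominance. The estimate 2 |b h k| <= |b| h^2 / 2 + 2 |b| k^2
    turns the first two bounds into the lower form 3/10 h^2 + 3/2 k^2, charging most of the cross
    term to the stiffer ordinate; equal weights turn the last two into the upper form 19/5 (h^2 +
    k^2). *)
Definition box_hessian_test (B : list itv) : bool :=
  match B with
  | [X; Y] =>
      if away_from_heavy X Y then
        let H := iGhess X Y in
        let a := fst (fst H) in
        let b := iabs (snd (fst H)) in
        let c := snd H in
        if lower 3 5 (isub (iint 2 a) b) then
          if lower 3 2 (isub c (iint 2 b)) then
            if upper 19 5 (iadd a b) then upper 19 5 (iadd c b) else false
          else false
        else false
      else false
  | _ => false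
  end.

Lemma box_hessian_test_correct B v Q E F :
  heavy_near Q E F -> box_hessian_test B = true -> Forall2 (cont p) B v ->
  match v with
  | [x; y] =>
      3 / 5 <= 2 * Gxx Q E F x y - Rabs (Gxy Q E F x y) /\
      3 / 2 <= Gyy Q E F x y - 2 * Rabs (Gxy Q E F x y) /\
      Gxx Q E F x y + Rabs (Gxy Q E F x y) <= 19 / 5 /\
      Gyy Q E F x y + Rabs (Gxy Q E F x y) <= 19 / 5
  | _ => True
  end.
Proof.
  intros Hq HT HB.
  destruct HB as [|X x B v Hx HB]; [exact Logic.I|].
  destruct HB as [|Y y B v Hy HB]; [exact Logic.I|].
  destruct HB as [|Z z B v Hz HB]; [|exact Logic.I].
  unfold box_hessian_test in HT.
  destruct (away_from_heavy X Y) eqn:A; [|discriminate]; cbv zeta in HT.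
  destruct (cont_iGhess X Y Q E F x y Hq Hx Hy A) as [Ha [Hb Hc]].
  apply cont_iabs in Hb.
  destruct (lower 3 5 _) eqn:T1 in HT; [|discriminate].
  destruct (lower 3 2 _) eqn:T2 in HT; [|discriminate].
  destruct (upper 19 5 _) eqn:T3 in HT; [|discriminate].
  repeat split.
  - apply (lower_correct 3 5 _ _ eq_refl T1).
    apply cont_isub; [apply (cont_iint p 2)|]; assumption.
  - apply (lower_correct 3 2 _ _ eq_refl T2).
    apply cont_isub; [|apply (cont_iint p 2)]; assumption.
  - apply (upper_correct 19 5 _ _ eq_refl T3); now apply cont_iadd.
  - apply (upper_correct 19 5 _ _ eq_refl HT); now apply cont_iadd.
Qed.

End HeavyField.

Lemma box_hessian Q E F x y :
  heavy_near Q E F -> -2 / 10 <= x <= 2 / 10 -> 7 / 10 <= y <= 10 / 10 ->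
  3 / 5 <= 2 * Gxx Q E F x y - Rabs (Gxy Q E F x y) /\
  3 / 2 <= Gyy Q E F x y - 2 * Rabs (Gxy Q E F x y) /\
  Gxx Q E F x y + Rabs (Gxy Q E F x y) <= 19 / 5 /\
  Gyy Q E F x y + Rabs (Gxy Q E F x y) <= 19 / 5.
Proof.
  intros Hq Hx Hy.
  assert (C : bisect (box_hessian_test 14) 20 [irng 14 (-2) 2 10; irng 14 7 10 10] = true)
    by (vm_cast_no_check (eq_refl true)).
  refine (bisect_sound 14 _ _ (fun B v => box_hessian_test_correct 14 ltac:(lia) B v Q E F Hq)
    _ _ [x; y] C _).
  constructor; [|constructor; [|constructor]]; apply cont_irng; lia || lra.
Qed.

(** The box is the one that the virial bound yields in [light_system_near]. At the Lagrange point
    Gxxx and Gxyy nearly cancel by symmetry, while Gxxy and Gyyy are about -0.65 and -1.95; the rest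
    of the constants covers the variation over the box and the overestimation of interval
    arithmetic. *)
Lemma third_derivatives_near Q E F x y :
  heavy_near Q E F -> -12 / 1000 <= x <= 12 / 1000 -> -54 / 10000 <= y - Y0 <= 54 / 10000 ->
  Rabs (Gxxx Q E F x y) <= 35 / 100 /\ Rabs (Gxxy Q E F x y) <= 88 / 100 /\
  Rabs (Gxyy Q E F x y) <= 50 / 100 /\ Rabs (Gyyy Q E F x y) <= 230 / 100.
Proof.
  intros Hq Hx Hy.
  assert (p_ge0 : (0 <= 30)%Z) by lia.
  set (X := irng 30 (-12) 12 1000); set (Y := iadd (iY0 30) (irng 30 (-54) 54 10000)).
  assert (cX : cont 30 X x) by (apply cont_irng; lia || lra).
  assert (cY : cont 30 Y y).
  { replace y with (Y0 + (y - Y0)) by ring.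
    apply cont_iadd; [apply cont_iY0 | apply cont_irng; lia || lra]. }
  assert (A : away_from_heavy 30 X Y = true) by (vm_cast_no_check (eq_refl true)).
  destruct (cont_iGthird 30 p_ge0 X Y Q E F x y Hq cX cY A) as [B1 [B2 [B3 B4]]].
  apply (cont_iabs 30 p_ge0) in B1, B2, B3, B4.
  repeat split; (eapply (upper_correct 30 p_ge0); [lia | | eassumption]);
    vm_cast_no_check (eq_refl true).
Qed.

(** With masses 1/2 at (1/2, 0) and (-1/2, 0), G vanishes at the apex of the equilateral triangle
    and its derivative there is diag(3/4, 9/4). The tolerances absorb the displacements allowed by
    [heavy_near] and the deficit of [m1]. *)
Lemma lagrange_point Q E F :
  heavy_near Q E F ->
  Rabs (Gx Q E F 0 Y0) <= 12 / 10000000 /\ Rabs (Gy Q E F 0 Y0) <= 12 / 10000000 /\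
  Rabs (Gxx Q E F 0 Y0 - 3 / 4) <= 1 / 100000 /\ Rabs (Gxy Q E F 0 Y0) <= 1 / 100000 /\
  Rabs (Gyy Q E F 0 Y0 - 9 / 4) <= 1 / 100000.
Proof.
  intros Hq.
  assert (p_ge0 : (0 <= 40)%Z) by lia.
  set (X := (0, 0)%Z : itv).
  assert (cX : cont 40 X 0) by (split; cbn [fst snd X]; lra).
  assert (cY := cont_iY0 40).
  assert (A : away_from_heavy 40 X (iY0 40) = true) by (vm_cast_no_check (eq_refl true)).
  destruct (cont_iG 40 p_ge0 X (iY0 40) Q E F 0 Y0 Hq cX cY A) as [B1 B2].
  destruct (cont_iGhess 40 p_ge0 X (iY0 40) Q E F 0 Y0 Hq cX cY A) as [B3 [B4 B5]].
  assert (B6 := cont_isub 40 B3 (cont_icst 40 3 4 eq_refl)).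
  assert (B7 := cont_isub 40 B5 (cont_icst 40 9 4 eq_refl)).
  apply (cont_iabs 40 p_ge0) in B1, B2, B4, B6, B7.
  repeat split; (eapply (upper_correct 40 p_ge0); [lia | | eassumption]);
    vm_cast_no_check (eq_refl true).
Qed.

(** * Convexity of the potential and linearisation of its gradient *)

Definition in_light_box (x y : R) : Prop := -2 / 10 <= x <= 2 / 10 /\ 7 / 10 <= y <= 10 / 10.

Lemma Rabs_le_inv a b : Rabs a <= b -> - b <= a <= b.
Proof. unfold Rabs; destruct Rcase_abs; lra. Qed.

Lemma cross_term_le (b h k : R) : 2 * Rabs (b * h * k) <= Rabs b * (h * h) + Rabs b * (k * k).
Proof.
  rewrite !Rabs_mult.
  assert (H := Rabs_pos b).
  assert (Eh : h * h = Rabs h * Rabs h) by (rewrite <- Rabs_mult; symmetry; apply Rabs_pos_eq, Rle_0_sqr).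
  assert (Ek : k * k = Rabs k * Rabs k) by (rewrite <- Rabs_mult; symmetry; apply Rabs_pos_eq, Rle_0_sqr).
  rewrite Eh, Ek; assert (H2 := Rle_0_sqr (Rabs h - Rabs k)); unfold Rsqr in H2; nra.
Qed.

Lemma G_strongly_monotone Q E F x y :
  heavy_near Q E F -> in_light_box x y ->
  3 / 10 * (x * x) + 3 / 2 * ((y - Y0) * (y - Y0))
  <= x * (Gx Q E F x y - Gx Q E F 0 Y0) + (y - Y0) * (Gy Q E F x y - Gy Q E F 0 Y0).
Proof.
  intros Hq [Hx Hy].
  assert (HY0 : 7 / 10 <= Y0 <= 10 / 10) by (unfold Y0; lra).
  destruct (G_mean_value Q E F x (y - Y0) x y 0 Y0) as [t [Ht Et]]; [apply Hq | lra | lra |].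
  cbv zeta in Et; rewrite Et.
  assert (BX := seg_in _ _ x 0 t Hx ltac:(lra) Ht).
  assert (BY := seg_in _ _ y Y0 t Hy HY0 Ht).
  destruct (box_hessian Q E F _ _ Hq BX BY) as [H1 [H2 _]].
  set (a := Gxx _ _ _ _ _) in *; set (b := Gxy _ _ _ _ _) in *; set (c := Gyy _ _ _ _ _) in *.
  rewrite Rminus_0_r; set (k := y - Y0) in *.
  assert (C1 := Rle_abs (- (b * (x * (2 * k))))).
  assert (C2 := Rle_0_sqr x); assert (C3 := Rle_0_sqr k); unfold Rsqr in C2, C3.
  (* Doubling k before the estimate of the cross term produces the weights 1/2 and 2 that
     [box_hessian] provides for. *)
  assert (C4 : 2 * Rabs (- (b * (x * (2 * k)))) <= Rabs b * (x * x) + 4 * (Rabs b * (k * k))).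
  { rewrite Rabs_Ropp, <- Rmult_assoc; assert (C := cross_term_le b x (2 * k)); lra. }
  nra.
Qed.

Lemma G_lipschitz Q E F x y x' y' :
  heavy_near Q E F -> in_light_box x y -> in_light_box x' y' ->
  (x - x') * (Gx Q E F x y - Gx Q E F x' y') + (y - y') * (Gy Q E F x y - Gy Q E F x' y')
  <= 19 / 5 * ((x - x') * (x - x') + (y - y') * (y - y')).
Proof.
  intros Hq [Hx Hy] [Hx' Hy'].
  destruct (G_mean_value Q E F (x - x') (y - y') x y x' y') as [t [Ht Et]]; [apply Hq | lra | lra |].
  cbv zeta in Et; rewrite Et.
  assert (BX := seg_in _ _ x x' t Hx Hx' Ht).
  assert (BY := seg_in _ _ y y' t Hy Hy' Ht).
  destruct (box_hessian Q E F _ _ Hq BX BY) as [_ [_ [H1 H2]]].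
  set (a := Gxx _ _ _ _ _) in *; set (b := Gxy _ _ _ _ _) in *; set (c := Gyy _ _ _ _ _) in *.
  set (h := x - x') in *; set (k := y - y') in *.
  assert (C1 := Rle_abs (b * h * k)); assert (C2 := cross_term_le b h k).
  assert (C3 := Rle_0_sqr h); assert (C4 := Rle_0_sqr k); unfold Rsqr in C3, C4.
  nra.
Qed.

(* Deviation of the Hessian of the heavy bodies' potential from diag(3/4, 9/4) at a
   point whose distances to the Lagrange point along the axes are at most Wx, Wy. *)
Definition kxx (Wx Wy : R) : R := 1 / 100000 + 35 / 100 * Wx + 88 / 100 * Wy.
Definition kxy (Wx Wy : R) : R := 1 / 100000 + 88 / 100 * Wx + 50 / 100 * Wy.
Definition kyy (Wx Wy : R) : R := 1 / 100000 + 50 / 100 * Wx + 230 / 100 * Wy.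

Lemma linear_bound {A B a b h k Wx Wy} :
  Rabs A <= a -> Rabs B <= b -> Rabs h <= Wx -> Rabs k <= Wy ->
  Rabs (A * h + B * k) <= a * Wx + b * Wy.
Proof.
  intros; eapply Rle_trans; [apply Rabs_triang|].
  rewrite !Rabs_mult; apply Rplus_le_compat; apply Rmult_le_compat; trivial; apply Rabs_pos.
Qed.

Lemma hessian_near Q E F x y Wx Wy :
  heavy_near Q E F -> Rabs x <= Wx -> Rabs (y - Y0) <= Wy -> Wx <= 12 / 1000 -> Wy <= 54 / 10000 ->
  Rabs (Gxx Q E F x y - 3 / 4) <= kxx Wx Wy /\
  Rabs (Gxy Q E F x y) <= kxy Wx Wy /\
  Rabs (Gyy Q E F x y - 9 / 4) <= kyy Wx Wy.
Proof.
  intros Hq Hx Hy HWx HWy.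
  assert (Hx' : -12 / 1000 <= x <= 12 / 1000) by (unfold Rabs in Hx; destruct Rcase_abs; lra).
  assert (Hy' : -54 / 10000 <= y - Y0 <= 54 / 10000) by (unfold Rabs in Hy; destruct Rcase_abs; lra).
  assert (HY : 0 < Y0) by (unfold Y0; lra).
  assert (Hy0 : 0 < y) by (unfold Y0 in *; lra).
  assert (HF : F <= 0) by apply Hq.
  destruct (lagrange_point Q E F Hq) as [_ [_ [L1 [L2 L3]]]].
  assert (T : forall t, 0 <= t <= 1 ->
    let X := 0 + t * (x - 0) in let Y := Y0 + t * (y - Y0) in
    Rabs (Gxxx Q E F X Y) <= 35 / 100 /\ Rabs (Gxxy Q E F X Y) <= 88 / 100 /\
    Rabs (Gxyy Q E F X Y) <= 50 / 100 /\ Rabs (Gyyy Q E F X Y) <= 230 / 100).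
  { intros t Ht; apply third_derivatives_near; [exact Hq | |].
    - apply seg_in; lra.
    - replace (Y0 + t * (y - Y0) - Y0) with (0 + t * ((y - Y0) - 0)) by ring; apply seg_in; lra. }
  cbv zeta in T; rewrite <- (Rminus_0_r x) in Hx.
  (* One argument for the three entries: the entry is close to e at the Lagrange point and varies
     along the segment by at most third derivatives times displacement. For Gxy the value e is 0,
     hence the rewriting backwards with [Rminus_0_r]. *)
  assert (M : forall (H Ha Hb : R -> R -> R -> R -> R -> R) e u v,
    (forall a b h k t, 0 < b + t * k ->
      is_derive (fun t => H Q E F (a + t * h) (b + t * k)) t
        (Ha Q E F (a + t * h) (b + t * k) * h + Hb Q E F (a + t * h) (b + t * k) * k)) ->
    (forall t, 0 <= t <= 1 -> Rabs (Ha Q E F (0 + t * (x - 0)) (Y0 + t * (y - Y0))) <= u /\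
                              Rabs (Hb Q E F (0 + t * (x - 0)) (Y0 + t * (y - Y0))) <= v) ->
    Rabs (H Q E F 0 Y0 - e) <= 1 / 100000 ->
    Rabs (H Q E F x y - e) <= 1 / 100000 + (u * Wx + v * Wy)).
  { intros H Ha Hb e u v HD HT He.
    destruct (G2_mean_value H Ha Hb Q E F x y 0 Y0 HD Hy0 HY) as [t [Ht Et]].
    cbv zeta in Et; destruct (HT t Ht) as [T1 T2].
    replace (H Q E F x y - e) with ((H Q E F 0 Y0 - e) + (H Q E F x y - H Q E F 0 Y0)) by ring.
    eapply Rle_trans; [apply Rabs_triang|]; rewrite Et; apply Rplus_le_compat; [exact He|].
    now apply linear_bound. }
  rewrite <- (Rminus_0_r (Gxy Q E F x y)); rewrite <- (Rminus_0_r (Gxy Q E F 0 Y0)) in L2.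
  unfold kxx, kxy, kyy; rewrite !Rplus_assoc; split; [|split].
  - apply (M Gxx Gxxx Gxxy); trivial; [intros; now apply is_derive_Gxx | intros t Ht; now destruct (T t Ht) as [? [? _]]].
  - apply (M Gxy Gxxy Gxyy); trivial; [intros; now apply is_derive_Gxy | intros t Ht; now destruct (T t Ht) as [_ [? [? _]]]].
  - apply (M Gyy Gxyy Gyyy); trivial; [intros; now apply is_derive_Gyy | intros t Ht; now destruct (T t Ht) as [_ [_ [? ?]]]].
Qed.

Lemma G_difference Q E F x y x' y' Wx Wy :
  heavy_near Q E F -> Rabs x <= Wx -> Rabs (y - Y0) <= Wy -> Rabs x' <= Wx -> Rabs (y' - Y0) <= Wy ->
  Wx <= 12 / 1000 -> Wy <= 54 / 10000 ->
  Rabs (Gx Q E F x y - Gx Q E F x' y' - 3 / 4 * (x - x'))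
    <= kxx Wx Wy * Rabs (x - x') + kxy Wx Wy * Rabs (y - y') /\
  Rabs (Gy Q E F x y - Gy Q E F x' y' - 9 / 4 * (y - y'))
    <= kxy Wx Wy * Rabs (x - x') + kyy Wx Wy * Rabs (y - y').
Proof.
  intros Hq Hx Hy Hx' Hy' HWx HWy.
  assert (HY : 8 / 10 < Y0) by (unfold Y0; lra).
  assert (py : 0 < y) by (unfold Rabs in Hy; destruct Rcase_abs; lra).
  assert (py' : 0 < y') by (unfold Rabs in Hy'; destruct Rcase_abs; lra).
  assert (HF : F <= 0) by apply Hq.
  assert (S : forall t, 0 <= t <= 1 ->
    let X := x' + t * (x - x') in let Y := y' + t * (y - y') in
    Rabs (Gxx Q E F X Y - 3 / 4) <= kxx Wx Wy /\ Rabs (Gxy Q E F X Y) <= kxy Wx Wy /\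
    Rabs (Gyy Q E F X Y - 9 / 4) <= kyy Wx Wy).
  { intros t Ht; apply hessian_near; trivial; apply Rabs_le.
    - apply seg_in; trivial; now apply Rabs_le_inv.
    - apply Rabs_le_inv in Hy, Hy'.
      replace (y' + t * (y - y') - Y0) with ((y' - Y0) + t * ((y - Y0) - (y' - Y0))) by ring.
      apply seg_in; trivial. }
  cbv zeta in S; split.
  - destruct (G_mean_value Q E F 1 0 x y x' y' HF py py') as [t [Ht Et]].
    cbv zeta in Et; destruct (S t Ht) as [S1 [S2 S3]].
    assert (B := linear_bound S1 S2 (Rle_refl (Rabs (x - x'))) (Rle_refl (Rabs (y - y')))).
    eapply Rle_trans; [|exact B]; right; f_equal; lra.
  - destruct (G_mean_value Q E F 0 1 x y x' y' HF py py') as [t [Ht Et]].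
    cbv zeta in Et; destruct (S t Ht) as [S1 [S2 S3]].
    assert (B := linear_bound S2 S3 (Rle_refl (Rabs (x - x'))) (Rle_refl (Rabs (y - y')))).
    eapply Rle_trans; [|exact B]; right; f_equal; lra.
Qed.

(** * Localisation of the bodies *)

Lemma rad_opp x y : rad (- x) (- y) = rad x y.
Proof. unfold rad; f_equal; ring. Qed.

Lemma fx_opp x y : fx (- x) (- y) = - fx x y.
Proof. unfold fx; rewrite rad_opp; unfold Rdiv; ring. Qed.

Lemma fy_opp x y : fy (- x) (- y) = - fy x y.
Proof. unfold fy; rewrite rad_opp; unfold Rdiv; ring. Qed.

Lemma rad_sym x y x' y' : rad (x - x') (y - y') = rad (x' - x) (y' - y).
Proof. rewrite <- rad_opp; f_equal; ring. Qed.

Lemma fx_sym x y x' y' : fx (x - x') (y - y') = - fx (x' - x) (y' - y).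
Proof. rewrite <- fx_opp; f_equal; ring. Qed.

Lemma fy_sym x y x' y' : fy (x - x') (y - y') = - fy (x' - x) (y' - y).
Proof. rewrite <- fy_opp; f_equal; ring. Qed.

Lemma dot_f x y : 0 < rad x y -> x * fx x y + y * fy x y = / rad x y.
Proof.
  intros Hr; assert (H2 := rad_sqr x y); unfold fx, fy.
  replace (x * (x / rad x y ^ 3) + y * (y / rad x y ^ 3)) with ((x * x + y * y) * / rad x y ^ 3)
    by (field; lra).
  rewrite <- H2; field; lra.
Qed.

Lemma dot_le_rad x y x' y' : x * x' + y * y' <= rad x y * rad x' y'.
Proof.
  assert (H1 := rad_ge0 x y); assert (H2 := rad_ge0 x' y').
  assert (H3 := rad_sqr x y); assert (H4 := rad_sqr x' y').
  assert (H5 : 0 <= rad x y * rad x' y') by now apply Rmult_le_pos.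
  destruct (Rle_dec (x * x' + y * y') 0); [lra|].
  apply Rsqr_incr_0_var; [|exact H5].
  unfold Rsqr.
  replace (rad x y * rad x' y' * (rad x y * rad x' y'))
    with ((rad x y * rad x y) * (rad x' y' * rad x' y')) by ring.
  rewrite H3, H4; assert (H6 := Rle_0_sqr (x * y' - y * x')); unfold Rsqr in H6; nra.
Qed.

(** The terms are scalar products rewritten by the law of cosines. For a <= b the second is
    nonnegative. The triangle inequality b <= a + d bounds the first numerator below by -2 a d, so
    the first term is at least -d / a^2, hence at least -1 / d because d <= a. *)
Lemma third_body_aux a b d :
  0 < d -> d <= a -> a <= b -> b <= a + d ->
  - / d <= (a * a - b * b + d * d) / (2 * a ^ 3) + (b * b - a * a + d * d) / (2 * b ^ 3).
Proof.
  intros Hd Ha Hab Hb.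
  assert (P1 : 0 <= (b * b - a * a + d * d) / (2 * b ^ 3)).
  { apply Rmult_le_pos; [nra|]; left; apply Rinv_0_lt_compat.
    assert (0 < b ^ 3) by (apply pow_lt; lra); lra. }
  assert (P2 : - / d <= (a * a - b * b + d * d) / (2 * a ^ 3)); [|lra].
  assert (A3 : 0 < 2 * a ^ 3) by (assert (0 < a ^ 3) by (apply pow_lt; lra); lra).
  apply Rmult_le_reg_r with (2 * a ^ 3 * d); [apply Rmult_lt_0_compat; lra|].
  replace (- / d * (2 * a ^ 3 * d)) with (- (2 * a ^ 3)) by (field; lra).
  replace ((a * a - b * b + d * d) / (2 * a ^ 3) * (2 * a ^ 3 * d)) with ((a * a - b * b + d * d) * d)
    by (field; lra).
  assert (Q1 : - (2 * a * d) <= a * a - b * b + d * d) by nra.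
  assert (Q2 : a * (d * d) <= a ^ 3) by (assert (d * d <= a * a) by nra; simpl; rewrite Rmult_1_r; apply Rmult_le_compat_l; lra).
  assert (Q3 := Rmult_le_compat_r d _ _ ltac:(lra) Q1); lra.
Qed.

(* At the ends of a shortest side the pull of the third body cannot outweigh half of
   the mutual repulsion 2 / d. *)
Lemma third_body ux uy vx vy :
  let d := rad (ux - vx) (uy - vy) in
  0 < d -> d <= rad ux uy -> d <= rad vx vy ->
  - / d <= (ux - vx) * (fx ux uy - fx vx vy) + (uy - vy) * (fy ux uy - fy vx vy).
Proof.
  intros d Hd Ha Hb.
  assert (E1 := rad_sqr ux uy); assert (E2 := rad_sqr vx vy).
  assert (E3 := rad_sqr (ux - vx) (uy - vy)); fold d in E3.
  assert (D1 := dot_le_rad ux uy (vx - ux) (vy - uy)).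
  assert (D2 := dot_le_rad vx vy (ux - vx) (uy - vy)).
  rewrite rad_sym in D1; fold d in D1, D2.
  unfold fx, fy; set (a := rad ux uy) in *; set (b := rad vx vy) in *.
  (* The two triangle inequalities, obtained by squaring from the Cauchy-Schwarz bounds [D1] and
     [D2]. *)
  assert (Hba : b <= a + d) by (apply Rsqr_incr_0_var; unfold Rsqr; nra).
  assert (Hab : a <= b + d) by (apply Rsqr_incr_0_var; unfold Rsqr; nra).
  replace ((ux - vx) * (ux / a ^ 3 - vx / b ^ 3) + (uy - vy) * (uy / a ^ 3 - vy / b ^ 3))
    with ((a * a - b * b + d * d) / (2 * a ^ 3) + (b * b - a * a + d * d) / (2 * b ^ 3)).
  - destruct (Rle_dec a b) as [L|L]; [now apply third_body_aux|].
    rewrite Rplus_comm; apply third_body_aux; lra.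
  - rewrite E1, E2, E3; field; split; lra.
Qed.

(* The equation of the light body (xi, yi), the other two being at (xj, yj), (xk, yk). *)
Definition light_eq (Q E F xi yi xj yj xk yk : R) : Prop :=
  Gx Q E F xi yi = mu * (fx (xi - xj) (yi - yj) + fx (xi - xk) (yi - yk)) /\
  Gy Q E F xi yi = mu * (fy (xi - xj) (yi - yj) + fy (xi - xk) (yi - yk)).

Lemma light_eq_sym {Q E F xi yi xj yj xk yk} :
  light_eq Q E F xi yi xj yj xk yk -> light_eq Q E F xi yi xk yk xj yj.
Proof. intros [H1 H2]; split; rewrite Rplus_comm; assumption. Qed.

(** Pair the difference of the two equations with z_i - z_j. The mutual term gives 2 mu / d, the
    third body at least -mu / d, and the heavy field at most 19/5 d^2. Hence d^3 >= 5 mu / 19, so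
    that d is at least about 0.00187. *)
Lemma shortest_side {Q E F xi yi xj yj xk yk} :
  heavy_near Q E F -> in_light_box xi yi -> in_light_box xj yj ->
  light_eq Q E F xi yi xj yj xk yk -> light_eq Q E F xj yj xi yi xk yk ->
  0 < rad (xi - xj) (yi - yj) ->
  rad (xi - xj) (yi - yj) <= rad (xi - xk) (yi - yk) ->
  rad (xi - xj) (yi - yj) <= rad (xj - xk) (yj - yk) ->
  185 / 100000 <= rad (xi - xj) (yi - yj).
Proof.
  intros Hq Bi Bj [Ei1 Ei2] [Ej1 Ej2] Hd H1 H2.
  assert (L := G_lipschitz Q E F _ _ _ _ Hq Bi Bj).
  rewrite Ei1, Ei2, Ej1, Ej2 in L.
  rewrite (fx_sym xj yj xi yi), (fy_sym xj yj xi yi) in L.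
  assert (T := third_body (xi - xk) (yi - yk) (xj - xk) (yj - yk)); cbv zeta in T.
  replace (xi - xk - (xj - xk)) with (xi - xj) in T by ring.
  replace (yi - yk - (yj - yk)) with (yi - yj) in T by ring.
  specialize (T Hd H1 H2).
  assert (D := dot_f _ _ Hd); rewrite <- (rad_sqr (xi - xj) (yi - yj)) in L.
  set (d := rad (xi - xj) (yi - yj)) in *.
  assert (Hmu : 0 < mu) by (rewrite mu_eq; lra).
  assert (M : mu * / d <= 19 / 5 * (d * d)).
  { assert (X : mu * (2 * / d - / d) <= mu * (2 * ((xi - xj) * fx (xi - xj) (yi - yj)
       + (yi - yj) * fy (xi - xj) (yi - yj))
     + ((xi - xj) * (fx (xi - xk) (yi - yk) - fx (xj - xk) (yj - yk))
       + (yi - yj) * (fy (xi - xk) (yi - yk) - fy (xj - xk) (yj - yk)))))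
      by (apply Rmult_le_compat_l; lra).
    lra. }
  assert (M2 : mu <= 19 / 5 * (d * d) * d).
  { replace mu with (mu * / d * d) by (field; lra). apply Rmult_le_compat_r; lra. }
  rewrite mu_eq in M2.
  destruct (Rle_dec (185 / 100000) d) as [L1|L1]; [exact L1|].
  exfalso; assert (d * d <= 185 / 100000 * (185 / 100000)) by nra.
  nra.
Qed.

Lemma light_distances Q E F x1 y1 x2 y2 x3 y3 :
  heavy_near Q E F -> in_light_box x1 y1 -> in_light_box x2 y2 -> in_light_box x3 y3 ->
  light_eq Q E F x1 y1 x2 y2 x3 y3 -> light_eq Q E F x2 y2 x1 y1 x3 y3 ->
  light_eq Q E F x3 y3 x1 y1 x2 y2 ->
  0 < rad (x1 - x2) (y1 - y2) -> 0 < rad (x1 - x3) (y1 - y3) -> 0 < rad (x2 - x3) (y2 - y3) ->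
  185 / 100000 <= rad (x1 - x2) (y1 - y2) /\
  185 / 100000 <= rad (x1 - x3) (y1 - y3) /\
  185 / 100000 <= rad (x2 - x3) (y2 - y3).
Proof.
  intros Hq B1 B2 B3 L1 L2 L3 D12 D13 D23.
  assert (S12 := shortest_side Hq B1 B2 L1 L2 D12).
  assert (S13 := shortest_side Hq B1 B3 (light_eq_sym L1) L3 D13).
  assert (S23 := shortest_side Hq B2 B3
    (light_eq_sym L2) (light_eq_sym L3) D23).
  rewrite (rad_sym x3 y3 x2 y2) in S13; rewrite (rad_sym x2 y2 x1 y1), (rad_sym x3 y3 x1 y1) in S23.
  set (a := rad (x1 - x2) (y1 - y2)) in *; set (b := rad (x1 - x3) (y1 - y3)) in *.
  set (c := rad (x2 - x3) (y2 - y3)) in *.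
  destruct (Rle_dec a b); destruct (Rle_dec a c); destruct (Rle_dec b c);
    try (specialize (S12 ltac:(lra) ltac:(lra))); try (specialize (S13 ltac:(lra) ltac:(lra)));
    try (specialize (S23 ltac:(lra) ltac:(lra))); lra.
Qed.

(** Pair each equation with the position relative to the Lagrange point and add. By antisymmetry the
    mutual terms give mu times the sum of the 1 / r, at most 3 mu / 0.00185 < 4.06 / 10^5. Strong
    monotonicity bounds the other side below, and the small value of G at the Lagrange point costs
    at most 46 / 10^8 per body. *)
Lemma virial_bound Q E F x1 y1 x2 y2 x3 y3 :
  heavy_near Q E F -> in_light_box x1 y1 -> in_light_box x2 y2 -> in_light_box x3 y3 ->
  light_eq Q E F x1 y1 x2 y2 x3 y3 -> light_eq Q E F x2 y2 x1 y1 x3 y3 ->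
  light_eq Q E F x3 y3 x1 y1 x2 y2 ->
  185 / 100000 <= rad (x1 - x2) (y1 - y2) ->
  185 / 100000 <= rad (x1 - x3) (y1 - y3) ->
  185 / 100000 <= rad (x2 - x3) (y2 - y3) ->
  3 / 10 * (x1 * x1 + x2 * x2 + x3 * x3)
  + 3 / 2 * ((y1 - Y0) * (y1 - Y0) + (y2 - Y0) * (y2 - Y0) + (y3 - Y0) * (y3 - Y0))
  <= 422 / 10000000.
Proof.
  intros Hq B1 B2 B3 [L1 L1'] [L2 L2'] [L3 L3'] D12 D13 D23.
  assert (S1 := G_strongly_monotone Q E F x1 y1 Hq B1).
  assert (S2 := G_strongly_monotone Q E F x2 y2 Hq B2).
  assert (S3 := G_strongly_monotone Q E F x3 y3 Hq B3).
  destruct (lagrange_point Q E F Hq) as [G1 [G2 _]].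
  rewrite L1, L1' in S1; rewrite L2, L2' in S2; rewrite L3, L3' in S3.
  rewrite (fx_sym x2 y2 x1 y1), (fy_sym x2 y2 x1 y1) in S2.
  rewrite (fx_sym x3 y3 x1 y1), (fy_sym x3 y3 x1 y1), (fx_sym x3 y3 x2 y2), (fy_sym x3 y3 x2 y2) in S3.
  assert (I12 := dot_f (x1 - x2) (y1 - y2) ltac:(lra)).
  assert (I13 := dot_f (x1 - x3) (y1 - y3) ltac:(lra)).
  assert (I23 := dot_f (x2 - x3) (y2 - y3) ltac:(lra)).
  assert (J : forall r, 185 / 100000 <= r -> / r <= 100000 / 185).
  { intros r Hr; replace (100000 / 185) with (/ (185 / 100000)) by field.
    apply Rinv_le_contravar; lra. }
  apply J in D12, D13, D23.
  assert (M : mu * (/ rad (x1 - x2) (y1 - y2) + / rad (x1 - x3) (y1 - y3) + / rad (x2 - x3) (y2 - y3))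
    <= mu * (3 * (100000 / 185))).
  { apply Rmult_le_compat_l; [rewrite mu_eq|]; lra. }
  rewrite <- I12, <- I13, <- I23 in M.
  rewrite mu_eq in M at 2.
  destruct B1 as [B1 B1'], B2 as [B2 B2'], B3 as [B3 B3'].
  apply Rabs_le_inv in G1, G2.
  set (gx := Gx Q E F 0 Y0) in *; set (gy := Gy Q E F 0 Y0) in *.
  assert (K : forall x y, -2 / 10 <= x <= 2 / 10 -> 7 / 10 <= y <= 10 / 10 ->
    - (x * gx + (y - Y0) * gy) <= 46 / 100000000).
  { intros x y Hx Hy.
    assert (Hy' : - (17 / 100) <= y - Y0 <= 17 / 100) by (unfold Y0; lra).
    assert (X1 : - (x * gx) <= 2 / 10 * (12 / 10000000)).
    { eapply Rle_trans; [apply Rle_abs|]; rewrite Rabs_Ropp, Rabs_mult.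
      apply Rmult_le_compat; try apply Rabs_pos; apply Rabs_le; lra. }
    assert (X2 : - ((y - Y0) * gy) <= 17 / 100 * (12 / 10000000)).
    { eapply Rle_trans; [apply Rle_abs|]; rewrite Rabs_Ropp, Rabs_mult.
      apply Rmult_le_compat; try apply Rabs_pos; apply Rabs_le; lra. }
    lra. }
  assert (K1 := K _ _ B1 B1'); assert (K2 := K _ _ B2 B2'); assert (K3 := K _ _ B3 B3').
  lra.
Qed.

(** * Position of the heavy bodies *)

Definition nu : R := 50 / 999999925.

Lemma nu_eq : m1 * nu = mu.
Proof. rewrite m1_eq, mu_eq; unfold nu; field. Qed.

(* The coordinates of the second heavy body, from the centre of mass; sx and sy are
   the sums of the coordinates of the light bodies. *)
Definition heavy2x (Q sx : R) : R := - Q - nu * sx.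
Definition heavy2y (sy : R) : R := - (nu * sy).

Definition heavy_eq (Q E F x1 y1 x2 y2 x3 y3 : R) : Prop :=
  Q = m1 * fx (Q - E) (- F)
      + mu * (fx (Q - x1) (- y1) + fx (Q - x2) (- y2) + fx (Q - x3) (- y3)).

Section HeavyPosition.

Variable p : Z.
Hypothesis p_ge0 : (0 <= p)%Z.

Definition inu : itv := icst p 50 999999925.

(** The light bodies enter only through their box: the sum of their abscissae lies in [-0.6, 0.6],
    that of their ordinates in [2.1, 3]. Up to terms of order mu the equation is Q = m1 / (2 Q)^2. A
    cell passes if it lies in the target window or if the defect of the equation keeps a strict sign
    on it. *)
Definition heavy_test (B : list itv) : bool :=
  match B with
  | [Q] =>
      if (lower p 4999995 10000000 Q && upper p 5000005 10000000 Q)%bool then true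
      else
        let DX := iadd (iint 2 Q) (imul p inu (irng p (-6) 6 10)) in
        let DY := imul p inu (irng p 21 30 10) in
        let X := isub Q (irng p (-2) 2 10) in
        let Y := iopp (irng p 7 10 10) in
        if (0 <? fst (irad2 p DX DY))%Z then
          if (0 <? fst (irad2 p X Y))%Z then
            let res := isub Q (iadd (imul p (im1 p) (fst (ikern p DX DY)))
              (imul p (icst p 25 1000000000) (iint 3 (fst (ikern p X Y))))) in
            if (0 <? fst res)%Z then true else (snd res <? 0)%Z
          else false
        else false
  | _ => false
  end.

Lemma heavy_test_correct x1 y1 x2 y2 x3 y3 B v :
  in_light_box x1 y1 -> in_light_box x2 y2 -> in_light_box x3 y3 ->
  heavy_test B = true -> Forall2 (cont p) B v ->
  match v with
  | [Q] => heavy_eq Q (heavy2x Q (x1 + x2 + x3)) (heavy2y (y1 + y2 + y3)) x1 y1 x2 y2 x3 y3 ->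
           4999995 / 10000000 <= Q <= 5000005 / 10000000
  | _ => True
  end.
Proof.
  intros [B1 B1'] [B2 B2'] [B3 B3'] HT HB.
  destruct HB as [|X x B v Hx HB]; [exact Logic.I|].
  destruct HB as [|Y y B v Hy HB]; [|exact Logic.I].
  unfold heavy_test in HT; cbv zeta in HT; intros Heq.
  destruct (lower p 4999995 10000000 X && upper p 5000005 10000000 X)%bool eqn:E0.
  { apply andb_prop in E0 as [E1 E2]; split.
    - now apply (lower_correct p p_ge0 4999995 10000000 X x eq_refl).
    - now apply (upper_correct p p_ge0 5000005 10000000 X x eq_refl). }
  clear E0; exfalso.
  destruct (0 <? fst (irad2 p (iadd _ _) _))%Z eqn:E1 in HT; [|discriminate].
  destruct (0 <? fst (irad2 p (isub _ _) _))%Z eqn:E2 in HT; [|discriminate].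
  apply Z.ltb_lt in E1, E2.
  assert (Hnu : cont p inu nu) by (apply cont_icst; lia).
  assert (HDX : cont p (iadd (iint 2 X) (imul p inu (irng p (-6) 6 10)))
    (x - heavy2x x (x1 + x2 + x3))).
  { unfold heavy2x; replace (x - (- x - nu * (x1 + x2 + x3))) with (2 * x + nu * (x1 + x2 + x3)) by ring.
    apply cont_iadd; [now apply (cont_iint p 2)|].
    apply cont_imul; trivial; apply cont_irng; lia || lra. }
  assert (HDY : cont p (imul p inu (irng p 21 30 10)) (- heavy2y (y1 + y2 + y3))).
  { unfold heavy2y; rewrite Ropp_involutive; apply cont_imul; trivial; apply cont_irng; lia || lra. }
  destruct (cont_ikern p p_ge0 E1 HDX HDY) as [K _].
  assert (L : forall a b, -2 / 10 <= a <= 2 / 10 -> 7 / 10 <= b <= 10 / 10 ->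
    cont p (fst (ikern p (isub X (irng p (-2) 2 10)) (iopp (irng p 7 10 10)))) (fx (x - a) (- b))).
  { intros a b Ha Hb; apply cont_ikern; trivial.
    - apply cont_isub; trivial; apply cont_irng; lia || lra.
    - apply cont_iopp, cont_irng; lia || lra. }
  assert (L1 := L _ _ B1 B1'); assert (L2 := L _ _ B2 B2'); assert (L3 := L _ _ B3 B3').
  assert (L4 : cont p (iint 3 (fst (ikern p (isub X (irng p (-2) 2 10)) (iopp (irng p 7 10 10)))))
    (fx (x - x1) (- y1) + fx (x - x2) (- y2) + fx (x - x3) (- y3))).
  { revert L1 L2 L3; unfold cont, iint; cbn [fst snd Z.leb Z.compare]; rewrite !mult_IZR; lra. }
  assert (Hmu : cont p (icst p 25 1000000000) mu) by (rewrite mu_eq; apply cont_icst; lia).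
  assert (Hres := cont_isub p Hx (cont_iadd p
    (cont_imul p p_ge0 (cont_im1 p) K) (cont_imul p p_ge0 Hmu L4))).
  rewrite <- Heq, Rminus_diag in Hres by reflexivity.
  destruct Hres as [R1 R2]; rewrite Rmult_0_l in R1, R2.
  apply le_IZR in R1, R2.
  destruct (0 <? fst (isub _ _))%Z eqn:E3 in HT.
  - apply Z.ltb_lt in E3; lia.
  - apply Z.ltb_lt in HT; lia.
Qed.

End HeavyPosition.

Lemma heavy_localised Q x1 y1 x2 y2 x3 y3 :
  let E := heavy2x Q (x1 + x2 + x3) in
  let F := heavy2y (y1 + y2 + y3) in
  in_light_box x1 y1 -> in_light_box x2 y2 -> in_light_box x3 y3 ->
  49 / 100 <= Q <= 65 / 100 -> heavy_eq Q E F x1 y1 x2 y2 x3 y3 ->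
  heavy_near Q E F.
Proof.
  intros E F B1 B2 B3 HQ Heq.
  assert (C : bisect (heavy_test 36) 40 [irng 36 49 65 100] = true)
    by (vm_cast_no_check (eq_refl true)).
  assert (HQ' : 4999995 / 10000000 <= Q <= 5000005 / 10000000).
  { refine (bisect_sound 36 _ _
      (fun B v => heavy_test_correct 36 ltac:(lia) x1 y1 x2 y2 x3 y3 B v B1 B2 B3) _ _ [Q] C _ Heq).
    constructor; [|constructor]; apply cont_irng; lia || lra. }
  destruct B1, B2, B3; unfold heavy_near, E, F, heavy2x, heavy2y, nu; lra.
Qed.

(** * The Jacobi coordinates of the light bodies *)

(* From here on lengths are in units of 1/1000, in which the coupling between the light
   bodies becomes 25.  With the light bodies at w1, w2, w3, the Jacobi coordinates are
   (x, y) = w3 - w2 and (xi, et) = w1 - (w2 + w3) / 2. *)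

(* Six times a bound of the coordinates of the light bodies relative to the Lagrange
   point. *)
Definition six_extent (u m : R) : R := 1 + 4 * Rabs m + 3 * Rabs u.

(* kxx, kxy, kyy with the coefficients rounded up to multiples of 2^-21. *)
Definition kapxx (Ax Ay : R) : R := (21 + 123 * Ax + 308 * Ay) / 2097152.
Definition kapxy (Ax Ay : R) : R := (21 + 308 * Ax + 175 * Ay) / 2097152.
Definition kapyy (Ax Ay : R) : R := (21 + 175 * Ax + 804 * Ay) / 2097152.

(** The light equations weakened to inequalities in four unknowns: the heavy bodies and the centre
    of mass survive only in the error terms. k1, k2, k3 belong to the sides opposite w1, w2, w3, and
    2 (x xi + y et) is the difference of the squared sides at the apex w1. *)
Record jacobi_system (x y xi et : R) : Prop := JacobiSystem {
  js_r1 : 185 / 100 <= rad x y;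
  js_r2 : 185 / 100 <= rad (xi - x / 2) (et - y / 2);
  js_r3 : 185 / 100 <= rad (xi + x / 2) (et + y / 2);
  js_iso2 : Rabs (2 * (x * xi + y * et))
            <= Rabs (x * x + y * y
                     - ((xi - x / 2) * (xi - x / 2) + (et - y / 2) * (et - y / 2)));
  js_iso3 : Rabs (2 * (x * xi + y * et))
            <= Rabs (x * x + y * y
                     - ((xi + x / 2) * (xi + x / 2) + (et + y / 2) * (et + y / 2)));
  js_eqs :
    let k1 := 25 / rad x y ^ 3 in
    let k2 := 25 / rad (xi - x / 2) (et - y / 2) ^ 3 in
    let k3 := 25 / rad (xi + x / 2) (et + y / 2) ^ 3 in
    let Ax := six_extent x xi in
    let Ay := six_extent y et in
    let M := Rmax (Rabs xi) (Rabs x / 2) in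
    let N := Rmax (Rabs et) (Rabs y / 2) in
    Rabs ((2 * k1 + (k2 + k3) / 2 - 3 / 4) * x + (k3 - k2) * xi)
      <= kapxx Ax Ay * Rabs x + kapxy Ax Ay * Rabs y /\
    Rabs ((2 * k1 + (k2 + k3) / 2 - 9 / 4) * y + (k3 - k2) * et)
      <= kapxy Ax Ay * Rabs x + kapyy Ax Ay * Rabs y /\
    Rabs ((3 / 2 * (k2 + k3) - 3 / 4) * xi + 3 / 4 * (k3 - k2) * x)
      <= kapxx Ax Ay * M + kapxy Ax Ay * N /\
    Rabs ((3 / 2 * (k2 + k3) - 9 / 4) * et + 3 / 4 * (k3 - k2) * y)
      <= kapxy Ax Ay * M + kapyy Ax Ay * N }.

(* Centre and radii, in units of 2^-12, of a box around each of the three solutions: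
   collinear along either axis, and isosceles with its axis along the first axis. *)
Definition hulls : list (list (Z * Z)) :=
  [[(28400, 123); (0, 205); (0, 123); (0, 410)];
   [(0, 246); (19692, 164); (0, 123); (0, 123)];
   [(0, 246); (11977, 123); (18035, 164); (0, 123)]]%Z.

Definition in_hull (h : list (Z * Z)) (v : list R) : Prop :=
  Forall2 (fun cr x => Rabs (x - IZR (fst cr) / 4096) <= IZR (snd cr) / 4096) h v.

Definition box_in_hull (h : list (Z * Z)) (B : list itv) : bool :=
  forallb (fun q => ((fst (fst q) - snd (fst q) <=? fst (snd q))
                  && (snd (snd q) <=? fst (fst q) + snd (fst q)))%Z)
    (combine h B).

Lemma box_in_hull_correct h B v :
  length h = length B -> box_in_hull h B = true -> Forall2 (cont 12) B v -> in_hull h v.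
Proof.
  intros HL H HB; revert h HL H; induction HB as [|J x B v Hx HB IH]; intros [|[c r] h] HL H;
    try discriminate; [constructor|].
  cbn in H; apply andb_prop in H as [H1 H2]; apply andb_prop in H1 as [H0 H1].
  apply Z.leb_le, IZR_le in H0; apply Z.leb_le, IZR_le in H1.
  rewrite minus_IZR in H0; rewrite plus_IZR in H1.
  constructor; [|apply IH; [now injection HL | exact H2]].
  destruct Hx as [L U]; change (2 ^ 12)%Z with 4096%Z in L, U.
  cbn [fst snd]; apply Rabs_le; lra.
Qed.

Lemma abs_combine (a1 a2 a3 a4 f1 f2 f3 f4 g1 g2 g3 g4 c c' : R) :
  0 <= c -> 0 <= c' -> Rabs f1 <= g1 -> Rabs f2 <= g2 -> Rabs f3 <= g3 -> Rabs f4 <= g4 ->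
  Rabs (c * (a1 * f1 + a2 * f2) + c' * (a3 * f3 + a4 * f4))
  <= c * (Rabs a1 * g1 + Rabs a2 * g2) + c' * (Rabs a3 * g3 + Rabs a4 * g4).
Proof.
  intros Hc Hc' H1 H2 H3 H4.
  assert (T : forall a b f g f' g', Rabs f <= g -> Rabs f' <= g' ->
    Rabs (a * f + b * f') <= Rabs a * g + Rabs b * g').
  { intros; eapply Rle_trans; [apply Rabs_triang|]; rewrite !Rabs_mult.
    apply Rplus_le_compat; apply Rmult_le_compat_l; trivial; apply Rabs_pos. }
  eapply Rle_trans; [apply Rabs_triang|]; rewrite (Rabs_mult c), (Rabs_mult c').
  rewrite (Rabs_pos_eq c), (Rabs_pos_eq c') by assumption.
  apply Rplus_le_compat; apply Rmult_le_compat_l; auto.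
Qed.

(* The balance of torques: the terms in k1, k2, k3 cancel. *)
Lemma torque_bound x y xi et L s d e1 e2 e3 e4 :
  Rabs ((L - 3 / 4) * x + d * xi) <= e1 -> Rabs ((L - 9 / 4) * y + d * et) <= e2 ->
  Rabs ((3 / 2 * s - 3 / 4) * xi + 3 / 4 * d * x) <= e3 ->
  Rabs ((3 / 2 * s - 9 / 4) * et + 3 / 4 * d * y) <= e4 ->
  Rabs (9 * (x * y) + 12 * (xi * et))
  <= 6 * (Rabs x * e2 + Rabs y * e1) + 8 * (Rabs xi * e4 + Rabs et * e3).
Proof.
  intros H1 H2 H3 H4.
  assert (H := abs_combine x (- y) xi (- et) _ _ _ _ _ _ _ _ 6 8 ltac:(lra) ltac:(lra) H2 H1 H4 H3).
  rewrite !Rabs_Ropp in H; eapply Rle_trans; [|exact H].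
  rewrite <- Rabs_Ropp; right; f_equal; field.
Qed.

(** * The exclusion test of the subdivision *)

Section JacobiTest.

Let p : Z := 12.

Local Lemma p_nonneg : (0 <= p)%Z.
Proof. discriminate. Qed.

Let s : R := IZR (2 ^ p).

Local Lemma s_pos : 0 < s.
Proof. apply scale_gt0, p_nonneg. Qed.

(** The error terms are nonnegative and only their upper bounds matter, so a single integer
    represents each. *)
Definition ub (z : Z) (r : R) : Prop := 0 <= r /\ r * s <= IZR z.

Definition umul (z z' : Z) : Z := cshift p (z * z').

Local Lemma ub_add {z z' r r'} : ub z r -> ub z' r' -> ub (z + z') (r + r').
Proof. unfold ub; rewrite plus_IZR; lra. Qed.

Local Lemma ub_mul {z z' r r'} : ub z r -> ub z' r' -> ub (umul z z') (r * r').
Proof.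
  intros [H1 H2] [H3 H4]; split; [now apply Rmult_le_pos|].
  assert (Hs := s_pos); assert (C := cshift_ge p p_nonneg (z * z')); rewrite mult_IZR in C; fold s in C.
  apply Rmult_le_reg_r with (1 := Hs).
  assert (H5 : (r * s) * (r' * s) <= IZR z * IZR z') by (apply Rmult_le_compat; nra).
  unfold umul; lra.
Qed.

Local Lemma ub_scale n {z r} : (0 <= n)%Z -> ub z r -> ub (n * z) (IZR n * r).
Proof.
  intros Hn [H1 H2]; apply IZR_le in Hn; split; [now apply Rmult_le_pos|].
  rewrite mult_IZR, Rmult_assoc; now apply Rmult_le_compat_l.
Qed.

Local Lemma ub_const n : (0 <= n)%Z -> ub (n * 4096) (IZR n).
Proof. intros Hn; apply IZR_le in Hn; split; [exact Hn|]; rewrite mult_IZR; unfold s, p; simpl; lra. Qed.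

Local Lemma ub_imag {J x} : cont p J x -> ub (imag J) (Rabs x).
Proof. intros H; split; [apply Rabs_pos | now apply cont_imag, H]. Qed.

Definition ukap (c a b Ax Ay : Z) : Z := (- Z.shiftr (- (c * 4096 + a * Ax + b * Ay)) 21)%Z.

Local Lemma ub_kap c a b Ax Ay rx ry :
  (0 <= c)%Z -> (0 <= a)%Z -> (0 <= b)%Z -> ub Ax rx -> ub Ay ry ->
  ub (ukap c a b Ax Ay) ((IZR c + IZR a * rx + IZR b * ry) / 2097152).
Proof.
  intros Hc Ha Hb Hx Hy.
  assert (U := ub_add (ub_add (ub_const c Hc) (ub_scale a Ha Hx)) (ub_scale b Hb Hy)).
  destruct U as [U1 U2]; split; [lra|].
  assert (C := cdiv_ge (c * 4096 + a * Ax + b * Ay) (2 ^ 21) eq_refl).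
  change (IZR (2 ^ 21)) with 2097152 in C.
  unfold ukap; rewrite Z.shiftr_div_pow2 by lia; fold (cdiv (c * 4096 + a * Ax + b * Ay) (2 ^ 21)).
  lra.
Qed.

(** The value [true] certifies that J misses [-z, z], which refutes a bound |x| <= r on the whole
    box when z bounds r. *)
Definition iout (J : itv) (z : Z) : bool := ((z <? fst J) || (snd J <? - z))%Z.

Local Lemma iout_false {J z x r} : cont p J x -> Rabs x <= r -> ub z r -> iout J z = false.
Proof.
  intros [H1 H2] Hx [_ H3]; apply Rabs_le_inv in Hx; assert (Hs := s_pos); fold s in H1, H2.
  unfold iout; apply orb_false_intro; apply Z.ltb_ge; apply le_IZR; rewrite ?opp_IZR;
    destruct Hx as [Hx1 Hx2]; apply (Rmult_le_compat_r s) in Hx1, Hx2; lra.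
Qed.

Definition ihalf (J : itv) : itv := (Z.div2 (fst J), - Z.div2 (- snd J))%Z.

Local Lemma cont_ihalf J x : cont p J x -> cont p (ihalf J) (x / 2).
Proof.
  intros [H1 H2]; unfold cont, ihalf; cbn [fst snd]; rewrite opp_IZR.
  assert (A := Zdiv2_odd_eqn (fst J)); assert (B := Zdiv2_odd_eqn (- snd J)).
  assert (A' : (2 * Z.div2 (fst J) <= fst J)%Z) by (destruct (Z.odd (fst J)); lia).
  assert (B' : (2 * Z.div2 (- snd J) <= - snd J)%Z) by (destruct (Z.odd (- snd J)); lia).
  apply IZR_le in A', B'; rewrite mult_IZR in A', B'; rewrite opp_IZR in B'; lra.
Qed.

(* 14018 / 4096 < 1.85^2 *)
Definition too_short (J : itv) : bool := (snd J <? 14018)%Z.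

Local Lemma too_short_false J x y :
  cont p J (x * x + y * y) -> 185 / 100 <= rad x y -> too_short J = false.
Proof.
  intros [_ H] Hr; apply Z.ltb_ge, le_IZR; rewrite <- rad_sqr in H; unfold p in H; simpl in H; nra.
Qed.

(* 5 / r, from an enclosure of r^2 and r >= 1.85 > 7577 / 4096. *)
Definition iinv5 (J : itv) : itv :=
  let r := isqrt p J in iinv p 5 (Z.max 7577 (fst r), Z.max 7577 (snd r)).

Local Lemma cont_iinv5 J x y :
  cont p J (x * x + y * y) -> 185 / 100 <= rad x y -> (0 <=? fst J)%Z = true ->
  cont p (iinv5 J) (5 / rad x y).
Proof.
  intros H Hr H0; apply Z.leb_le in H0.
  destruct (cont_isqrt p p_nonneg _ _ H0 H) as [L U]; fold (rad x y) in L, U.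
  apply cont_iinv; [exact p_nonneg | lia | cbn [fst]; lia |].
  assert (E : IZR 7577 <= rad x y * IZR (2 ^ p)) by (unfold p; simpl; lra).
  split; cbn [fst snd].
  - destruct (Z.max_spec 7577 (fst (isqrt p J))) as [[_ ->]|[_ ->]]; assumption.
  - eapply Rle_trans; [exact U|]; apply IZR_le; lia.
Qed.

Definition icube (J : itv) : itv := imul p J (isqr p J).
Definition ishift (n : Z) (J : itv) : itv := (fst J + n * 4096, snd J + n * 4096)%Z.

Local Lemma cont_icube J x : cont p J x -> cont p (icube J) (x * (x * x)).
Proof. intros H; apply cont_imul; trivial; [exact p_nonneg|]; now apply cont_isqr; [exact p_nonneg|]. Qed.

Local Lemma cont_ishift n J x : cont p J x -> cont p (ishift n J) (x + IZR n).
Proof.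
  intros [H1 H2]; unfold cont, ishift; cbn [fst snd].
  rewrite !plus_IZR, !mult_IZR; unfold p in *; simpl in *; lra.
Qed.

(** A box passes if it lies in a hull or if some condition of [jacobi_system] fails throughout it.
    Tests without roots and inverses come first. The four equations are multiplied by 20: as the
    cube of 5 / r is 5 k, all their coefficients become integers, with 3/4 and 9/4 turning into 15
    and 45. *)
Definition jacobi_test (B : list itv) : bool :=
  match B with
  | [x; y; xi; et] =>
    if existsb (fun h => box_in_hull h B) hulls then true else
    let hx := ihalf x in
    let hy := ihalf y in
    let R1 := iadd (isqr p x) (isqr p y) in
    let R2 := iadd (isqr p (isub xi hx)) (isqr p (isub et hy)) in
    let R3 := iadd (isqr p (iadd xi hx)) (isqr p (iadd et hy)) in
    if (too_short R1 || (too_short R2 || too_short R3))%bool then true else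
    let um := iint 2 (iadd (imul p x xi) (imul p y et)) in
    if iout um (imag (isub R1 R2)) then true else
    if iout um (imag (isub R1 R3)) then true else
    let X := imag x in
    let Y := imag y in
    let XI := imag xi in
    let ET := imag et in
    let Ax := (4096 + 4 * XI + 3 * X)%Z in
    let Ay := (4096 + 4 * ET + 3 * Y)%Z in
    let kxx := ukap 21 123 308 Ax Ay in
    let kxy := ukap 21 308 175 Ax Ay in
    let kyy := ukap 21 175 804 Ax Ay in
    let M := Z.max XI (imag hx) in
    let N := Z.max ET (imag hy) in
    let e1 := (umul kxx X + umul kxy Y)%Z in
    let e2 := (umul kxy X + umul kyy Y)%Z in
    let e3 := (umul kxx M + umul kxy N)%Z in
    let e4 := (umul kxy M + umul kyy N)%Z in
    if iout (iadd (iint 9 (imul p x y)) (iint 12 (imul p xi et)))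
         (6 * (umul X e2 + umul Y e1) + 8 * (umul XI e4 + umul ET e3)) then true else
    if ((0 <=? fst R1) && ((0 <=? fst R2) && (0 <=? fst R3)))%Z then
    let i1 := iinv5 R1 in
    let i2 := iinv5 R2 in
    let i3 := iinv5 R3 in
    let K2 := icube i2 in
    let K3 := icube i3 in
    let S := iadd K2 K3 in
    let D := isub K3 K2 in
    let L := iadd (iint 8 (icube i1)) (iint 2 S) in
    if iout (iadd (imul p (ishift (-15) L) x) (iint 4 (imul p D xi))) (20 * e1) then true else
    if iout (iadd (imul p (ishift (-45) L) y) (iint 4 (imul p D et))) (20 * e2) then true else
    let S6 := iint 6 S in
    if iout (iadd (imul p (ishift (-15) S6) xi) (iint 3 (imul p D x))) (20 * e3) then true else
    iout (iadd (imul p (ishift (-45) S6) et) (iint 3 (imul p D y))) (20 * e4)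
    else false
  | _ => false
  end%Z.

Local Lemma kube r : 0 < r -> 5 / r * (5 / r * (5 / r)) = 5 * (25 / r ^ 3).
Proof. intros; field; lra. Qed.

Local Lemma jacobi_test_correct B v :
  jacobi_test B = true -> Forall2 (cont p) B v ->
  match v with
  | [x; y; xi; et] => jacobi_system x y xi et -> Exists (fun h => in_hull h v) hulls
  | _ => True
  end.
Proof.
  intros HT HB.
  destruct HB as [|Jx x B v Hx HB]; [exact Logic.I|].
  destruct HB as [|Jy y B v Hy HB]; [exact Logic.I|].
  destruct HB as [|Jxi xi B v Hxi HB]; [exact Logic.I|].
  destruct HB as [|Jet et B v Het HB]; [exact Logic.I|].
  destruct HB as [|J5 x5 B v H5 HB]; [|exact Logic.I].
  intros [r1 r2 r3 iso2 iso3 eqs].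
  assert (p_ge0 := p_nonneg).
  unfold jacobi_test in HT.
  destruct (existsb _ hulls) eqn:EH in HT.
  { apply existsb_exists in EH as [h [Hin Hh]].
    apply Exists_exists; exists h; split; [exact Hin|].
    apply (box_in_hull_correct h [Jx; Jy; Jxi; Jet]).
    - destruct Hin as [<-|[<-|[<-|[]]]]; reflexivity.
    - exact Hh.
    - do 4 (constructor; [assumption|]); constructor. }
  (* Outside the hulls, every condition of the system now forces the corresponding exclusion test to
     be [false], until nothing is left that could make [jacobi_test] true. *)
  clear EH; exfalso; cbv zeta in HT, eqs.
  assert (Hhx := cont_ihalf _ _ Hx); assert (Hhy := cont_ihalf _ _ Hy).
  assert (R1 := cont_iadd p (cont_isqr p p_ge0 Hx) (cont_isqr p p_ge0 Hy)).
  assert (R2 := cont_iadd p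
    (cont_isqr p p_ge0 (cont_isub p Hxi Hhx)) (cont_isqr p p_ge0 (cont_isub p Het Hhy))).
  assert (R3 := cont_iadd p
    (cont_isqr p p_ge0 (cont_iadd p Hxi Hhx)) (cont_isqr p p_ge0 (cont_iadd p Het Hhy))).
  rewrite (too_short_false _ _ _ R1 r1), (too_short_false _ _ _ R2 r2), (too_short_false _ _ _ R3 r3) in HT.
  cbn [orb] in HT.
  assert (UM := cont_iint p 2 (cont_iadd p
    (cont_imul p p_ge0 Hx Hxi) (cont_imul p p_ge0 Hy Het))).
  rewrite (iout_false UM iso2 (ub_imag (cont_isub p R1 R2))) in HT.
  rewrite (iout_false UM iso3 (ub_imag (cont_isub p R1 R3))) in HT.
  assert (UX := ub_imag Hx); assert (UY := ub_imag Hy).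
  assert (UXI := ub_imag Hxi); assert (UET := ub_imag Het).
  assert (UAx : ub (4096 + 4 * imag Jxi + 3 * imag Jx) (six_extent x xi)).
  { apply ub_add; [apply ub_add|]; [apply (ub_const 1)|apply (ub_scale 4)|apply (ub_scale 3)]; lia || assumption. }
  assert (UAy : ub (4096 + 4 * imag Jet + 3 * imag Jy) (six_extent y et)).
  { apply ub_add; [apply ub_add|]; [apply (ub_const 1)|apply (ub_scale 4)|apply (ub_scale 3)]; lia || assumption. }
  assert (Ukxx := ub_kap 21 123 308 _ _ _ _ ltac:(lia) ltac:(lia) ltac:(lia) UAx UAy).
  assert (Ukxy := ub_kap 21 308 175 _ _ _ _ ltac:(lia) ltac:(lia) ltac:(lia) UAx UAy).
  assert (Ukyy := ub_kap 21 175 804 _ _ _ _ ltac:(lia) ltac:(lia) ltac:(lia) UAx UAy).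
  assert (UMAX : forall J K a b, cont p J a -> cont p K (b / 2) ->
    ub (Z.max (imag J) (imag K)) (Rmax (Rabs a) (Rabs b / 2))).
  { intros J K a b HJ HK; apply ub_imag in HJ, HK.
    replace (Rabs b / 2) with (Rabs (b / 2))
      by (unfold Rdiv; rewrite Rabs_mult, (Rabs_pos_eq (/ 2)); lra).
    destruct HJ as [A1 A2], HK as [B1 B2].
    apply Rmax_case; split; trivial; eapply Rle_trans; try eassumption; apply IZR_le; lia. }
  assert (UM' := UMAX _ _ _ _ Hxi Hhx); assert (UN := UMAX _ _ _ _ Het Hhy).
  fold (kapxx (six_extent x xi) (six_extent y et)) in Ukxx.
  fold (kapxy (six_extent x xi) (six_extent y et)) in Ukxy.
  fold (kapyy (six_extent x xi) (six_extent y et)) in Ukyy.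
  destruct eqs as [e1 [e2 [e3 e4]]].
  assert (U1 := ub_add (ub_mul Ukxx UX) (ub_mul Ukxy UY)).
  assert (U2 := ub_add (ub_mul Ukxy UX) (ub_mul Ukyy UY)).
  assert (U3 := ub_add (ub_mul Ukxx UM') (ub_mul Ukxy UN)).
  assert (U4 := ub_add (ub_mul Ukxy UM') (ub_mul Ukyy UN)).
  assert (T := torque_bound _ _ _ _ _ _ _ _ _ _ _ e1 e2 e3 e4).
  rewrite (iout_false
    (cont_iadd p (cont_iint p 9 (cont_imul p p_ge0 Hx Hy))
                         (cont_iint p 12 (cont_imul p p_ge0 Hxi Het))) T
    (ub_add
      (ub_scale 6 ltac:(lia) (ub_add (ub_mul UX U2) (ub_mul UY U1)))
      (ub_scale 8 ltac:(lia) (ub_add (ub_mul UXI U4) (ub_mul UET U3))))) in HT.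
  clear T.
  destruct ((0 <=? _) && _)%Z eqn:E0 in HT; [|discriminate].
  apply andb_prop in E0 as [P1 E0]; apply andb_prop in E0 as [P2 P3].
  assert (I1 := cont_iinv5 _ _ _ R1 r1 P1).
  assert (I2 := cont_iinv5 _ _ _ R2 r2 P2).
  assert (I3 := cont_iinv5 _ _ _ R3 r3 P3).
  apply cont_icube in I1, I2, I3; rewrite kube in I1, I2, I3 by lra.
  set (k1 := 25 / rad x y ^ 3) in *; set (k2 := 25 / rad (xi - x / 2) (et - y / 2) ^ 3) in *.
  set (k3 := 25 / rad (xi + x / 2) (et + y / 2) ^ 3) in *.
  assert (S := cont_iadd p I2 I3); assert (D := cont_isub p I3 I2).
  assert (L := cont_iadd p (cont_iint p 8 I1) (cont_iint p 2 S)).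
  assert (S6 := cont_iint p 6 S).
  assert (T20 : forall J z a f g, cont p J a -> Rabs f <= g -> ub z g -> a = 20 * f ->
    iout J (20 * z) = false).
  { intros J z a f g HJ Hf Hz ->; apply (iout_false (r := 20 * g) HJ).
    - rewrite Rabs_mult, (Rabs_pos_eq 20); lra.
    - now apply (ub_scale 20). }
  rewrite (T20 _ _ _ _ _ (cont_iadd p
      (cont_imul p p_ge0 (cont_ishift (-15) _ _ L) Hx) (cont_iint p 4 (cont_imul p p_ge0 D Hxi)))
    e1 U1 ltac:(field)) in HT.
  rewrite (T20 _ _ _ _ _ (cont_iadd p
      (cont_imul p p_ge0 (cont_ishift (-45) _ _ L) Hy) (cont_iint p 4 (cont_imul p p_ge0 D Het)))
    e2 U2 ltac:(field)) in HT.
  rewrite (T20 _ _ _ _ _ (cont_iadd p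
      (cont_imul p p_ge0 (cont_ishift (-15) _ _ S6) Hxi) (cont_iint p 3 (cont_imul p p_ge0 D Hx)))
    e3 U3 ltac:(field)) in HT.
  rewrite (T20 _ _ _ _ _ (cont_iadd p
      (cont_imul p p_ge0 (cont_ishift (-45) _ _ S6) Het) (cont_iint p 3 (cont_imul p p_ge0 D Hy)))
    e4 U4 ltac:(field)) in HT.
  discriminate.
Qed.

(* The bounds of [jacobi_system_first_quadrant] times 4096, rounded outwards. *)
Definition jacobi_domain : list itv :=
  [(0, 68813); (0, 31130); (0, 59802); (-27034, 27034)]%Z.

Lemma jacobi_system_first_quadrant x y xi et :
  0 <= x <= 168 / 10 -> 0 <= y <= 76 / 10 -> 0 <= xi <= 146 / 10 -> -66 / 10 <= et <= 66 / 10 ->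
  jacobi_system x y xi et -> Exists (fun h => in_hull h [x; y; xi; et]) hulls.
Proof.
  intros Hx Hy Hxi Het Hsys.
  assert (C : bisect jacobi_test 60 jacobi_domain = true) by (vm_cast_no_check (eq_refl true)).
  refine (bisect_sound p _ _ jacobi_test_correct _ _ [x; y; xi; et] C _ Hsys).
  unfold p; constructor; [|constructor; [|constructor; [|constructor; [|constructor]]]];
    split; cbn [fst snd]; change (IZR (2 ^ 12)) with 4096; lra.
Qed.

End JacobiTest.

(** * From the light equations to the Jacobi system *)

Record light_system (Q E F x1 y1 x2 y2 x3 y3 : R) : Prop := LightSystem {
  ls_heavy : heavy_near Q E F;
  ls_eq1 : light_eq Q E F x1 y1 x2 y2 x3 y3;
  ls_eq2 : light_eq Q E F x2 y2 x1 y1 x3 y3;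
  ls_eq3 : light_eq Q E F x3 y3 x1 y1 x2 y2;
  ls_d12 : 185 / 100000 <= rad (x1 - x2) (y1 - y2);
  ls_d13 : 185 / 100000 <= rad (x1 - x3) (y1 - y3);
  ls_d23 : 185 / 100000 <= rad (x2 - x3) (y2 - y3);
  ls_virial :
    3 / 10 * (x1 * x1 + x2 * x2 + x3 * x3)
    + 3 / 2 * ((y1 - Y0) * (y1 - Y0) + (y2 - Y0) * (y2 - Y0) + (y3 - Y0) * (y3 - Y0))
    <= 422 / 10000000 }.

Arguments ls_heavy {Q E F x1 y1 x2 y2 x3 y3}.
Arguments ls_virial {Q E F x1 y1 x2 y2 x3 y3}.

Lemma light_system_rot {Q E F x1 y1 x2 y2 x3 y3} :
  light_system Q E F x1 y1 x2 y2 x3 y3 -> light_system Q E F x2 y2 x3 y3 x1 y1.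
Proof.
  intros [H E1 E2 E3 D12 D13 D23 V]; split; trivial; try (apply light_eq_sym; assumption);
    try lra; rewrite rad_sym; assumption.
Qed.

Lemma sqr_le_Rabs a b : 0 <= b -> a * a <= b * b -> Rabs a <= b.
Proof. intros Hb H; apply Rabs_le; split; nra. Qed.

Ltac squares_nonneg x1 y1 x2 y2 x3 y3 :=
  pose proof (Rle_0_sqr x1); pose proof (Rle_0_sqr x2); pose proof (Rle_0_sqr x3);
  pose proof (Rle_0_sqr (y1 - Y0)); pose proof (Rle_0_sqr (y2 - Y0));
  pose proof (Rle_0_sqr (y3 - Y0)); unfold Rsqr in *.

Lemma light_system_near {Q E F x1 y1 x2 y2 x3 y3} :
  light_system Q E F x1 y1 x2 y2 x3 y3 ->
  Rabs x1 <= 12 / 1000 /\ Rabs (y1 - Y0) <= 54 / 10000.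
Proof.
  intros [_ _ _ _ _ _ _ V].
  squares_nonneg x1 y1 x2 y2 x3 y3.
  split; apply sqr_le_Rabs; lra.
Qed.

Lemma rad_scale c x y : 0 < c -> rad (c * x) (c * y) = c * rad x y.
Proof.
  intros Hc; unfold rad.
  replace (c * x * (c * x) + c * y * (c * y)) with ((c * c) * (x * x + y * y)) by ring.
  rewrite sqrt_mult by nra; now rewrite sqrt_square by lra.
Qed.

(** As mu = 25 / 10^9, the change to thousandths turns mu / r^3 into 25 / r^3. *)
Lemma mu_fx x y : 0 < rad x y -> mu * fx x y = 25 / rad (1000 * x) (1000 * y) ^ 3 * x.
Proof. intros H; rewrite rad_scale, mu_eq by lra; unfold fx; field; lra. Qed.

Lemma mu_fy x y : 0 < rad x y -> mu * fy x y = 25 / rad (1000 * x) (1000 * y) ^ 3 * y.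
Proof. intros H; rewrite rad_scale, mu_eq by lra; unfold fy; field; lra. Qed.

(* The forces between the light bodies cancel in the sum of their equations. *)
Lemma centre_bound Q E F x1 y1 x2 y2 x3 y3 Wx Wy Sx Sy :
  light_system Q E F x1 y1 x2 y2 x3 y3 ->
  Rabs x1 <= Wx -> Rabs x2 <= Wx -> Rabs x3 <= Wx ->
  Rabs (y1 - Y0) <= Wy -> Rabs (y2 - Y0) <= Wy -> Rabs (y3 - Y0) <= Wy ->
  Wx <= 12 / 1000 -> Wy <= 54 / 10000 ->
  Rabs x1 + Rabs x2 + Rabs x3 <= Sx ->
  Rabs (y1 - Y0) + Rabs (y2 - Y0) + Rabs (y3 - Y0) <= Sy ->
  3 / 4 * Rabs (x1 + x2 + x3) <= 36 / 10000000 + kxx Wx Wy * Sx + kxy Wx Wy * Sy /\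
  9 / 4 * Rabs (y1 - Y0 + (y2 - Y0) + (y3 - Y0))
    <= 36 / 10000000 + kxy Wx Wy * Sx + kyy Wx Wy * Sy.
Proof.
  intros [Hq [L1 L1'] [L2 L2'] [L3 L3'] _ _ _ _] A1 A2 A3 B1 B2 B3 HWx HWy HSx HSy.
  destruct (lagrange_point Q E F Hq) as [G1 [G2 _]].
  assert (P1 := Rabs_pos x1); assert (P2 := Rabs_pos (y1 - Y0)).
  assert (Z1 : Rabs 0 <= Wx) by (rewrite Rabs_R0; lra).
  assert (Z2 : Rabs (Y0 - Y0) <= Wy) by (rewrite Rminus_diag, Rabs_R0 by reflexivity; lra).
  destruct (G_difference Q E F x1 y1 0 Y0 Wx Wy Hq A1 B1 Z1 Z2 HWx HWy) as [C1 D1].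
  destruct (G_difference Q E F x2 y2 0 Y0 Wx Wy Hq A2 B2 Z1 Z2 HWx HWy) as [C2 D2].
  destruct (G_difference Q E F x3 y3 0 Y0 Wx Wy Hq A3 B3 Z1 Z2 HWx HWy) as [C3 D3].
  rewrite Rminus_0_r in *.
  assert (SX : Gx Q E F x1 y1 + Gx Q E F x2 y2 + Gx Q E F x3 y3 = 0).
  { rewrite L1, L2, L3, (fx_sym x2 y2 x1 y1), (fx_sym x3 y3 x1 y1), (fx_sym x3 y3 x2 y2); ring. }
  assert (SY : Gy Q E F x1 y1 + Gy Q E F x2 y2 + Gy Q E F x3 y3 = 0).
  { rewrite L1', L2', L3', (fy_sym x2 y2 x1 y1), (fy_sym x3 y3 x1 y1), (fy_sym x3 y3 x2 y2); ring. }
  assert (Kxx : 0 <= kxx Wx Wy) by (unfold kxx; lra).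
  assert (Kxy : 0 <= kxy Wx Wy) by (unfold kxy; lra).
  assert (Kyy : 0 <= kyy Wx Wy) by (unfold kyy; lra).
  assert (M1 := Rmult_le_compat_l _ _ _ Kxx HSx); assert (M2 := Rmult_le_compat_l _ _ _ Kxy HSy).
  assert (M3 := Rmult_le_compat_l _ _ _ Kxy HSx); assert (M4 := Rmult_le_compat_l _ _ _ Kyy HSy).
  apply Rabs_le_inv in G1, G2, C1, C2, C3, D1, D2, D3.
  split.
  - rewrite <- (Rabs_pos_eq (3 / 4)), <- Rabs_mult by lra; apply Rabs_le; lra.
  - rewrite <- (Rabs_pos_eq (9 / 4)), <- Rabs_mult by lra; apply Rabs_le; lra.
Qed.

Lemma sum_abs_le a b c r t :
  0 <= t -> a * a + b * b + c * c <= r -> 3 * r <= t * t -> Rabs a + Rabs b + Rabs c <= t.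
Proof.
  intros Ht Hr Hrt.
  assert (S : forall z, Rabs z * Rabs z = z * z)
    by (intros z; rewrite <- Rabs_mult; apply Rabs_pos_eq, Rle_0_sqr).
  rewrite <- (S a), <- (S b), <- (S c) in Hr; apply Rsqr_incr_0_var; [unfold Rsqr|exact Ht].
  assert (H1 := Rle_0_sqr (Rabs a - Rabs b)); assert (H2 := Rle_0_sqr (Rabs a - Rabs c)).
  assert (H3 := Rle_0_sqr (Rabs b - Rabs c)); unfold Rsqr in *; nra.
Qed.

(** By Cauchy-Schwarz the virial bound limits the sums of absolute values more sharply than three
    times the individual bounds would. In thousandths the centre of mass is then within 0.15 of the
    Lagrange point in each coordinate. *)
Lemma centre_near {Q E F x1 y1 x2 y2 x3 y3} :
  light_system Q E F x1 y1 x2 y2 x3 y3 ->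
  Rabs (x1 + x2 + x3) <= 45 / 100000 /\
  Rabs (y1 - Y0 + (y2 - Y0) + (y3 - Y0)) <= 45 / 100000.
Proof.
  intros H; assert (V := ls_virial H).
  destruct (light_system_near H) as [A1 B1]; destruct (light_system_near (light_system_rot H)) as [A2 B2].
  destruct (light_system_near (light_system_rot (light_system_rot H))) as [A3 B3].
  squares_nonneg x1 y1 x2 y2 x3 y3.
  assert (Sx : Rabs x1 + Rabs x2 + Rabs x3 <= 206 / 10000)
    by (apply (sum_abs_le _ _ _ (1407 / 10000000)); lra).
  assert (Sy : Rabs (y1 - Y0) + Rabs (y2 - Y0) + Rabs (y3 - Y0) <= 92 / 10000)
    by (apply (sum_abs_le _ _ _ (282 / 10000000)); lra).
  destruct (centre_bound _ _ _ _ _ _ _ _ _ (12 / 1000) (54 / 10000) _ _ H A1 A2 A3 B1 B2 B3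
    (Rle_refl _) (Rle_refl _) Sx Sy) as [C1 C2].
  unfold kxx, kxy, kyy in *; lra.
Qed.

Lemma abs_pair_max a b : Rabs (a + b) + Rabs (a - b) = 2 * Rmax (Rabs a) (Rabs b).
Proof.
  unfold Rmax; destruct Rle_dec as [L|L]; revert L; unfold Rabs; repeat destruct Rcase_abs; lra.
Qed.

Definition jx (x1 x2 x3 : R) : R := 1000 * (x3 - x2).
Definition jm (x1 x2 x3 : R) : R := 1000 * (x1 - (x2 + x3) / 2).

(** In thousandths the bodies sit at c + 2m/3 and c - m/3 -+ u/2 around their centre c. Six times
    |c| is at most 0.9, which the summand 1 of [six_extent] covers. *)
Lemma extent_bound x1 x2 x3 :
  Rabs (x1 + x2 + x3) <= 45 / 100000 ->
  Rmax (Rmax (Rabs x1) (Rabs x2)) (Rabs x3) <= six_extent (jx x1 x2 x3) (jm x1 x2 x3) / 6000.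
Proof.
  intros H; unfold six_extent, jx, jm.
  rewrite !Rabs_mult, (Rabs_pos_eq 1000) by lra.
  repeat apply Rmax_lub; unfold Rabs in *; repeat destruct Rcase_abs; lra.
Qed.

(** r1, r2, r3 are the squared sides opposite bodies 1, 2, 3. Comparing squares instead of lengths
    makes the apex condition polynomial in the Jacobi coordinates. *)
Definition isosceles_label (x1 y1 x2 y2 x3 y3 : R) : Prop :=
  let r1 := (x3 - x2) * (x3 - x2) + (y3 - y2) * (y3 - y2) in
  let r2 := (x1 - x3) * (x1 - x3) + (y1 - y3) * (y1 - y3) in
  let r3 := (x1 - x2) * (x1 - x2) + (y1 - y2) * (y1 - y2) in
  Rabs (r3 - r2) <= Rabs (r1 - r2) /\ Rabs (r3 - r2) <= Rabs (r1 - r3).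

Lemma rad_jacobi2 x1 y1 x2 y2 x3 y3 :
  rad (jm x1 x2 x3 - jx x1 x2 x3 / 2) (jm y1 y2 y3 - jx y1 y2 y3 / 2)
  = rad (1000 * (x1 - x3)) (1000 * (y1 - y3)).
Proof. unfold jm, jx; f_equal; field. Qed.

Lemma rad_jacobi3 x1 y1 x2 y2 x3 y3 :
  rad (jm x1 x2 x3 + jx x1 x2 x3 / 2) (jm y1 y2 y3 + jx y1 y2 y3 / 2)
  = rad (1000 * (x1 - x2)) (1000 * (y1 - y2)).
Proof. unfold jm, jx; f_equal; field. Qed.

(* The two rows are treated alike: z is the abscissa or the ordinate, g the
   corresponding component of G, and a, ka, kb the entries of its row. *)
Lemma jacobi_row k1 k2 k3 g1 g2 g3 z1 z2 z3 t1 t2 t3 a ka kb Ka Kb :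
  g1 = k3 * (z1 - z2) + k2 * (z1 - z3) ->
  g2 = k3 * (z2 - z1) + k1 * (z2 - z3) ->
  g3 = k2 * (z3 - z1) + k1 * (z3 - z2) ->
  0 <= ka <= Ka -> 0 <= kb <= Kb ->
  Rabs (g3 - g2 - a * (z3 - z2)) <= ka * Rabs (z3 - z2) + kb * Rabs (t3 - t2) ->
  Rabs (g1 - g2 - a * (z1 - z2)) <= ka * Rabs (z1 - z2) + kb * Rabs (t1 - t2) ->
  Rabs (g1 - g3 - a * (z1 - z3)) <= ka * Rabs (z1 - z3) + kb * Rabs (t1 - t3) ->
  Rabs ((2 * k1 + (k2 + k3) / 2 - a) * jx z1 z2 z3 + (k3 - k2) * jm z1 z2 z3)
    <= Ka * Rabs (jx z1 z2 z3) + Kb * Rabs (jx t1 t2 t3) /\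
  Rabs ((3 / 2 * (k2 + k3) - a) * jm z1 z2 z3 + 3 / 4 * (k3 - k2) * jx z1 z2 z3)
    <= Ka * Rmax (Rabs (jm z1 z2 z3)) (Rabs (jx z1 z2 z3) / 2)
       + Kb * Rmax (Rabs (jm t1 t2 t3)) (Rabs (jx t1 t2 t3) / 2).
Proof.
  intros E1 E2 E3 Hka Hkb H32 H12 H13.
  assert (R2 : forall z, Rabs z / 2 = Rabs (z / 2))
    by (intros z; unfold Rdiv; rewrite Rabs_mult, (Rabs_pos_eq (/ 2)); lra).
  split.
  - replace ((2 * k1 + (k2 + k3) / 2 - a) * jx z1 z2 z3 + (k3 - k2) * jm z1 z2 z3)
      with (1000 * (g3 - g2 - a * (z3 - z2))) by (rewrite E2, E3; unfold jx, jm; field).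
    unfold jx; rewrite !Rabs_mult, (Rabs_pos_eq 1000) by lra.
    assert (M1 : ka * Rabs (z3 - z2) <= Ka * Rabs (z3 - z2))
      by (apply Rmult_le_compat_r; [apply Rabs_pos | lra]).
    assert (M2 : kb * Rabs (t3 - t2) <= Kb * Rabs (t3 - t2))
      by (apply Rmult_le_compat_r; [apply Rabs_pos | lra]).
    lra.
  - replace ((3 / 2 * (k2 + k3) - a) * jm z1 z2 z3 + 3 / 4 * (k3 - k2) * jx z1 z2 z3)
      with (500 * ((g1 - g2 - a * (z1 - z2)) + (g1 - g3 - a * (z1 - z3))))
      by (rewrite E1, E2, E3; unfold jx, jm; field).
    rewrite Rabs_mult, (Rabs_pos_eq 500), !R2 by lra.
    assert (T := Rabs_triang (g1 - g2 - a * (z1 - z2)) (g1 - g3 - a * (z1 - z3))).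
    assert (Mz := abs_pair_max (jm z1 z2 z3) (jx z1 z2 z3 / 2)).
    assert (Mt := abs_pair_max (jm t1 t2 t3) (jx t1 t2 t3 / 2)).
    assert (X : forall u1 u2 u3, Rabs (jm u1 u2 u3 + jx u1 u2 u3 / 2) = 1000 * Rabs (u1 - u2)
      /\ Rabs (jm u1 u2 u3 - jx u1 u2 u3 / 2) = 1000 * Rabs (u1 - u3)).
    { intros u1 u2 u3; rewrite <- (Rabs_pos_eq 1000), <- !Rabs_mult by lra; unfold jm, jx.
      split; f_equal; field. }
    destruct (X z1 z2 z3) as [Xz1 Xz2]; destruct (X t1 t2 t3) as [Xt1 Xt2].
    rewrite Xz1, Xz2 in Mz; rewrite Xt1, Xt2 in Mt.
    assert (Pz1 := Rabs_pos (z1 - z2)); assert (Pz2 := Rabs_pos (z1 - z3)).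
    assert (Pt1 := Rabs_pos (t1 - t2)); assert (Pt2 := Rabs_pos (t1 - t3)).
    assert (M1 : ka * (Rabs (z1 - z2) + Rabs (z1 - z3)) <= Ka * (Rabs (z1 - z2) + Rabs (z1 - z3)))
      by (apply Rmult_le_compat_r; lra).
    assert (M2 : kb * (Rabs (t1 - t2) + Rabs (t1 - t3)) <= Kb * (Rabs (t1 - t2) + Rabs (t1 - t3)))
      by (apply Rmult_le_compat_r; lra).
    replace (Rmax (Rabs (jm z1 z2 z3)) (Rabs (jx z1 z2 z3 / 2)))
      with (500 * (Rabs (z1 - z2) + Rabs (z1 - z3))) by lra.
    replace (Rmax (Rabs (jm t1 t2 t3)) (Rabs (jx t1 t2 t3 / 2)))
      with (500 * (Rabs (t1 - t2) + Rabs (t1 - t3))) by lra.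
    lra.
Qed.

Lemma light_system_jacobi {Q E F x1 y1 x2 y2 x3 y3} :
  light_system Q E F x1 y1 x2 y2 x3 y3 -> isosceles_label x1 y1 x2 y2 x3 y3 ->
  jacobi_system (jx x1 x2 x3) (jx y1 y2 y3) (jm x1 x2 x3) (jm y1 y2 y3).
Proof.
  intros H [I2 I3].
  destruct (light_system_near H) as [A1 B1]; destruct (light_system_near (light_system_rot H)) as [A2 B2].
  destruct (light_system_near (light_system_rot (light_system_rot H))) as [A3 B3].
  destruct (centre_near H) as [Cx Cy].
  destruct H as [Hq [L1 L1'] [L2 L2'] [L3 L3'] D12 D13 D23 _].
  (* The extents of the triangle itself, instead of the uniform bounds 0.012 and 0.0054: the error
     terms then shrink with the triangle and can be expressed by its Jacobi coordinates. *)
  set (Wx := Rmax (Rmax (Rabs x1) (Rabs x2)) (Rabs x3)).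
  set (Wy := Rmax (Rmax (Rabs (y1 - Y0)) (Rabs (y2 - Y0))) (Rabs (y3 - Y0))).
  assert (HWx : Wx <= 12 / 1000) by (repeat apply Rmax_lub; assumption).
  assert (HWy : Wy <= 54 / 10000) by (repeat apply Rmax_lub; assumption).
  assert (W1 : Rabs x1 <= Wx) by (eapply Rle_trans; [|apply Rmax_l]; apply Rmax_l).
  assert (W2 : Rabs x2 <= Wx) by (eapply Rle_trans; [|apply Rmax_l]; apply Rmax_r).
  assert (W3 : Rabs x3 <= Wx) by apply Rmax_r.
  assert (V1 : Rabs (y1 - Y0) <= Wy) by (eapply Rle_trans; [|apply Rmax_l]; apply Rmax_l).
  assert (V2 : Rabs (y2 - Y0) <= Wy) by (eapply Rle_trans; [|apply Rmax_l]; apply Rmax_r).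
  assert (V3 : Rabs (y3 - Y0) <= Wy) by apply Rmax_r.
  assert (Ex := extent_bound _ _ _ Cx); assert (Ey := extent_bound _ _ _ Cy).
  fold Wx in Ex; fold Wy in Ey.
  replace (jx (y1 - Y0) (y2 - Y0) (y3 - Y0)) with (jx y1 y2 y3) in Ey by (unfold jx; ring).
  replace (jm (y1 - Y0) (y2 - Y0) (y3 - Y0)) with (jm y1 y2 y3) in Ey by (unfold jm; field).
  destruct (G_difference _ _ _ _ _ _ _ _ _ Hq W3 V3 W2 V2 HWx HWy) as [X32 Y32].
  destruct (G_difference _ _ _ _ _ _ _ _ _ Hq W1 V1 W2 V2 HWx HWy) as [X12 Y12].
  destruct (G_difference _ _ _ _ _ _ _ _ _ Hq W1 V1 W3 V3 HWx HWy) as [X13 Y13].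
  assert (Wx0 := Rle_trans _ _ _ (Rabs_pos _) W1); assert (Wy0 := Rle_trans _ _ _ (Rabs_pos _) V1).
  set (Ax := six_extent (jx x1 x2 x3) (jm x1 x2 x3)) in *.
  set (Ay := six_extent (jx y1 y2 y3) (jm y1 y2 y3)) in *.
  assert (Kxx : 0 <= kxx Wx Wy <= kapxx Ax Ay) by (unfold kxx, kapxx; lra).
  assert (Kxy : 0 <= kxy Wx Wy <= kapxy Ax Ay) by (unfold kxy, kapxy; lra).
  assert (Kyy : 0 <= kyy Wx Wy <= kapyy Ax Ay) by (unfold kyy, kapyy; lra).
  assert (S23 : 0 < rad (x2 - x3) (y2 - y3)) by lra.
  assert (S13 : 0 < rad (x1 - x3) (y1 - y3)) by lra.
  assert (S12 : 0 < rad (x1 - x2) (y1 - y2)) by lra.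
  rewrite Rmult_plus_distr_l, !mu_fx in L1, L2, L3
    by (assumption || (rewrite rad_sym; assumption)).
  rewrite Rmult_plus_distr_l, !mu_fy in L1', L2', L3'
    by (assumption || (rewrite rad_sym; assumption)).
  assert (RS : forall a b c d, rad (1000 * (a - b)) (1000 * (c - d)) = rad (1000 * (b - a)) (1000 * (d - c))).
  { intros; rewrite <- rad_opp; f_equal; ring. }
  rewrite (RS x2 x1) in L2, L2'; rewrite (RS x3 x1), (RS x3 x2) in L3, L3'.
  destruct (jacobi_row (25 / rad (1000 * (x2 - x3)) (1000 * (y2 - y3)) ^ 3)
    (25 / rad (1000 * (x1 - x3)) (1000 * (y1 - y3)) ^ 3)
    (25 / rad (1000 * (x1 - x2)) (1000 * (y1 - y2)) ^ 3)
    _ _ _ _ _ _ y1 y2 y3 _ _ _ _ _ L1 L2 L3 Kxx Kxy X32 X12 X13) as [J1 J3].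
  (* In the row of the ordinates the diagonal entry comes second, so the summands are exchanged to
     fit [jacobi_row], and exchanged back afterwards. *)
  rewrite Rplus_comm in Y32, Y12, Y13.
  destruct (jacobi_row (25 / rad (1000 * (x2 - x3)) (1000 * (y2 - y3)) ^ 3)
    (25 / rad (1000 * (x1 - x3)) (1000 * (y1 - y3)) ^ 3)
    (25 / rad (1000 * (x1 - x2)) (1000 * (y1 - y2)) ^ 3)
    _ _ _ _ _ _ x1 x2 x3 _ _ _ _ _ L1' L2' L3' Kyy Kxy Y32 Y12 Y13) as [J2 J4].
  rewrite (Rplus_comm (kapyy _ _ * _)) in J2; rewrite (Rplus_comm (kapyy _ _ * _)) in J4.
  constructor.
  - unfold jx; rewrite rad_scale, rad_sym by lra; lra.
  - rewrite rad_jacobi2, rad_scale by lra; lra.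
  - rewrite rad_jacobi3, rad_scale by lra; lra.
  - cbv zeta in I2; revert I2; unfold jx, jm; intros I2.
    apply (Rmult_le_compat_l 1000000) in I2; [|lra].
    rewrite <- (Rabs_pos_eq 1000000), <- !Rabs_mult in I2 by lra.
    eapply Rle_trans; [|eapply Rle_trans; [exact I2|]]; right; f_equal; field.
  - cbv zeta in I3; revert I3; unfold jx, jm; intros I3.
    apply (Rmult_le_compat_l 1000000) in I3; [|lra].
    rewrite <- (Rabs_pos_eq 1000000), <- !Rabs_mult in I3 by lra.
    eapply Rle_trans; [|eapply Rle_trans; [exact I3|]]; right; f_equal; field.
  - cbv zeta.
    replace (rad (jx x1 x2 x3) (jx y1 y2 y3)) with (rad (1000 * (x2 - x3)) (1000 * (y2 - y3)))
      by (unfold jx; rewrite <- rad_opp; f_equal; ring).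
    rewrite rad_jacobi2, rad_jacobi3; fold Ax Ay; auto.
Qed.

(** * Sign symmetries of the Jacobi system *)

Lemma rad_opp_l x y : rad (- x) y = rad x y.
Proof. unfold rad; f_equal; ring. Qed.

(** The exact equations need not have this symmetry, as the heavy bodies are not placed
    symmetrically. The weakened system has it because its error terms depend on absolute values
    only. *)
Lemma jacobi_system_mirror x y xi et : jacobi_system x y xi et -> jacobi_system (- x) y (- xi) et.
Proof.
  intros [r1 r2 r3 i2 i3 eqs].
  assert (A2 : rad (- xi - - x / 2) (et - y / 2) = rad (xi - x / 2) (et - y / 2))
    by (rewrite <- rad_opp_l; f_equal; field).
  assert (A3 : rad (- xi + - x / 2) (et + y / 2) = rad (xi + x / 2) (et + y / 2))
    by (rewrite <- rad_opp_l; f_equal; field).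
  constructor; rewrite ?A2, ?A3, ?rad_opp_l; trivial.
  - eapply Rle_trans; [|eapply Rle_trans; [exact i2|]]; right; f_equal; field.
  - eapply Rle_trans; [|eapply Rle_trans; [exact i3|]]; right; f_equal; field.
  - cbv zeta in *; unfold six_extent in *; rewrite !Rabs_Ropp.
    destruct eqs as [e1 [e2 [e3 e4]]]; repeat split; trivial.
    + eapply Rle_trans; [|exact e1]; rewrite <- Rabs_Ropp; right; f_equal; ring.
    + eapply Rle_trans; [|exact e3]; rewrite <- Rabs_Ropp; right; f_equal; ring.
Qed.

Ltac same_up_to_sign E :=
  first [ eapply Rle_trans; [|exact E]; right; f_equal; field
        | eapply Rle_trans; [|exact E]; rewrite <- Rabs_Ropp; right; f_equal; field ].

Ltac exchange_sides A2 A3 r1 r2 r3 i2 i3 eqs x y xi et :=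
  constructor; rewrite ?A2, ?A3, ?rad_opp; trivial;
  [ rewrite <- Rabs_Ropp; eapply Rle_trans; [|eapply Rle_trans; [exact i3|]]; right; f_equal; field
  | rewrite <- Rabs_Ropp; eapply Rle_trans; [|eapply Rle_trans; [exact i2|]]; right; f_equal; field
  | cbv zeta in *; unfold six_extent in *; rewrite ?A2, ?A3, ?rad_opp, !Rabs_Ropp;
    set (k1 := 25 / rad x y ^ 3) in *;
    set (k2 := 25 / rad (xi - x / 2) (et - y / 2) ^ 3) in *;
    set (k3 := 25 / rad (xi + x / 2) (et + y / 2) ^ 3) in *;
    let e1 := fresh in let e2 := fresh in let e3 := fresh in let e4 := fresh in
    destruct eqs as [e1 [e2 [e3 e4]]]; repeat split;
    [same_up_to_sign e1 | same_up_to_sign e2 | same_up_to_sign e3 | same_up_to_sign e4] ].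

(* Half a turn of the apex about the midpoint of the base exchanges k2 and k3. *)
Lemma jacobi_system_half_turn x y xi et : jacobi_system x y xi et -> jacobi_system x y (- xi) (- et).
Proof.
  intros [r1 r2 r3 i2 i3 eqs].
  assert (A2 : rad (- xi - x / 2) (- et - y / 2) = rad (xi + x / 2) (et + y / 2))
    by (rewrite <- rad_opp; f_equal; ring).
  assert (A3 : rad (- xi + x / 2) (- et + y / 2) = rad (xi - x / 2) (et - y / 2))
    by (rewrite <- rad_opp; f_equal; ring).
  exchange_sides A2 A3 r1 r2 r3 i2 i3 eqs x y xi et.
Qed.

(* So does half a turn of the base. *)
Lemma jacobi_system_opp x y xi et : jacobi_system x y xi et -> jacobi_system (- x) (- y) xi et.
Proof.
  intros [r1 r2 r3 i2 i3 eqs].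
  assert (A2 : rad (xi - - x / 2) (et - - y / 2) = rad (xi + x / 2) (et + y / 2))
    by (f_equal; field).
  assert (A3 : rad (xi + - x / 2) (et + - y / 2) = rad (xi - x / 2) (et - y / 2))
    by (f_equal; field).
  exchange_sides A2 A3 r1 r2 r3 i2 i3 eqs x y xi et.
Qed.

(** The available symmetries preserve the product of the four signs. So x, y and xi can be made
    nonnegative while the sign of et remains; hence the witness [e] and the two-sided range of et in
    [jacobi_domain]. *)
Lemma jacobi_system_hull x y xi et :
  Rabs x <= 168 / 10 -> Rabs y <= 76 / 10 -> Rabs xi <= 146 / 10 -> Rabs et <= 66 / 10 ->
  jacobi_system x y xi et ->
  exists e, Rabs e = Rabs et /\ Exists (fun h => in_hull h [Rabs x; Rabs y; Rabs xi; e]) hulls.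
Proof.
  intros Hx Hy Hxi Het H.
  assert (P1 := Rabs_pos x); assert (P2 := Rabs_pos y); assert (P3 := Rabs_pos xi).
  assert (S : exists e, Rabs e = Rabs et /\ jacobi_system (Rabs x) (Rabs y) (Rabs xi) e).
  { clear - H.
    assert (A : exists a b e, Rabs a = Rabs x /\ Rabs b = Rabs xi /\ Rabs e = Rabs et
      /\ 0 <= a /\ jacobi_system a (Rabs y) b e).
    { assert (A : exists a, Rabs a = Rabs x /\ jacobi_system a (Rabs y) xi et).
      { destruct (Rle_dec 0 y) as [L|L].
        - exists x; rewrite (Rabs_pos_eq y); auto.
        - exists (- x); rewrite Rabs_Ropp, (Rabs_left y) by lra; split; trivial.
          now apply jacobi_system_opp. }
      destruct A as [a [E A]]; destruct (Rle_dec 0 a) as [L|L].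
      - exists a, xi, et; auto.
      - exists (- a), (- xi), et; rewrite !Rabs_Ropp.
        apply jacobi_system_mirror in A; assert (0 <= - a) by lra; auto. }
    destruct A as [a [b [e [E1 [E2 [E3 [Ha A]]]]]]].
    rewrite <- E1, <- E2, (Rabs_pos_eq a) by exact Ha.
    destruct (Rle_dec 0 b) as [L|L].
    - exists e; rewrite (Rabs_pos_eq b); auto.
    - exists (- e); rewrite Rabs_Ropp, (Rabs_left b) by lra; split; trivial.
      now apply jacobi_system_half_turn. }
  destruct S as [e [E S]]; exists e; split; [exact E|].
  rewrite <- E in Het; apply Rabs_le_inv in Het.
  apply jacobi_system_first_quadrant; lra || assumption.
Qed.

(** * Localisation of the light triangle in small boxes *)

Lemma isosceles_label_exists x1 y1 x2 y2 x3 y3 :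
  isosceles_label x1 y1 x2 y2 x3 y3 \/ isosceles_label x2 y2 x3 y3 x1 y1 \/
  isosceles_label x3 y3 x1 y1 x2 y2.
Proof.
  unfold isosceles_label; cbv zeta.
  replace ((x2 - x1) * (x2 - x1) + (y2 - y1) * (y2 - y1))
    with ((x1 - x2) * (x1 - x2) + (y1 - y2) * (y1 - y2)) by ring.
  replace ((x3 - x1) * (x3 - x1) + (y3 - y1) * (y3 - y1))
    with ((x1 - x3) * (x1 - x3) + (y1 - y3) * (y1 - y3)) by ring.
  replace ((x2 - x3) * (x2 - x3) + (y2 - y3) * (y2 - y3))
    with ((x3 - x2) * (x3 - x2) + (y3 - y2) * (y3 - y2)) by ring.
  set (a := (x3 - x2) * (x3 - x2) + (y3 - y2) * (y3 - y2)).
  set (b := (x1 - x3) * (x1 - x3) + (y1 - y3) * (y1 - y3)).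
  set (c := (x1 - x2) * (x1 - x2) + (y1 - y2) * (y1 - y2)).
  rewrite (Rabs_minus_sym c b), (Rabs_minus_sym a c), (Rabs_minus_sym b a).
  destruct (Rle_dec (Rabs (b - c)) (Rabs (a - b))); destruct (Rle_dec (Rabs (b - c)) (Rabs (c - a)));
    destruct (Rle_dec (Rabs (a - b)) (Rabs (c - a))); lra.
Qed.

(* Jacobi coordinates followed by those of the centre of mass of the light bodies
   relative to the Lagrange point. *)
Definition coords (x1 y1 x2 y2 x3 y3 : R) : list R :=
  [jx x1 x2 x3; jx y1 y2 y3; jm x1 x2 x3; jm y1 y2 y3;
   1000 / 3 * (x1 + x2 + x3); 1000 / 3 * (y1 - Y0 + (y2 - Y0) + (y3 - Y0))].

(** Exchanging the base bodies flips the signs of x and y but not that of xi, so the isosceles hull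
    splits into two boxes. The radius 123 / 4096 of the centre of mass is just above 1000 / 3 times
    the bound of [centre_nearer]. *)
Definition boxes : list (list (Z * Z)) :=
  [[(28400, 123); (0, 205); (0, 123); (0, 410); (0, 123); (0, 123)];
   [(0, 246); (19692, 164); (0, 123); (0, 123); (0, 123); (0, 123)];
   [(0, 246); (11977, 123); (18035, 164); (0, 123); (0, 123); (0, 123)];
   [(0, 246); (11977, 123); (-18035, 164); (0, 123); (0, 123); (0, 123)]]%Z.

Lemma extents x1 x2 x3 u m c :
  Rabs (jx x1 x2 x3) <= u -> Rabs (jm x1 x2 x3) <= m -> Rabs (x1 + x2 + x3) <= c ->
  Rabs x1 <= c / 3 + m / 1500 /\
  Rabs x2 <= c / 3 + m / 3000 + u / 2000 /\ Rabs x3 <= c / 3 + m / 3000 + u / 2000.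
Proof.
  unfold jx, jm; intros H1 H2 H3; apply Rabs_le_inv in H1, H2, H3.
  repeat split; apply Rabs_le; lra.
Qed.

(** A second pass of [centre_bound], with the extents of a hull in place of those of the virial
    region, sharpens the bound fivefold. The three alternatives are the hulls, rounded outwards. *)
Lemma centre_nearer Q E F x1 y1 x2 y2 x3 y3 u u' m m' :
  light_system Q E F x1 y1 x2 y2 x3 y3 ->
  Rabs (jx x1 x2 x3) <= u -> Rabs (jm x1 x2 x3) <= m ->
  Rabs (jx y1 y2 y3) <= u' -> Rabs (jm y1 y2 y3) <= m' ->
  (u, u', m, m') = (697 / 100, 6 / 100, 4 / 100, 11 / 100) \/
  (u, u', m, m') = (7 / 100, 485 / 100, 4 / 100, 4 / 100) \/
  (u, u', m, m') = (7 / 100, 296 / 100, 445 / 100, 4 / 100) ->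
  Rabs (x1 + x2 + x3) <= 9 / 100000 /\
  Rabs (y1 - Y0 + (y2 - Y0) + (y3 - Y0)) <= 9 / 100000.
Proof.
  intros H H1 H2 H3 H4 D.
  destruct (centre_near H) as [C1 C2].
  destruct (extents _ _ _ _ _ _ H1 H2 C1) as [X1 [X2 X3]].
  replace (jx y1 y2 y3) with (jx (y1 - Y0) (y2 - Y0) (y3 - Y0)) in H3 by (unfold jx; ring).
  replace (jm y1 y2 y3) with (jm (y1 - Y0) (y2 - Y0) (y3 - Y0)) in H4 by (unfold jm; field).
  destruct (extents _ _ _ _ _ _ H3 H4 C2) as [Y1 [Y2 Y3]].
  assert (B : exists Wx Wy Sx Sy,
    Rabs x1 <= Wx /\ Rabs x2 <= Wx /\ Rabs x3 <= Wx /\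
    Rabs (y1 - Y0) <= Wy /\ Rabs (y2 - Y0) <= Wy /\ Rabs (y3 - Y0) <= Wy /\
    Rabs x1 + Rabs x2 + Rabs x3 <= Sx /\ Rabs (y1 - Y0) + Rabs (y2 - Y0) + Rabs (y3 - Y0) <= Sy /\
    ((Wx, Wy, Sx, Sy) = (37 / 10000, 3 / 10000, 8 / 1000, 8 / 10000) \/
     (Wx, Wy, Sx, Sy) = (3 / 10000, 26 / 10000, 8 / 10000, 6 / 1000) \/
     (Wx, Wy, Sx, Sy) = (32 / 10000, 17 / 10000, 7 / 1000, 4 / 1000))).
  { destruct D as [D|[D|D]]; injection D as -> -> -> ->;
      [exists (37 / 10000), (3 / 10000), (8 / 1000), (8 / 10000)
      |exists (3 / 10000), (26 / 10000), (8 / 10000), (6 / 1000)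
      |exists (32 / 10000), (17 / 10000), (7 / 1000), (4 / 1000)];
      repeat split; try lra; auto. }
  destruct B as [Wx [Wy [Sx [Sy [B1 [B2 [B3 [B4 [B5 [B6 [B7 [B8 B]]]]]]]]]]]].
  assert (BW : Wx <= 12 / 1000 /\ Wy <= 54 / 10000)
    by (destruct B as [B|[B|B]]; injection B as -> -> -> ->; lra).
  destruct (centre_bound _ _ _ _ _ _ _ _ _ _ _ _ _ H B1 B2 B3 B4 B5 B6 (proj1 BW) (proj2 BW) B7 B8)
    as [E1 E2].
  unfold kxx, kxy, kyy in *.
  destruct B as [B|[B|B]]; injection B as -> -> -> ->; lra.
Qed.

Ltac split_forall2 H :=
  repeat match type of H with
  | Forall2 _ (_ :: _) (_ :: _) =>
      let A := fresh "A" in let B := fresh "B" in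
      apply Forall2_cons_iff in H as [A B]; rename B into H; cbn [fst snd] in A
  end; clear H.

Ltac in_box_by_bounds :=
  repeat match goal with H : Rabs _ <= _ |- _ => apply Rabs_le_inv in H end;
  unfold in_hull; repeat (constructor; [cbn [fst snd]; apply Rabs_le; lra|]); constructor.

Lemma light_system_box {Q E F x1 y1 x2 y2 x3 y3} :
  light_system Q E F x1 y1 x2 y2 x3 y3 -> isosceles_label x1 y1 x2 y2 x3 y3 ->
  Exists (fun h => in_hull h (coords x1 y1 x2 y2 x3 y3)) boxes \/
  Exists (fun h => in_hull h (coords x1 y1 x3 y3 x2 y2)) boxes.
Proof.
  intros H HL.
  assert (J := light_system_jacobi H HL).
  assert (V := ls_virial H).
  squares_nonneg x1 y1 x2 y2 x3 y3.
  (* These squares turn the virial bound into the range of the search: (x3 - x2)^2 + (x3 + x2)^2 = 2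
     (x2^2 + x3^2), and x1^2 + x2^2 + x3^2 is a third of the squared sum plus u^2 / 2 + 2 m^2 / 3,
     with u = x3 - x2 and m = x1 - (x2 + x3) / 2. *)
  assert (Tx := Rle_0_sqr (x3 + x2)); assert (Ty := Rle_0_sqr (y3 - Y0 + (y2 - Y0))).
  assert (Ux := Rle_0_sqr (x1 + x2 + x3)); assert (Uy := Rle_0_sqr (y1 - Y0 + (y2 - Y0) + (y3 - Y0))).
  assert (Vx := Rle_0_sqr (x3 - x2)); assert (Vy := Rle_0_sqr (y3 - y2)).
  unfold Rsqr in *.
  assert (Hx : Rabs (jx x1 x2 x3) <= 168 / 10) by (unfold jx; apply sqr_le_Rabs; lra).
  assert (Hy : Rabs (jx y1 y2 y3) <= 76 / 10) by (unfold jx; apply sqr_le_Rabs; lra).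
  assert (Hxi : Rabs (jm x1 x2 x3) <= 146 / 10) by (unfold jm; apply sqr_le_Rabs; lra).
  assert (Het : Rabs (jm y1 y2 y3) <= 66 / 10) by (unfold jm; apply sqr_le_Rabs; lra).
  destruct (jacobi_system_hull _ _ _ _ Hx Hy Hxi Het J) as [e [Ee Hull]].
  clear - H Ee Hull.
  assert (Wx : jx x1 x3 x2 = - jx x1 x2 x3) by (unfold jx; ring).
  assert (Wy : jx y1 y3 y2 = - jx y1 y2 y3) by (unfold jx; ring).
  assert (Wxi : jm x1 x3 x2 = jm x1 x2 x3) by (unfold jm; field).
  assert (Wet : jm y1 y3 y2 = jm y1 y2 y3) by (unfold jm; field).
  assert (C : forall a, Rabs a <= 9 / 100000 -> Rabs (1000 / 3 * a - 0 / 4096) <= 123 / 4096).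
  { intros a Ha; apply Rabs_le_inv in Ha; apply Rabs_le; lra. }
  assert (CN := centre_nearer Q E F x1 y1 x2 y2 x3 y3).
  unfold coords; rewrite Wx, Wy, Wxi, Wet.
  replace (x1 + x3 + x2) with (x1 + x2 + x3) by ring.
  replace (y1 - Y0 + (y3 - Y0) + (y2 - Y0)) with (y1 - Y0 + (y2 - Y0) + (y3 - Y0)) by ring.
  set (x := jx x1 x2 x3) in *; set (y := jx y1 y2 y3) in *.
  set (xi := jm x1 x2 x3) in *; set (et := jm y1 y2 y3) in *.
  unfold hulls, boxes in *.
  apply Exists_cons in Hull as [Hull|Hull];
    [|apply Exists_cons in Hull as [Hull|Hull];
      [|apply Exists_cons in Hull as [Hull|Hull]; [|now apply Exists_nil in Hull]]];
    unfold in_hull in Hull; split_forall2 Hull;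
    rewrite ?Rdiv_0_l, ?Rminus_0_r, ?Rabs_Rabsolu in *; rewrite Ee in *.
  - destruct (CN (697 / 100) (6 / 100) (4 / 100) (11 / 100) H) as [C1 C2];
      [apply Rabs_le_inv in A; lra | lra | lra | lra | now left |].
    apply C in C1, C2; destruct (Rle_dec 0 x) as [L|L];
      [left; rewrite (Rabs_pos_eq x) in A by lra | right; rewrite (Rabs_left x) in A by lra];
      apply Exists_cons_hd; in_box_by_bounds.
  - destruct (CN (7 / 100) (485 / 100) (4 / 100) (4 / 100) H) as [C1 C2];
      [lra | lra | apply Rabs_le_inv in A0; lra | lra | right; now left |].
    apply C in C1, C2; destruct (Rle_dec 0 y) as [L|L];
      [left; rewrite (Rabs_pos_eq y) in A0 by lra | right; rewrite (Rabs_left y) in A0 by lra];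
      apply Exists_cons_tl, Exists_cons_hd; in_box_by_bounds.
  - destruct (CN (7 / 100) (296 / 100) (445 / 100) (4 / 100) H) as [C1 C2];
      [lra | apply Rabs_le_inv in A1; lra | apply Rabs_le_inv in A0; lra | lra | right; now right |].
    apply C in C1, C2; destruct (Rle_dec 0 y) as [L|L];
      [left; rewrite (Rabs_pos_eq y) in A0 by lra | right; rewrite (Rabs_left y) in A0 by lra];
      (destruct (Rle_dec 0 xi) as [L'|L'];
        [apply Exists_cons_tl, Exists_cons_tl, Exists_cons_hd; rewrite (Rabs_pos_eq xi) in A1 by lra
        |apply Exists_cons_tl, Exists_cons_tl, Exists_cons_tl, Exists_cons_hd;
         rewrite (Rabs_left xi) in A1 by lra]);
      in_box_by_bounds.
Qed.

(** * Contractions on a cube and straight-line programs *)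

Definition cube (n : nat) (s : list R) : Prop := length s = n /\ Forall (fun x => -1 <= x <= 1) s.

Definition close (M : R) (s s' : list R) : Prop := Forall2 (fun x y => Rabs (x - y) <= M) s s'.

Lemma close_nth M s s' i : 0 <= M -> close M s s' -> Rabs (nth i s 0 - nth i s' 0) <= M.
Proof.
  intros HM H; revert i; induction H as [|x y s s' Hxy H IH]; intros [|i]; cbn [nth]; auto;
    rewrite Rminus_diag, Rabs_R0 by reflexivity; exact HM.
Qed.

Lemma nth_close M s s' :
  length s = length s' -> (forall i, (i < length s)%nat -> Rabs (nth i s 0 - nth i s' 0) <= M) ->
  close M s s'.
Proof.
  revert s'; induction s as [|x s IH]; intros [|y s'] HL H; try discriminate; constructor.
  - apply (H 0%nat); cbn; lia.
  - apply IH; [now injection HL|]; intros i Hi; apply (H (S i)); cbn; lia.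
Qed.

Lemma close_trans M M' a b c : close M a b -> close M' b c -> close (M + M') a c.
Proof.
  intros H; revert c; induction H as [|x y a b Hxy H IH]; intros c H'; inversion H'; subst; constructor.
  - match goal with H1 : Rabs (y - ?z) <= M' |- _ =>
      replace (x - z) with ((x - y) + (y - z)) by ring end.
    eapply Rle_trans; [apply Rabs_triang|]; lra.
  - now apply IH.
Qed.

Section Banach.

Variables (n : nat) (T : list R -> list R) (th : R).
Hypothesis th_pos : 0 <= th < 1.
Hypothesis T_length : forall s, length (T s) = n.
Hypothesis T_contracts : forall s s' M,
  cube n s -> cube n s' -> 0 <= M -> close M s s' -> close (th * M) (T s) (T s').
Hypothesis T_origin : close (1 - th) (T (repeat 0 n)) (repeat 0 n).

Lemma cube_close_origin s : cube n s <-> close 1 s (repeat 0 n).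
Proof.
  split.
  - intros [L H]; unfold close; rewrite <- L; clear L.
    induction H as [|a s Ha HF IH]; cbn; constructor; trivial.
    apply Rabs_le; lra.
  - intros H; split.
    + apply Forall2_length in H; now rewrite repeat_length in H.
    + remember (repeat 0 n) as o eqn:E; assert (Ho : Forall (fun z => z = 0) o)
        by (rewrite E; apply Forall_forall; intros z Hz; now apply repeat_spec in Hz).
      clear E T_origin; induction H as [|a b s o Hab HF IH]; constructor; inversion Ho; subst.
      * apply Rabs_le_inv in Hab; lra.
      * auto.
Qed.

Lemma origin_in_cube : cube n (repeat 0 n).
Proof.
  split; [apply repeat_length|]; apply Forall_forall; intros z Hz.
  apply repeat_spec in Hz; lra.
Qed.

(** The displacement of the origin is allowed exactly the room 1 - th that the contraction
    leaves. *)
Lemma T_cube s : cube n s -> cube n (T s).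
Proof.
  intros Hs; apply cube_close_origin.
  replace 1 with (th * 1 + (1 - th)) by ring.
  apply close_trans with (T (repeat 0 n)); [|exact T_origin].
  apply T_contracts; [exact Hs | apply origin_in_cube | lra | now apply cube_close_origin].
Qed.

Let x (k : nat) : list R := Nat.iter k T (repeat 0 n).

Lemma x_cube k : cube n (x k).
Proof. induction k as [|k IH]; [apply origin_in_cube | apply T_cube, IH]. Qed.

Lemma x_step k : close (th ^ k) (x (S k)) (x k).
Proof.
  induction k as [|k IH].
  - apply cube_close_origin, T_cube, origin_in_cube.
  - apply (T_contracts _ _ _ (x_cube (S k)) (x_cube k)); [apply pow_le; lra | exact IH].
Qed.

Lemma x_far k m : close (th ^ k / (1 - th)) (x (m + k)) (x k).
Proof.
  (* The partial geometric sum, rather than its limit, is what the induction on m reproduces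
     exactly. *)
  assert (H : close ((th ^ k - th ^ (m + k)) / (1 - th)) (x (m + k)) (x k)).
  { induction m as [|m IH].
    - cbn [Nat.add]; rewrite Rminus_diag, Rdiv_0_l by reflexivity.
      apply nth_close; trivial; intros; rewrite Rminus_diag, Rabs_R0 by reflexivity; lra.
    - replace ((th ^ k - th ^ (S m + k)) / (1 - th))
        with (th ^ (m + k) + (th ^ k - th ^ (m + k)) / (1 - th)) by (simpl; field; lra).
      exact (close_trans _ _ _ _ _ (x_step (m + k)) IH). }
  unfold close in *; eapply Forall2_impl; [|exact H]; intros a b Hab.
  eapply Rle_trans; [exact Hab|].
  apply Rmult_le_compat_r; [left; apply Rinv_0_lt_compat; lra|].
  assert (0 <= th ^ (m + k)) by (apply pow_le; lra); lra.
Qed.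

Lemma small_power C eps : 0 < C -> 0 < eps -> exists N, forall k, (N <= k)%nat -> C * th ^ k < eps.
Proof.
  intros HC He.
  destruct (pow_lt_1_zero th ltac:(rewrite Rabs_pos_eq; lra) (eps / C)) as [N HN].
  { apply Rdiv_lt_0_compat; lra. }
  exists N; intros k Hk; specialize (HN k Hk).
  rewrite Rabs_pos_eq in HN by (apply pow_le; lra).
  apply (Rmult_lt_compat_l C) in HN; [|exact HC].
  replace (C * (eps / C)) with eps in HN by (field; lra); exact HN.
Qed.

Lemma x_limit i : { l : R | forall k, Rabs (nth i (x k) 0 - l) <= th ^ k / (1 - th) }.
Proof.
  assert (Hi : 0 < / (1 - th)) by (apply Rinv_0_lt_compat; lra).
  assert (HP : forall k, 0 <= th ^ k / (1 - th))
    by (intros k; apply Rmult_le_pos; [apply pow_le|]; lra).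
  assert (F : forall k m, Rabs (nth i (x (m + k)) 0 - nth i (x k) 0) <= th ^ k / (1 - th))
    by (intros; apply close_nth; [apply HP | apply x_far]).
  destruct (R_complete (fun k => nth i (x k) 0)) as [l Hl].
  - intros eps He; destruct (small_power (2 * / (1 - th)) eps ltac:(lra) He) as [N HN].
    exists N; intros a b Ha Hb; unfold Rdist; specialize (HN N (le_n N)).
    replace a with ((a - N) + N)%nat by lia; replace b with ((b - N) + N)%nat by lia.
    assert (Fa := F N (a - N)%nat); assert (Fb := F N (b - N)%nat).
    apply Rabs_le_inv in Fa, Fb; unfold Rdiv in *; apply Rabs_def1; lra.
  - exists l; intros k; apply le_epsilon; intros eps He.
    destruct (Hl eps He) as [N HN]; specialize (HN (N + k)%nat ltac:(lia)).
    unfold Rdist in HN; apply Rabs_def2 in HN; specialize (F k N); apply Rabs_le_inv in F.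
    apply Rabs_le; lra.
Qed.

Lemma fixed_point_exists : exists s, cube n s /\ T s = s.
Proof.
  set (s := map (fun i => proj1_sig (x_limit i)) (seq 0 n)).
  assert (Ls : length s = n) by (unfold s; now rewrite length_map, length_seq).
  assert (Hi : 0 < / (1 - th)) by (apply Rinv_0_lt_compat; lra).
  assert (HP : forall k, 0 <= th ^ k / (1 - th))
    by (intros k; apply Rmult_le_pos; [apply pow_le|]; lra).
  assert (C : forall k, close (th ^ k / (1 - th)) (x k) s).
  { intros k; destruct (x_cube k) as [Lk _]; apply nth_close; [lia|]; intros i Hi'.
    unfold s; rewrite (nth_indep (map _ _) 0 (proj1_sig (x_limit 0)))
      by (rewrite length_map, length_seq; lia).
    rewrite (map_nth (fun i => proj1_sig (x_limit i))), seq_nth by lia; cbn [Nat.add].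
    apply (proj2_sig (x_limit i)). }
  assert (Cs : cube n s).
  { split; [exact Ls|]; apply Forall_forall; intros z Hz; apply In_nth with (d := 0) in Hz.
    destruct Hz as [i [Hi' <-]].
    assert (B : forall eps, 0 < eps -> Rabs (nth i s 0) <= 1 + eps).
    { intros eps He; destruct (small_power (/ (1 - th)) eps Hi He) as [N HN].
      specialize (HN N (le_n N)); assert (D := close_nth _ _ _ i (HP N) (C N)).
      destruct (x_cube N) as [LN FN]; rewrite Forall_forall in FN.
      assert (Li : (i < length (x N))%nat) by lia.
      assert (E := FN _ (nth_In (x N) 0 Li)).
      apply Rabs_le_inv in D; unfold Rdiv in *; apply Rabs_le; lra. }
    apply Rabs_le_inv, le_epsilon; intros; now apply B. }
  exists s; split; [exact Cs|].
  assert (E : forall i, nth i (T s) 0 = nth i s 0).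
  { intros i; apply cond_eq; intros eps He.
    destruct (small_power (2 * / (1 - th)) eps ltac:(lra) He) as [N HN]; specialize (HN N (le_n N)).
    assert (D1 := close_nth _ _ _ i (Rmult_le_pos _ _ (proj1 th_pos) (HP N))
      (T_contracts _ _ _ (x_cube N) Cs (HP N) (C N))).
    assert (D2 := close_nth _ _ _ i (HP (S N)) (C (S N))).
    change (T (x N)) with (x (S N)) in D1.
    apply Rabs_le_inv in D1, D2; specialize (HP N).
    assert (HQ : forall P, 0 <= P -> th * P <= P) by (intros; nra); specialize (HQ _ HP).
    assert (th ^ S N / (1 - th) = th * (th ^ N / (1 - th))) by (simpl; field; lra).
    unfold Rdiv in *; apply Rabs_def1; lra. }
  apply (nth_ext _ _ 0 0); [rewrite T_length; lia | intros i _; apply E].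
Qed.

Lemma fixed_point_unique s s' : cube n s -> cube n s' -> T s = s -> T s' = s' -> s = s'.
Proof.
  intros Hs Hs' E E'.
  assert (H2 : forall k, close (2 * th ^ k) s s').
  { induction k as [|k IH].
    - destruct Hs as [L F], Hs' as [L' F']; rewrite Forall_forall in F, F'.
      apply nth_close; [lia|]; intros i Hi.
      assert (Hi' : (i < length s')%nat) by lia.
      assert (A := F _ (nth_In s 0 Hi)); assert (B := F' _ (nth_In s' 0 Hi')).
      simpl; apply Rabs_le; lra.
    - rewrite <- E, <- E'; replace (2 * th ^ S k) with (th * (2 * th ^ k)) by (simpl; ring).
      apply T_contracts; trivial; assert (0 <= th ^ k) by (apply pow_le; lra); lra. }
  apply (nth_ext _ _ 0 0); [destruct Hs, Hs'; lia|]; intros i _.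
  apply cond_eq; intros eps He; destruct (small_power 2 eps ltac:(lra) He) as [N HN].
  assert (0 <= th ^ N) by (apply pow_le; lra).
  eapply Rle_lt_trans; [|apply (HN N (le_n N))].
  apply close_nth; [lra | apply H2].
Qed.

End Banach.

(* A straight-line program appends the results of its instructions to the list of its
   arguments; Ikern appends both components of the force field. *)
Inductive instr : Type :=
  | Iadd (i j : nat)
  | Isub (i j : nat)
  | Iscal (a b : Z) (i : nat)
  | Icst (a b : Z)
  | Ikern (i j : nat).

Definition step_R (r : list R) (c : instr) : list R :=
  let g := fun i => nth i r 0 in
  match c with
  | Iadd i j => r ++ [g i + g j]
  | Isub i j => r ++ [g i - g j]
  | Iscal a b i => r ++ [IZR a / IZR b * g i]
  | Icst a b => r ++ [IZR a / IZR b]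
  | Ikern i j => r ++ [fx (g i) (g j); fy (g i) (g j)]
  end.

Definition run_R (prog : list instr) (r : list R) : list R := fold_left step_R prog r.

(** * Interval slopes of straight-line programs *)

Fixpoint map2 {A : Type} (f : A -> A -> A) (l l' : list A) : list A :=
  match l, l' with
  | a :: l, b :: l' => f a b :: map2 f l l'
  | _, _ => []
  end.

Fixpoint dot (c d : list R) : R :=
  match c, d with
  | a :: c, b :: d => a * b + dot c d
  | _, _ => 0
  end.

Definition dual : Type := (itv * list itv)%type.

Section Dual.

Variable p : Z.
Hypothesis p_ge0 : (0 <= p)%Z.

Definition dzero : dual := ((0, 0)%Z, []).

Definition dkern (A B : dual) : list dual :=
  let k := ikern p (fst A) (fst B) in
  let h := ihess p (fst A) (fst B) in
  let row a b := map2 iadd (map (imul p a) (snd A)) (map (imul p b) (snd B)) in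
  [(fst k, row (fst (fst h)) (snd (fst h))); (snd k, row (snd (fst h)) (snd h))].

(** [None] reports a nonpositive denominator, or a kernel whose squared distance is not enclosed
    away from 0. A constant copies the length of its zero row from register 0, which is why
    [well_scoped] asks for a nonempty register list there. *)
Definition step_D (r : list dual) (c : instr) : option (list dual) :=
  let g := fun i => nth i r dzero in
  match c with
  | Iadd i j => Some (r ++ [(iadd (fst (g i)) (fst (g j)), map2 iadd (snd (g i)) (snd (g j)))])
  | Isub i j => Some (r ++ [(isub (fst (g i)) (fst (g j)), map2 isub (snd (g i)) (snd (g j)))])
  | Iscal a b i =>
      if (0 <? b)%Z then Some (r ++ [(iscal a b (fst (g i)), map (iscal a b) (snd (g i)))]) else None
  | Icst a b =>
      if (0 <? b)%Z then Some (r ++ [(icst p a b, map (fun _ => (0, 0)%Z) (snd (nth 0 r dzero)))]) else None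
  | Ikern i j =>
      if (0 <? fst (irad2 p (fst (g i)) (fst (g j))))%Z then Some (r ++ dkern (g i) (g j)) else None
  end.

Fixpoint run_D (prog : list instr) (r : list dual) : option (list dual) :=
  match prog with
  | [] => Some r
  | c :: prog => match step_D r c with Some r' => run_D prog r' | None => None end
  end.

Variable D : list R.

(** Slopes between two inputs instead of derivatives at one: a and a' are the values at inputs that
    differ by [D], and the row encloses coefficients c with a - a' = c . D. Slopes compose like
    forward derivatives and bound differences directly, so the mean value theorem enters only at the
    kernel. *)
Definition encloses (A : dual) (a a' : R) : Prop :=
  cont p (fst A) a /\ cont p (fst A) a' /\
  exists c, Forall2 (cont p) (snd A) c /\ length c = length D /\ a - a' = dot c D.

Lemma dot_map2 (f : R -> R -> R) u v c d e :
  (forall a b, f a b = u * a + v * b) -> length c = length e -> length d = length e ->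
  dot (map2 f c d) e = u * dot c e + v * dot d e.
Proof.
  intros Hf; revert d e; induction c as [|a c IH]; intros [|b d] [|z e] H1 H2; try discriminate;
    cbn [map2 dot]; [ring|].
  injection H1 as H1; injection H2 as H2; rewrite Hf, IH by assumption; ring.
Qed.

Lemma dot_map f u c e :
  (forall a, f a = u * a) -> dot (map f c) e = u * dot c e.
Proof.
  intros Hf; revert e; induction c as [|a c IH]; intros [|z e]; cbn [map dot]; try ring.
  rewrite Hf, IH; ring.
Qed.

Lemma length_map2 {A} (f : A -> A -> A) l l' n :
  length l = n -> length l' = n -> length (map2 f l l') = n.
Proof.
  revert l' n; induction l as [|a l IH]; intros [|b l'] n H1 H2; cbn in *; try congruence.
  destruct n; [discriminate|]; f_equal; apply IH; congruence.
Qed.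

Lemma cont_map2 (f : itv -> itv -> itv) (g : R -> R -> R) l l' c c' :
  (forall I J a b, cont p I a -> cont p J b -> cont p (f I J) (g a b)) ->
  Forall2 (cont p) l c -> Forall2 (cont p) l' c' -> Forall2 (cont p) (map2 f l l') (map2 g c c').
Proof.
  intros Hf H; revert l' c'; induction H as [|J a l c Ha H IH]; intros l' c' H'; cbn [map2];
    [constructor|].
  destruct H'; constructor; auto.
Qed.

Lemma cont_map (f : itv -> itv) (g : R -> R) l c :
  (forall I a, cont p I a -> cont p (f I) (g a)) ->
  Forall2 (cont p) l c -> Forall2 (cont p) (map f l) (map g c).
Proof. intros Hf H; induction H; constructor; auto. Qed.

Lemma encloses_add A B a a' b b' :
  encloses A a a' -> encloses B b b' ->
  encloses (iadd (fst A) (fst B), map2 iadd (snd A) (snd B)) (a + b) (a' + b').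
Proof.
  intros [A1 [A2 [c [A3 [A4 A5]]]]] [B1 [B2 [d [B3 [B4 B5]]]]].
  split; [|split]; try (now apply cont_iadd).
  exists (map2 Rplus c d); split; [|split].
  - apply cont_map2; trivial; intros; now apply cont_iadd.
  - now apply length_map2.
  - rewrite (dot_map2 Rplus 1 1) by (trivial; intros; ring); lra.
Qed.

Lemma encloses_sub A B a a' b b' :
  encloses A a a' -> encloses B b b' ->
  encloses (isub (fst A) (fst B), map2 isub (snd A) (snd B)) (a - b) (a' - b').
Proof.
  intros [A1 [A2 [c [A3 [A4 A5]]]]] [B1 [B2 [d [B3 [B4 B5]]]]].
  split; [|split]; try (now apply cont_isub).
  exists (map2 Rminus c d); split; [|split].
  - apply cont_map2; trivial; intros; now apply cont_isub.
  - now apply length_map2.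
  - rewrite (dot_map2 Rminus 1 (-1)) by (trivial; intros; ring); lra.
Qed.

Lemma encloses_scal n d A a a' :
  (0 < d)%Z -> encloses A a a' ->
  encloses (iscal n d (fst A), map (iscal n d) (snd A)) (IZR n / IZR d * a) (IZR n / IZR d * a').
Proof.
  intros Hd [A1 [A2 [c [A3 [A4 A5]]]]].
  split; [|split]; try (now apply cont_iscal).
  exists (map (Rmult (IZR n / IZR d)) c); split; [|split].
  - apply cont_map; trivial; intros; now apply cont_iscal.
  - now rewrite length_map.
  - rewrite (dot_map _ (IZR n / IZR d)) by reflexivity; rewrite <- A5; ring.
Qed.

Lemma dot_zero c e : Forall (fun a => a = 0) c -> dot c e = 0.
Proof.
  intros H; revert e; induction H as [|a c -> H IH]; intros [|b e]; cbn [dot]; trivial.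
  rewrite IH; ring.
Qed.

Lemma encloses_cst n d A a a' :
  (0 < d)%Z -> encloses A a a' ->
  encloses (icst p n d, map (fun _ => (0, 0)%Z) (snd A)) (IZR n / IZR d) (IZR n / IZR d).
Proof.
  intros Hd [_ [_ [c [A3 [A4 _]]]]].
  split; [|split]; try (now apply cont_icst).
  exists (map (fun _ => 0) c); split; [|split].
  - apply cont_map with (g := fun _ => 0); trivial; intros; split; cbn [fst snd]; lra.
  - now rewrite length_map.
  - rewrite dot_zero; [ring|]; apply Forall_forall; intros z Hz.
    apply in_map_iff in Hz as [? [<- _]]; reflexivity.
Qed.

(** The input enclosures are convex, so they contain the segment between the two inputs, and the
    Hessian enclosed on them covers the intermediate points, which may differ for the two
    components. The positive enclosure of the squared distance keeps the segment off the
    singularity. *)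
Lemma encloses_kern A B a a' b b' :
  (0 < fst (irad2 p (fst A) (fst B)))%Z -> encloses A a a' -> encloses B b b' ->
  Forall2 (fun K kk => encloses K (fst kk) (snd kk)) (dkern A B)
    [(fx a b, fx a' b'); (fy a b, fy a' b')].
Proof.
  intros H0 [A1 [A2 [c [A3 [A4 A5]]]]] [B1 [B2 [d [B3 [B4 B5]]]]].
  destruct (cont_ikern p p_ge0 H0 A1 B1) as [K1 K2].
  destruct (cont_ikern p p_ge0 H0 A2 B2) as [K1' K2'].
  assert (S : forall J u u' t, cont p J u -> cont p J u' -> 0 <= t <= 1 -> cont p J (u' + t * (u - u'))).
  { intros J u u' t Hu Hu' Ht; unfold cont in *.
    replace ((u' + t * (u - u')) * IZR (2 ^ p))
      with (u' * IZR (2 ^ p) + t * (u * IZR (2 ^ p) - u' * IZR (2 ^ p))) by ring.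
    now apply seg_in. }
  assert (P : forall t, 0 <= t <= 1 ->
     0 < (a' + t * (a - a')) * (a' + t * (a - a')) + (b' + t * (b - b')) * (b' + t * (b - b')))
    by (intros t Ht; apply (irad2_gt0 p p_ge0 _ _ _ _ H0); auto).
  assert (Row : forall I J h k, cont p I h -> cont p J k ->
    exists e, Forall2 (cont p) (map2 iadd (map (imul p I) (snd A)) (map (imul p J) (snd B))) e /\
      length e = length D /\ h * (a - a') + k * (b - b') = dot e D).
  { intros I J h k HI HJ; exists (map2 Rplus (map (Rmult h) c) (map (Rmult k) d)); split; [|split].
    - apply cont_map2; [intros; now apply cont_iadd | |];
        (apply cont_map; trivial; intros; now apply cont_imul).
    - apply length_map2; now rewrite length_map.
    - rewrite (dot_map2 Rplus 1 1), (dot_map _ h), (dot_map _ k)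
        by (rewrite ?length_map; trivial; intros; ring).
      rewrite A5, B5; ring. }
  constructor; [|constructor; [|constructor]]; (split; [|split]); trivial; cbn [fst snd].
  - destruct (fx_mean_value a b a' b' P) as [t [Ht ->]].
    destruct (cont_ihess p p_ge0 H0 (S _ _ _ t A1 A2 Ht) (S _ _ _ t B1 B2 Ht)) as [H1 [H2 _]].
    now apply Row.
  - destruct (fy_mean_value a b a' b' P) as [t [Ht ->]].
    destruct (cont_ihess p p_ge0 H0 (S _ _ _ t A1 A2 Ht) (S _ _ _ t B1 B2 Ht)) as [_ [H2 H3]].
    now apply Row.
Qed.

Definition enclose_all (rD : list dual) (r r' : list R) : Prop :=
  Forall2 (fun A aa => encloses A (fst aa) (snd aa)) rD (combine r r') /\ length r = length r'.

Lemma enclose_all_nth rD r r' i :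
  enclose_all rD r r' -> (i < length r)%nat -> encloses (nth i rD dzero) (nth i r 0) (nth i r' 0).
Proof.
  intros [H L]; revert rD r' i H L; induction r as [|a r IH]; intros rD [|a' r'] i H L Hi;
    cbn in *; try lia.
  inversion H as [|A aa rD' l HA HR]; subst; destruct i as [|i]; [exact HA|].
  cbn [nth]; apply IH; trivial; lia.
Qed.

Lemma enclose_all_app rD r r' sD s s' :
  enclose_all rD r r' -> enclose_all sD s s' -> enclose_all (rD ++ sD) (r ++ s) (r' ++ s').
Proof.
  intros [H L] [H' L']; split; [|rewrite !length_app; congruence].
  revert r' rD H L; induction r as [|a r IH]; intros [|a' r'] rD H L; try discriminate; cbn in *;
    inversion H; subst; [exact H'|]; constructor; auto.
Qed.

Definition well_scoped (n : nat) (c : instr) : bool :=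
  match c with
  | Iadd i j | Isub i j | Ikern i j => (Nat.ltb i n && Nat.ltb j n)%bool
  | Iscal _ _ i => Nat.ltb i n
  | Icst _ _ => Nat.ltb 0 n
  end.

Definition size (c : instr) : nat := match c with Ikern _ _ => 2 | _ => 1 end.

Fixpoint scoped (n : nat) (prog : list instr) : bool :=
  match prog with
  | [] => true
  | c :: prog => (well_scoped n c && scoped (size c + n) prog)%bool
  end.

Lemma length_step r c : length (step_R r c) = (size c + length r)%nat.
Proof. destruct c; cbn [step_R size]; rewrite length_app; cbn; lia. Qed.

Lemma step_enclosed rD rD' r r' c :
  well_scoped (length r) c = true -> enclose_all rD r r' -> step_D rD c = Some rD' ->
  enclose_all rD' (step_R r c) (step_R r' c).
Proof.
  intros HS H HD.
  destruct c as [i j|i j|u v i|u v|i j]; cbn [well_scoped step_D step_R] in *.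
  1, 2, 5: apply andb_prop in HS as [Hi Hj]; apply Nat.ltb_lt in Hi, Hj;
    assert (Ei := enclose_all_nth _ _ _ _ H Hi); assert (Ej := enclose_all_nth _ _ _ _ H Hj).
  4, 5: apply Nat.ltb_lt in HS; assert (Ei := enclose_all_nth _ _ _ _ H HS).
  - injection HD as <-; apply enclose_all_app; trivial; split; trivial.
    constructor; [|constructor]; now apply encloses_add.
  - injection HD as <-; apply enclose_all_app; trivial; split; trivial.
    constructor; [|constructor]; now apply encloses_sub.
  - destruct (0 <? fst _)%Z eqn:E in HD; [|discriminate]; apply Z.ltb_lt in E.
    injection HD as <-; apply enclose_all_app; trivial; split; trivial.
    now apply encloses_kern.
  - destruct (0 <? v)%Z eqn:E in HD; [|discriminate]; apply Z.ltb_lt in E.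
    injection HD as <-; apply enclose_all_app; trivial; split; trivial.
    constructor; [|constructor]; now apply encloses_scal.
  - destruct (0 <? v)%Z eqn:E in HD; [|discriminate]; apply Z.ltb_lt in E.
    injection HD as <-; apply enclose_all_app; trivial; split; trivial.
    constructor; [|constructor]; cbn [fst snd]; eapply encloses_cst; eassumption.
Qed.

Lemma run_enclosed prog rD rD' r r' :
  scoped (length r) prog = true -> enclose_all rD r r' -> run_D prog rD = Some rD' ->
  enclose_all rD' (run_R prog r) (run_R prog r').
Proof.
  revert rD r r'; induction prog as [|c prog IH]; intros rD r r' HS H HD; cbn [scoped run_D run_R fold_left] in *.
  - injection HD as <-; exact H.
  - apply andb_prop in HS as [HS1 HS2].
    destruct (step_D rD c) as [rD1|] eqn:E; [|discriminate].
    apply (IH rD1); trivial.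
    + now rewrite length_step.
    + now apply (step_enclosed rD).
Qed.

End Dual.

(* The interval (c / d) +- (r / d). *)
Record cell : Type := Cell { ccentre : Z; cradius : Z; cden : Z }.

Definition centre_R (q : cell) : R := IZR (ccentre q) / IZR (cden q).
Definition radius_R (q : cell) : R := IZR (cradius q) / IZR (cden q).

Definition nocell : cell := Cell 0 1 1.

Definition good_cell (q : cell) : bool := ((0 <? cradius q) && (0 <? cden q))%Z.

Lemma good_cell_pos q : good_cell q = true -> (0 < cden q)%Z /\ 0 < radius_R q.
Proof.
  intros H; apply andb_prop in H as [H1 H2]; apply Z.ltb_lt in H1, H2; split; trivial.
  apply IZR_lt in H1, H2; now apply Rdiv_lt_0_compat.
Qed.

Definition in_cells (b : list cell) (X : list R) : Prop :=
  length X = length b /\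
  forall j, (j < length b)%nat -> Rabs (nth j X 0 - centre_R (nth j b nocell)) <= radius_R (nth j b nocell).

Definition sumZ (l : list Z) : Z := fold_right Z.add 0%Z l.

Lemma nth_map2_minus c d j :
  length c = length d -> nth j (map2 Rminus c d) 0 = nth j c 0 - nth j d 0.
Proof.
  revert d j; induction c as [|u c IH]; intros [|v d] [|j] H; try discriminate; cbn [map2 nth]; try ring.
  apply IH; now injection H.
Qed.

(** * The preconditioned Newton map on a box *)

Section NewtonMap.

Variable p : Z.
Hypothesis p_ge0 : (0 <= p)%Z.
Variables (prog : list instr) (outs : list nat) (b : list cell) (dd : list (Z * Z)).

Let n : nat := length b.
Let q (j : nat) : cell := nth j b nocell.
Let out (i : nat) : nat := nth i outs 0%nat.
Let rate (i : nat) : R := IZR (fst (nth i dd (1, 1)%Z)) / IZR (snd (nth i dd (1, 1)%Z)).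

Definition outputs (X : list R) : list R :=
  map (fun i => nth (nth i outs 0%nat) (run_R prog X) 0) (seq 0 (length b)).

Definition unit_row (u : itv) (j : nat) : list itv :=
  map (fun k => if Nat.eqb k j then u else (0, 0)%Z) (seq 0 (length b)).

(** Each unknown is parametrised by [-1, 1], so its initial slope is the radius of its cell. *)
Definition seed (j : nat) : dual :=
  let c := nth j b nocell in
  (irng p (ccentre c - cradius c) (ccentre c + cradius c) (cden c),
   unit_row (icst p (cradius c) (cden c)) j).

(** For the evaluation at the centre the two inputs coincide, and both the difference vector and the
    rows may be empty. *)
Definition seed0 (j : nat) : dual :=
  let c := nth j b nocell in (icst p (ccentre c) (cden c), []).

(** In the maximum norm the contraction factor is the largest absolute row sum of the identity minus
    the preconditioned slopes; it is required to be at most 4/5. The step at the centre is at most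
    the remaining 1/5, so the cube is mapped into itself. Nonzero preconditioners make the fixed
    points the zeros of the outputs. *)
Definition contraction_check : bool :=
  (forallb good_cell b
   && forallb (fun e => negb (fst e =? 0) && (0 <? snd e))%Z dd
   && Nat.eqb (length dd) (length b) && scoped (length b) prog
   && match run_D p prog (map seed (seq 0 (length b))),
            run_D p prog (map seed0 (seq 0 (length b))) with
      | Some r, Some r0 =>
          forallb (fun i =>
            let e := nth i dd (1, 1)%Z in
            let o := nth i outs 0%nat in
            Nat.ltb o (length r) &&
            (5 * sumZ (map imag (map2 isub (unit_row (2 ^ p, 2 ^ p)%Z i)
                                 (map (iscal (fst e) (snd e)) (snd (nth o r dzero)))))
               <=? 4 * 2 ^ p) &&
            (5 * imag (iscal (fst e) (snd e) (fst (nth o r0 dzero))) <=? 2 ^ p))%Z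
            (seq 0 (length b))
      | _, _ => false
      end)%bool.

Hypothesis Hcheck : contraction_check = true.

Let point (s : list R) : list R :=
  map (fun j => centre_R (q j) + radius_R (q j) * nth j s 0) (seq 0 n).

Let newton (s : list R) : list R :=
  map (fun i => nth i s 0
                - rate i
                  * nth (out i) (run_R prog (point s)) 0) (seq 0 n).

Local Lemma check_parts :
  (forall j, (j < n)%nat -> good_cell (q j) = true) /\
  (forall i, (i < n)%nat -> fst (nth i dd (1, 1)%Z) <> 0%Z /\ (0 < snd (nth i dd (1, 1)%Z))%Z) /\
  scoped n prog = true /\
  exists r r0, run_D p prog (map seed (seq 0 n)) = Some r /\
    run_D p prog (map seed0 (seq 0 n)) = Some r0 /\
    forall i, (i < n)%nat ->
      let e := nth i dd (1, 1)%Z in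
      (out i < length r)%nat /\
      (5 * sumZ (map imag (map2 isub (unit_row (2 ^ p, 2 ^ p)%Z i)
                             (map (iscal (fst e) (snd e)) (snd (nth (out i) r dzero))))) <= 4 * 2 ^ p)%Z /\
      (5 * imag (iscal (fst e) (snd e) (fst (nth (out i) r0 dzero))) <= 2 ^ p)%Z.
Proof.
  assert (H := Hcheck); unfold contraction_check in H.
  apply andb_prop in H as [H H5]; apply andb_prop in H as [H H4]; apply andb_prop in H as [H H3].
  apply andb_prop in H as [H1 H2]; apply Nat.eqb_eq in H3.
  rewrite forallb_forall in H1, H2.
  split; [|split; [|split]].
  - intros j Hj; apply H1, nth_In; exact Hj.
  - intros i Hi; assert (Hi' : (i < length dd)%nat) by (rewrite H3; exact Hi).
    assert (H := H2 _ (nth_In dd (1, 1)%Z Hi')); apply andb_prop in H as [A B].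
    split; [|now apply Z.ltb_lt]; intros E; rewrite E in A; discriminate.
  - exact H4.
  - fold n in H5; destruct (run_D p prog (map seed (seq 0 n))) as [r|]; [|discriminate].
    destruct (run_D p prog (map seed0 (seq 0 n))) as [r0|]; [|discriminate].
    exists r, r0; split; [reflexivity|]; split; [reflexivity|]; intros i Hi; cbv zeta.
    rewrite forallb_forall in H5; assert (H := H5 i ltac:(apply in_seq; lia)); cbv zeta in H.
    apply andb_prop in H as [H C]; apply andb_prop in H as [A B].
    split; [now apply Nat.ltb_lt|]; split; now apply Z.leb_le.
Qed.

Local Lemma dot_unit a j o m d :
  length d = m ->
  dot (map (fun k => if Nat.eqb k j then a else 0) (seq o m)) d
  = if Nat.leb o j then a * nth (j - o) d 0 else 0.
Proof.
  revert o d; induction m as [|m IH]; intros o [|z d] Hd; try discriminate; cbn [seq map dot].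
  - destruct (Nat.leb o j); [|reflexivity]; destruct (j - o)%nat; cbn; ring.
  - rewrite IH by (now injection Hd).
    destruct (Nat.eqb_spec o j) as [->|E].
    + rewrite Nat.leb_refl, Nat.sub_diag; destruct (Nat.leb_spec (S j) j); [lia|]; cbn [nth]; ring.
    + destruct (Nat.leb_spec o j); destruct (Nat.leb_spec (S o) j); try lia; [|ring].
      replace (j - o)%nat with (S (j - S o)) by lia; cbn [nth]; ring.
Qed.

Local Lemma unit_row_correct u a j :
  cont p u a ->
  Forall2 (cont p) (unit_row u j) (map (fun k => if Nat.eqb k j then a else 0) (seq 0 n)).
Proof.
  intros H; unfold unit_row; fold n; induction (seq 0 n) as [|k l IH]; cbn [map]; constructor; trivial.
  destruct (Nat.eqb k j); [exact H|]; split; cbn [fst snd]; lra.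
Qed.

Local Lemma enclose_all_map (D : list R) (f : nat -> dual) (g h : nat -> R) (l : list nat) :
  (forall j, In j l -> encloses p D (f j) (g j) (h j)) -> enclose_all p D (map f l) (map g l) (map h l).
Proof.
  intros H; split; [|now rewrite !length_map].
  induction l as [|j l IH]; cbn [map combine]; constructor.
  - apply H; now left.
  - apply IH; intros; apply H; now right.
Qed.

Local Lemma nth_point s j : (j < n)%nat -> nth j (point s) 0 = centre_R (q j) + radius_R (q j) * nth j s 0.
Proof.
  intros Hj; unfold point.
  rewrite (nth_indep _ 0 (centre_R (q 0) + radius_R (q 0) * nth 0 s 0)) by (now rewrite length_map, length_seq).
  rewrite (map_nth (fun j => centre_R (q j) + radius_R (q j) * nth j s 0)), seq_nth by exact Hj; reflexivity.
Qed.

Local Lemma length_point s : length (point s) = n.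
Proof. unfold point; now rewrite length_map, length_seq. Qed.

Local Lemma nth_newton s i : (i < n)%nat ->
  nth i (newton s) 0 = nth i s 0
    - rate i * nth (out i) (run_R prog (point s)) 0.
Proof.
  intros Hi; unfold newton.
  set (f := fun i => nth i s 0 - rate i
                * nth (out i) (run_R prog (point s)) 0).
  rewrite (nth_indep _ 0 (f 0%nat)) by (now rewrite length_map, length_seq).
  rewrite map_nth, seq_nth by exact Hi; reflexivity.
Qed.

Local Lemma length_newton s : length (newton s) = n.
Proof. unfold newton; now rewrite length_map, length_seq. Qed.

Local Lemma cube_nth s j : cube n s -> (j < n)%nat -> -1 <= nth j s 0 <= 1.
Proof. intros [L F] Hj; rewrite Forall_forall in F; apply F, nth_In; lia. Qed.

Local Lemma dot_bound l c d M :
  0 <= M -> Forall2 (cont p) l c -> Forall (fun z => Rabs z <= M) d ->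
  Rabs (dot c d) * IZR (2 ^ p) <= IZR (sumZ (map imag l)) * M.
Proof.
  intros HM H; revert d; assert (Hs := scale_gt0 p p_ge0).
  induction H as [|J a l c Ha H IH]; intros d Hd; cbn [map dot sumZ fold_right].
  - rewrite Rabs_R0; lra.
  - fold (sumZ (map imag l)); rewrite plus_IZR.
    assert (HJ := cont_imag p p_ge0 _ _ Ha).
    destruct d as [|z d].
    + rewrite Rabs_R0; assert (X := IH [] (Forall_nil _)).
      assert (Y := Rabs_pos (dot c [])).
      assert (0 <= IZR (imag J)) by (eapply Rle_trans; [|exact HJ]; apply Rmult_le_pos; [apply Rabs_pos|lra]).
      nra.
    + inversion Hd; subst; assert (X := IH d ltac:(assumption)).
      assert (T := Rabs_triang (a * z) (dot c d)); rewrite Rabs_mult in T.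
      assert (Y : Rabs a * Rabs z * IZR (2 ^ p) <= IZR (imag J) * M).
      { replace (Rabs a * Rabs z * IZR (2 ^ p)) with (Rabs a * IZR (2 ^ p) * Rabs z) by ring.
        apply Rmult_le_compat; trivial; [|apply Rabs_pos].
        apply Rmult_le_pos; [apply Rabs_pos|lra]. }
      nra.
Qed.

Local Lemma point_enclosed s s' :
  cube n s -> cube n s' ->
  enclose_all p (map2 Rminus s s') (map seed (seq 0 n)) (point s) (point s').
Proof.
  intros Hs Hs'; destruct check_parts as [Hq _].
  assert (LD : length (map2 Rminus s s') = n) by (apply length_map2; [apply Hs | apply Hs']).
  assert (LE : length s = length s') by (destruct Hs, Hs'; congruence).
  apply enclose_all_map; intros j Hj; apply in_seq in Hj.
  assert (Hj' : (j < n)%nat) by lia.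
  destruct (good_cell_pos _ (Hq j Hj')) as [Hd Hr].
  assert (V : forall z, -1 <= z <= 1 -> cont p (fst (seed j)) (centre_R (q j) + radius_R (q j) * z)).
  { intros z Hz; apply (cont_irng p p_ge0); trivial.
    fold (q j); rewrite minus_IZR, plus_IZR; unfold centre_R, radius_R in *.
    assert (Hd' := IZR_lt _ _ Hd).
    replace ((IZR (ccentre (q j)) - IZR (cradius (q j))) / IZR (cden (q j)))
      with (IZR (ccentre (q j)) / IZR (cden (q j)) - IZR (cradius (q j)) / IZR (cden (q j))) by (field; lra).
    replace ((IZR (ccentre (q j)) + IZR (cradius (q j))) / IZR (cden (q j)))
      with (IZR (ccentre (q j)) / IZR (cden (q j)) + IZR (cradius (q j)) / IZR (cden (q j))) by (field; lra).
    nra. }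
  split; [|split]; try (apply V; now apply cube_nth).
  exists (map (fun k => if Nat.eqb k j then radius_R (q j) else 0) (seq 0 n)); split; [|split].
  - apply unit_row_correct; now apply cont_icst.
  - now rewrite length_map, length_seq, LD.
  - rewrite dot_unit by exact LD; cbn [Nat.leb]; rewrite Nat.sub_0_r, nth_map2_minus by exact LE; ring.
Qed.

Local Lemma newton_contracts s s' M :
  cube n s -> cube n s' -> 0 <= M -> close M s s' -> close (4 / 5 * M) (newton s) (newton s').
Proof.
  intros Hs Hs' HM HC; destruct check_parts as [Hq [Hd [Hsc [r [r0 [Er [_ Hr]]]]]]].
  assert (E := run_enclosed p p_ge0 (map2 Rminus s s') prog _ _ _ _
    ltac:(now rewrite length_point) (point_enclosed s s' Hs Hs') Er).
  apply nth_close; [now rewrite !length_newton|]; rewrite length_newton; intros i Hi.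
  rewrite !nth_newton by exact Hi.
  destruct (Hr i Hi) as [Ho [Hc _]].
  assert (Lr : length r = length (run_R prog (point s))).
  { destruct E as [E1 E2]; apply Forall2_length in E1; rewrite E1, length_combine, <- E2; lia. }
  assert (Eo := enclose_all_nth p _ _ _ _ _ E ltac:(rewrite <- Lr; exact Ho)).
  destruct (Hd i Hi) as [_ Hd2].
  apply (encloses_scal p _ (fst (nth i dd (1, 1)%Z)) _ _ _ _ Hd2) in Eo.
  destruct Eo as [_ [_ [c [C1 [C2 C3]]]]]; cbn [snd] in C1.
  set (D := map2 Rminus s s') in *.
  assert (LD : length D = n) by (apply length_map2; [apply Hs | apply Hs']).
  (* The identity is written as a unit row e as well, so that the difference of the images becomes
     (e - c) . D with the enclosed row e - c. *)
  assert (ND : nth i s 0 - nth i s' 0 = dot (map (fun k => if Nat.eqb k i then 1 else 0) (seq 0 n)) D).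
  { rewrite dot_unit by exact LD; cbn [Nat.leb]; rewrite Nat.sub_0_r, Rmult_1_l.
    unfold D; rewrite nth_map2_minus; [reflexivity|]; destruct Hs, Hs'; congruence. }
  fold (rate i) in C3; set (a := rate i) in *.
  replace (nth i s 0 - a * nth (out i) (run_R prog (point s)) 0
           - (nth i s' 0 - a * nth (out i) (run_R prog (point s')) 0))
    with ((nth i s 0 - nth i s' 0)
          - (a * nth (out i) (run_R prog (point s)) 0 - a * nth (out i) (run_R prog (point s')) 0)) by ring.
  rewrite C3, ND.
  set (e := map (fun k => if Nat.eqb k i then 1 else 0) (seq 0 n)) in *.
  assert (Le : length e = length D) by (unfold e; rewrite length_map, length_seq; congruence).
  replace (dot e D - dot c D) with (dot (map2 Rminus e c) D)
    by (rewrite (dot_map2 Rminus 1 (-1)) by (trivial; intros; ring); ring).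
  assert (Hs2 := scale_gt0 p p_ge0).
  assert (B := dot_bound _ _ D M HM (cont_map2 p isub Rminus _ _ _ _ (fun _ _ _ _ => cont_isub p)
    (unit_row_correct _ 1 i (cont_one p)) C1)).
  assert (FD : Forall (fun z => Rabs z <= M) D).
  { unfold D; clear - HC; induction HC; cbn [map2]; constructor; trivial. }
  specialize (B FD); apply IZR_le in Hc; rewrite !mult_IZR in Hc.
  apply Rmult_le_reg_r with (1 := Hs2).
  eapply Rle_trans; [exact B|]; nra.
Qed.

Local Lemma newton_origin : close (1 - 4 / 5) (newton (repeat 0 n)) (repeat 0 n).
Proof.
  destruct check_parts as [Hq [Hd [Hsc [r [r0 [_ [Er Hr]]]]]]].
  assert (E : enclose_all p [] (map seed0 (seq 0 n)) (point (repeat 0 n)) (point (repeat 0 n))).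
  { apply enclose_all_map; intros j Hj; apply in_seq in Hj.
    destruct (good_cell_pos _ (Hq j ltac:(lia))) as [Hd' _].
    rewrite nth_repeat, Rmult_0_r, Rplus_0_r.
    assert (C := cont_icst p (ccentre (q j)) (cden (q j)) Hd').
    split; [exact C|]; split; [exact C|]; exists []; repeat split; [constructor | cbn; ring]. }
  assert (E' := run_enclosed p p_ge0 [] prog _ _ _ _ ltac:(now rewrite length_point) E Er).
  apply nth_close; [now rewrite length_newton, repeat_length|]; rewrite length_newton; intros i Hi.
  rewrite nth_newton, nth_repeat by exact Hi.
  destruct (Hr i Hi) as [_ [_ Hc]]; destruct (Hd i Hi) as [_ Hd2].
  (* A register out of range reads the default 0, and then the Newton step vanishes. *)
  destruct (Nat.lt_ge_cases (out i) (length (run_R prog (point (repeat 0 n))))) as [Ho|Ho].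
  - assert (Eo := enclose_all_nth p _ _ _ _ _ E' Ho).
    apply (encloses_scal p _ (fst (nth i dd (1, 1)%Z)) _ _ _ _ Hd2) in Eo as [C _]; cbn [fst] in C.
    apply (cont_imag p p_ge0) in C; apply IZR_le in Hc; rewrite mult_IZR in Hc.
    assert (Hs2 := scale_gt0 p p_ge0).
    fold (rate i) in C; set (a := rate i * nth (out i) _ 0) in *.
    replace (0 - a - 0) with (- a) by ring; rewrite Rabs_Ropp.
    apply Rmult_le_reg_r with (1 := Hs2); lra.
  - rewrite (nth_overflow (run_R _ _) _ Ho); rewrite Rmult_0_r, !Rminus_0_r, Rabs_R0; lra.
Qed.

Local Lemma newton_fixed s : cube n s -> (newton s = s <-> outputs (point s) = repeat 0 n).
Proof.
  intros [Ls _]; destruct check_parts as [_ [Hd _]].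
  assert (NO : forall i, (i < n)%nat -> nth i (outputs (point s)) 0 = nth (out i) (run_R prog (point s)) 0).
  { intros i Hi; unfold outputs; fold n.
    set (f := fun i => nth (nth i outs 0%nat) (run_R prog (point s)) 0).
    rewrite (nth_indep _ 0 (f 0%nat)) by (now rewrite length_map, length_seq).
    rewrite map_nth, seq_nth by exact Hi; reflexivity. }
  assert (LO : length (outputs (point s)) = n) by (unfold outputs; now rewrite length_map, length_seq).
  split; intros E.
  - apply (nth_ext _ _ 0 0); [now rewrite LO, repeat_length|]; rewrite LO; intros i Hi.
    rewrite NO, nth_repeat by exact Hi.
    assert (A : nth i (newton s) 0 = nth i s 0) by now rewrite E.
    rewrite nth_newton in A by exact Hi.
    destruct (Hd i Hi) as [H1 H2].
    apply (Rmult_eq_reg_l (rate i)); [lra|].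
    apply Rmult_integral_contrapositive; split; [now apply not_0_IZR|].
    apply Rinv_neq_0_compat, not_0_IZR; lia.
  - apply (nth_ext _ _ 0 0); [now rewrite length_newton|]; rewrite length_newton; intros i Hi.
    rewrite nth_newton, <- NO, E, nth_repeat by exact Hi; ring.
Qed.

Theorem contraction_solution : exists X, in_cells b X /\ outputs X = repeat 0 n.
Proof.
  destruct (fixed_point_exists n newton (4 / 5) ltac:(lra) length_newton newton_contracts newton_origin)
    as [s [Hs Es]].
  exists (point s); split; [|now apply newton_fixed].
  destruct check_parts as [Hq _].
  split; [apply length_point|]; intros j Hj; rewrite nth_point by exact Hj; fold (q j).
  destruct (good_cell_pos _ (Hq j Hj)) as [_ Hr]; assert (H := cube_nth s j Hs Hj).
  apply Rabs_le; nra.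
Qed.

Theorem contraction_unique X X' :
  in_cells b X -> in_cells b X' -> outputs X = repeat 0 n -> outputs X' = repeat 0 n -> X = X'.
Proof.
  destruct check_parts as [Hq _].
  assert (S : forall Y, in_cells b Y -> exists s, cube n s /\ Y = point s).
  { intros Y [LY HY]; set (f := fun j => (nth j Y 0 - centre_R (q j)) / radius_R (q j)).
    exists (map f (seq 0 n)); split.
    - split; [now rewrite length_map, length_seq|]; apply Forall_forall; intros z Hz.
      apply in_map_iff in Hz as [j [<- Hj]]; apply in_seq in Hj.
      assert (Hj' : (j < n)%nat) by lia.
      destruct (good_cell_pos _ (Hq j Hj')) as [_ Hr]; assert (B := HY j Hj'); fold (q j) in B.
      apply Rabs_le_inv; unfold f, Rdiv; rewrite Rabs_mult, (Rabs_pos_eq (/ _))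
        by (left; now apply Rinv_0_lt_compat).
      apply Rmult_le_reg_r with (1 := Hr); rewrite Rmult_assoc, Rinv_l by lra; lra.
    - apply (nth_ext _ _ 0 0); [now rewrite length_point|]; rewrite LY; intros j Hj.
      rewrite nth_point by exact Hj.
      destruct (good_cell_pos _ (Hq j Hj)) as [_ Hr].
      rewrite (nth_indep (map f _) 0 (f 0%nat)) by (now rewrite length_map, length_seq).
      rewrite map_nth, seq_nth by exact Hj; unfold f; cbn [Nat.add]; field; lra. }
  intros HX HX' E E'.
  destruct (S X HX) as [s [Hs ->]]; destruct (S X' HX') as [s' [Hs' ->]].
  f_equal; apply (fixed_point_unique n newton (4 / 5) ltac:(lra) newton_contracts);
    trivial; now apply newton_fixed.
Qed.

End NewtonMap.

(** * The four boxes *)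

(* The arguments, in registers 0 to 6, are the six entries of [coords] and the abscissa
   of the first heavy body; [residual_raw] spells out the values computed. *)
Definition residual_prog : list instr :=
  [Icst 8660254037844 10000000000000; Iscal 2 3 2; Iadd 4 8; Iscal 1 3 2; Isub 4 10; Iscal 1 2
    0; Isub 11 12; Iadd 11 12; Iscal 1 1000 9; Iscal 1 1000 13; Iscal 1 1000 14; Iscal 2 3 3;
    Iadd 5 18; Iscal 1 3 3; Isub 5 20; Iscal 1 2 1; Isub 21 22; Iadd 21 22; Iscal 1 1000 19;
    Iscal 1 1000 23; Iscal 1 1000 24; Iadd 7 25; Iadd 7 26; Iadd 7 27;
   Iscal 3 1000 4; Iscal 3 1000 5; Iscal 3 1 7; Iadd 33 32; Iscal (-1) 1 6; Iscal 50 999999925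
    31; Isub 35 36; Iscal (-50) 999999925 34;
   Isub 15 6; Ikern 39 28; Isub 15 37; Isub 28 38; Ikern 42 43; Iadd 40 44; Iscal 999999925
    2000000000 46; Isub 15 47; Iadd 41 45; Iscal 999999925 2000000000 49; Isub 28 50;
   Isub 16 6; Ikern 52 29; Isub 16 37; Isub 29 38; Ikern 55 56; Iadd 53 57; Iscal 999999925
    2000000000 59; Isub 16 60; Iadd 54 58; Iscal 999999925 2000000000 62; Isub 29 63;
   Isub 17 6; Ikern 65 30; Isub 17 37; Isub 30 38; Ikern 68 69; Iadd 66 70; Iscal 999999925
    2000000000 72; Isub 17 73; Iadd 67 71; Iscal 999999925 2000000000 75; Isub 30 76;
   Ikern 0 1; Iadd 2 12; Iadd 3 22; Ikern 80 81; Isub 2 12; Isub 3 22; Ikern 84 85;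
   Isub 74 61; Iscal 1000 1 88; Iscal 2 1 78; Isub 82 86; Iadd 90 91; Iscal 25 1 92; Isub 89
    93; Isub 77 64; Iscal 1000 1 95; Iscal 2 1 79; Isub 83 87; Iadd 97 98; Iscal 25 1 99; Isub
    96 100;
   Iadd 61 74; Iscal 1 2 102; Isub 48 103; Iscal 1000 1 104; Iadd 82 86; Iscal 75 2 106; Isub
    105 107; Iadd 64 77; Iscal 1 2 109; Isub 51 110; Iscal 1000 1 111; Iadd 83 87; Iscal 75 2
    113; Isub 112 114;
   Iadd 61 74; Iadd 48 116; Iscal 1000 3 117; Iadd 64 77; Iadd 51 119; Iscal 1000 3 120;
   Isub 6 37; Iscal (-1) 1 38; Ikern 122 123; Iscal 999999925 2000000000 124; Iadd 53 66; Iadd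
    40 127; Iscal 25 1000000000 128; Isub 126 129; Isub 6 130; Iscal 1000000 1 131].
Definition residual_outputs : list nat := [94; 101; 108; 115; 118; 121; 132]%nat.

(** The last cell is the abscissa of q1, with twice the radius that [heavy_near] grants. *)
Definition cells (h : list (Z * Z)) : list cell :=
  map (fun cr => Cell (fst cr) (snd cr) 4096) h ++ [Cell 500000 1 1000000].

(* Inverses of the diagonal of the Jacobian at the centres, relative to the radii. *)
Definition preconds : list (list (Z * Z)) :=
  [[(4096000, 123 * 2250); (4096000, 205 * 1500); (4096000, 123 * 4350); (4096000, 410 * 450);
    (4096000, 123 * 750); (4096000, 123 * 2250); (1, 3)];
   [(-4096000, 246 * 1500); (4096000, 164 * 6750); (-4096000, 123 * 4650); (4096000, 123 * 13050);
    (4096000, 123 * 750); (4096000, 123 * 2250); (1, 3)];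
   [(-4096000, 246 * 824); (4096000, 123 * 6074); (4096000, 164 * 2028); (4096000, 123 * 1723);
    (4096000, 123 * 750); (4096000, 123 * 2250); (1, 3)];
   [(-4096000, 246 * 824); (4096000, 123 * 6074); (4096000, 164 * 2028); (4096000, 123 * 1723);
    (4096000, 123 * 750); (4096000, 123 * 2250); (1, 3)]]%Z.

(** In the limit system the diagonal entries for the Jacobi coordinates are 9/4, 3/2, 87/20, 9/20 at
    the first collinear triangle and -3/2, 27/4, -93/20, 261/20 at the second. The centre of mass
    always has 3/4 and 9/4, and Q - m1 / (2 Q)^2 has slope about 3 at 1/2. The denominators of
    [preconds] list these in thousandths, times the radii; the isosceles entries are rounded. *)
Lemma boxes_contract :
  forallb (fun hd => contraction_check 40 residual_prog residual_outputs (cells (fst hd)) (snd hd))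
    (combine boxes preconds) = true.
Proof. vm_cast_no_check (eq_refl true). Qed.

Definition residual (X : list R) : list R :=
  map (fun o => nth o (run_R residual_prog X) 0) residual_outputs.

Lemma outputs_residual h X :
  length h = 6%nat -> outputs residual_prog residual_outputs (cells h) X = residual X.
Proof.
  intros Hh; unfold outputs, cells; rewrite length_app, length_map, Hh; reflexivity.
Qed.

Lemma box_in_boxes h : In h boxes -> exists d, In (h, d) (combine boxes preconds) /\ length h = 6%nat.
Proof.
  intros [<-|[<-|[<-|[<-|[]]]]]; eexists; (split; [|reflexivity]); cbn [boxes preconds combine].
  - now left.
  - right; now left.
  - right; right; now left.
  - right; right; right; now left.
Qed.

Lemma box_solution h :
  In h boxes -> exists X, in_cells (cells h) X /\ residual X = repeat 0 7.
Proof.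
  intros Hh; destruct (box_in_boxes h Hh) as [d [Hd Lh]].
  assert (C := boxes_contract); rewrite forallb_forall in C; specialize (C _ Hd); cbn [fst snd] in C.
  destruct (contraction_solution 40 ltac:(lia) _ _ _ _ C) as [X [H1 H2]].
  exists X; split; [exact H1|]; rewrite outputs_residual in H2 by exact Lh.
  unfold cells in H2; rewrite length_app, length_map, Lh in H2; exact H2.
Qed.

Lemma box_solution_unique h X X' :
  In h boxes -> in_cells (cells h) X -> in_cells (cells h) X' ->
  residual X = repeat 0 7 -> residual X' = repeat 0 7 -> X = X'.
Proof.
  intros Hh H1 H2 E1 E2; destruct (box_in_boxes h Hh) as [d [Hd Lh]].
  assert (C := boxes_contract); rewrite forallb_forall in C; specialize (C _ Hd); cbn [fst snd] in C.
  assert (Ln : length (cells h) = 7%nat) by (unfold cells; rewrite length_app, length_map, Lh; reflexivity).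
  apply (contraction_unique 40 ltac:(lia) _ _ _ _ C); trivial; rewrite outputs_residual, Ln; assumption.
Qed.

(** * The residual and the equations of the bodies *)

Definition light_x1 (m c : R) : R := 1 / 1000 * (c + 2 / 3 * m).
Definition light_x2 (u m c : R) : R := 1 / 1000 * (c - 1 / 3 * m - 1 / 2 * u).
Definition light_x3 (u m c : R) : R := 1 / 1000 * (c - 1 / 3 * m + 1 / 2 * u).

(** Fractions such as [2 / 1] are left as the instructions produce them, so that the unfolding of
    the program holds by conversion. *)
Lemma residual_raw x y xi et cx cy Q :
  let x1 := light_x1 xi cx in
  let x2 := light_x2 x xi cx in
  let x3 := light_x3 x xi cx in
  let y1 := Y0 + light_x1 et cy in
  let y2 := Y0 + light_x2 y et cy in
  let y3 := Y0 + light_x3 y et cy in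
  let E := -1 / 1 * Q - 50 / 999999925 * (3 / 1000 * cx) in
  let F := -50 / 999999925 * (3 / 1 * Y0 + 3 / 1000 * cy) in
  let gx := fun a b => a - 999999925 / 2000000000 * (fx (a - Q) b + fx (a - E) (b - F)) in
  let gy := fun a b => b - 999999925 / 2000000000 * (fy (a - Q) b + fy (a - E) (b - F)) in
  let k12 := fun f : R -> R -> R => f (xi + 1 / 2 * x) (et + 1 / 2 * y) in
  let k13 := fun f : R -> R -> R => f (xi - 1 / 2 * x) (et - 1 / 2 * y) in
  residual [x; y; xi; et; cx; cy; Q] =
  [1000 / 1 * (gx x3 y3 - gx x2 y2) - 25 / 1 * (2 / 1 * fx x y + (k12 fx - k13 fx));
   1000 / 1 * (gy x3 y3 - gy x2 y2) - 25 / 1 * (2 / 1 * fy x y + (k12 fy - k13 fy));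
   1000 / 1 * (gx x1 y1 - 1 / 2 * (gx x2 y2 + gx x3 y3)) - 75 / 2 * (k12 fx + k13 fx);
   1000 / 1 * (gy x1 y1 - 1 / 2 * (gy x2 y2 + gy x3 y3)) - 75 / 2 * (k12 fy + k13 fy);
   1000 / 3 * (gx x1 y1 + (gx x2 y2 + gx x3 y3));
   1000 / 3 * (gy x1 y1 + (gy x2 y2 + gy x3 y3));
   1000000 / 1 * (Q - (999999925 / 2000000000 * fx (Q - E) (-1 / 1 * F)
     - 25 / 1000000000 * (fx (x1 - Q) y1 + (fx (x2 - Q) y2 + fx (x3 - Q) y3))))].
Proof. reflexivity. Qed.

Lemma light_coords1 x1 x2 x3 :
  light_x1 (jm x1 x2 x3) (1000 / 3 * (x1 + x2 + x3)) = x1.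
Proof. unfold light_x1, jm; field. Qed.
Lemma light_coords2 x1 x2 x3 :
  light_x2 (jx x1 x2 x3) (jm x1 x2 x3) (1000 / 3 * (x1 + x2 + x3)) = x2.
Proof. unfold light_x2, jm, jx; field. Qed.
Lemma light_coords3 x1 x2 x3 :
  light_x3 (jx x1 x2 x3) (jm x1 x2 x3) (1000 / 3 * (x1 + x2 + x3)) = x3.
Proof. unfold light_x3, jm, jx; field. Qed.

Lemma coords_light x y xi et cx cy :
  coords (light_x1 xi cx) (Y0 + light_x1 et cy) (light_x2 x xi cx) (Y0 + light_x2 y et cy)
         (light_x3 x xi cx) (Y0 + light_x3 y et cy) = [x; y; xi; et; cx; cy].
Proof.
  unfold coords, jx, jm, light_x1, light_x2, light_x3; repeat f_equal; field.
Qed.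

Lemma force_units x y : 0 < rad x y ->
  25 * fx (1000 * x) (1000 * y) = 1000 * (mu * fx x y) /\
  25 * fy (1000 * x) (1000 * y) = 1000 * (mu * fy x y).
Proof. intros H; unfold fx, fy; rewrite rad_scale, mu_eq by lra; split; field; lra. Qed.

(* With e1, e2, e3 the defects of the light equations, the first six entries of the
   residual are, up to scaling, e3 - e2, e1 - (e2 + e3) / 2 and e1 + e2 + e3. *)
Lemma residual_zero_iff x1 y1 x2 y2 x3 y3 Q :
  0 < rad (x1 - x2) (y1 - y2) -> 0 < rad (x1 - x3) (y1 - y3) -> 0 < rad (x2 - x3) (y2 - y3) ->
  let E := heavy2x Q (x1 + x2 + x3) in
  let F := heavy2y (y1 + y2 + y3) in
  residual (coords x1 y1 x2 y2 x3 y3 ++ [Q]) = repeat 0 7 <->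
  light_eq Q E F x1 y1 x2 y2 x3 y3 /\ light_eq Q E F x2 y2 x1 y1 x3 y3 /\
  light_eq Q E F x3 y3 x1 y1 x2 y2 /\ heavy_eq Q E F x1 y1 x2 y2 x3 y3.
Proof.
  intros D12 D13 D23 E F; unfold coords; cbn [app]; rewrite residual_raw.
  replace (y1 - Y0 + (y2 - Y0) + (y3 - Y0)) with ((y1 - Y0) + (y2 - Y0) + (y3 - Y0)) by ring.
  replace (jm y1 y2 y3) with (jm (y1 - Y0) (y2 - Y0) (y3 - Y0)) by (unfold jm; field).
  replace (jx y1 y2 y3) with (jx (y1 - Y0) (y2 - Y0) (y3 - Y0)) by (unfold jx; ring).
  rewrite !light_coords1, !light_coords2, !light_coords3.
  replace (Y0 + (y1 - Y0)) with y1 by ring; replace (Y0 + (y2 - Y0)) with y2 by ring.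
  replace (Y0 + (y3 - Y0)) with y3 by ring.
  replace (-1 / 1 * Q - 50 / 999999925 * (3 / 1000 * (1000 / 3 * (x1 + x2 + x3)))) with E
    by (unfold E, heavy2x, nu; field).
  replace (-50 / 999999925 * (3 / 1 * Y0 + 3 / 1000 * (1000 / 3 * (y1 - Y0 + (y2 - Y0) + (y3 - Y0)))))
    with F by (unfold F, heavy2y, nu; field).
  cbv zeta; cbn beta.
  replace (jm x1 x2 x3 + 1 / 2 * jx x1 x2 x3) with (1000 * (x1 - x2)) by (unfold jx, jm; field).
  replace (jm x1 x2 x3 - 1 / 2 * jx x1 x2 x3) with (1000 * (x1 - x3)) by (unfold jx, jm; field).
  replace (jm (y1 - Y0) (y2 - Y0) (y3 - Y0) + 1 / 2 * jx (y1 - Y0) (y2 - Y0) (y3 - Y0))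
    with (1000 * (y1 - y2)) by (unfold jx, jm; field).
  replace (jm (y1 - Y0) (y2 - Y0) (y3 - Y0) - 1 / 2 * jx (y1 - Y0) (y2 - Y0) (y3 - Y0))
    with (1000 * (y1 - y3)) by (unfold jx, jm; field).
  replace (jx (y1 - Y0) (y2 - Y0) (y3 - Y0)) with (1000 * - (y2 - y3)) by (unfold jx; ring).
  replace (jx x1 x2 x3) with (1000 * - (x2 - x3)) by (unfold jx; ring).
  destruct (force_units _ _ D12) as [U12 V12]; destruct (force_units _ _ D13) as [U13 V13].
  assert (D32 : 0 < rad (- (x2 - x3)) (- (y2 - y3))) by (rewrite rad_opp; exact D23).
  destruct (force_units _ _ D32) as [U23 V23]; rewrite fx_opp in U23; rewrite fy_opp in V23.
  unfold light_eq, heavy_eq.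
  rewrite (fx_sym x2 y2 x1 y1), (fx_sym x3 y3 x1 y1), (fx_sym x3 y3 x2 y2).
  rewrite (fy_sym x2 y2 x1 y1), (fy_sym x3 y3 x1 y1), (fy_sym x3 y3 x2 y2).
  assert (HQ : forall a b, fx (Q - a) (- b) = - fx (a - Q) b).
  { intros a b; rewrite <- fx_opp; f_equal; ring. }
  rewrite (HQ x1), (HQ x2), (HQ x3); replace (-1 / 1 * F) with (- F) by field.
  assert (M1 := m1_eq); assert (MU := mu_eq).
  unfold Gx, Gy; rewrite <- M1, <- MU.
  cbn [repeat].
  set (a12 := fx (x1 - x2) (y1 - y2)) in *; set (a13 := fx (x1 - x3) (y1 - y3)) in *.
  set (a23 := fx (x2 - x3) (y2 - y3)) in *; set (b12 := fy (x1 - x2) (y1 - y2)) in *.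
  set (b13 := fy (x1 - x3) (y1 - y3)) in *; set (b23 := fy (x2 - x3) (y2 - y3)) in *.
  set (g1x := m1 * (fx (x1 - Q) y1 + _)); set (g1y := m1 * (fy (x1 - Q) y1 + _)).
  set (g2x := m1 * (fx (x2 - Q) y2 + _)); set (g2y := m1 * (fy (x2 - Q) y2 + _)).
  set (g3x := m1 * (fx (x3 - Q) y3 + _)); set (g3y := m1 * (fy (x3 - Q) y3 + _)).
  (* What remains is linear in products of masses and named forces: the combinations e3 - e2, e1 -
     (e2 + e3) / 2 and e1 + e2 + e3 of the defects determine e1, e2, e3 and conversely. *)
  clearbody a12 a13 a23 b12 b13 b23 g1x g1y g2x g2y g3x g3y.
  split.
  - intros H; injection H as H1 H2 H3 H4 H5 H6 H7; repeat split; lra.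
  - intros [[A1 A2] [[B1 B2] [[C1 C2] HH]]]; repeat f_equal; lra.
Qed.

(** * Central configurations of five bodies *)

Lemma point_neq_iff x y x' y' : (x, y) <> (x', y') <-> 0 < rad (x - x') (y - y').
Proof.
  split; intros H.
  - apply rad_gt0; apply Rnot_le_lt; intros L; apply H.
    assert (S1 := Rle_0_sqr (x - x')); assert (S2 := Rle_0_sqr (y - y')); unfold Rsqr in S1, S2.
    assert (E1 : (x - x') * (x - x') = 0) by lra; assert (E2 : (y - y') * (y - y') = 0) by lra.
    apply Rsqr_0_uniq in E1, E2; f_equal; lra.
  - intros E; injection E as -> ->; rewrite !Rminus_diag in H by reflexivity.
    unfold rad in H; rewrite Rmult_0_l, Rplus_0_l, sqrt_0 in H; lra.
Qed.

Lemma pull_eq m x y x' y' :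
  pscale (m / pdist (x, y) (x', y') ^ 3) (psub (x, y) (x', y'))
  = (m * fx (x - x') (y - y'), m * fy (x - x') (y - y')).
Proof.
  unfold pscale, psub, fx, fy; cbn [fst snd].
  change (pdist (x, y) (x', y')) with (rad (x - x') (y - y')).
  unfold Rdiv; f_equal; ring.
Qed.

Lemma cross_f x y : x * fy x y = y * fx x y.
Proof. unfold fx, fy, Rdiv; ring. Qed.

Section FiveBodies.

Variables x1 y1 x2 y2 x3 y3 Q E F : R.

Let c : config5 := Config5 (x1, y1) (x2, y2) (x3, y3) (Q, 0) (E, F).

Let a12 := fx (x1 - x2) (y1 - y2).
Let b12 := fy (x1 - x2) (y1 - y2).
Let a13 := fx (x1 - x3) (y1 - y3).
Let b13 := fy (x1 - x3) (y1 - y3).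
Let a23 := fx (x2 - x3) (y2 - y3).
Let b23 := fy (x2 - x3) (y2 - y3).
Let a14 := fx (x1 - Q) y1.
Let b14 := fy (x1 - Q) y1.
Let a24 := fx (x2 - Q) y2.
Let b24 := fy (x2 - Q) y2.
Let a34 := fx (x3 - Q) y3.
Let b34 := fy (x3 - Q) y3.
Let a15 := fx (x1 - E) (y1 - F).
Let b15 := fy (x1 - E) (y1 - F).
Let a25 := fx (x2 - E) (y2 - F).
Let b25 := fy (x2 - E) (y2 - F).
Let a35 := fx (x3 - E) (y3 - F).
Let b35 := fy (x3 - E) (y3 - F).
Let a45 := fx (Q - E) (- F).
Let b45 := fy (Q - E) (- F).

Ltac sum_pulls :=
  unfold attraction; cbn [seq filter Nat.eqb negb map psum fold_right]; unfold position, mass;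
  cbn [nth p1 p2 p3 q1 q2 c]; rewrite !pull_eq.

Local Lemma attraction1 : attraction 5 mass (position c) 0 =
  (mu * a12 + mu * a13 + m1 * (a14 + a15), mu * b12 + mu * b13 + m1 * (b14 + b15)).
Proof.
  sum_pulls; rewrite Rminus_0_r.
  unfold padd, m2; cbn [fst snd]; fold a12 b12 a13 b13 a14 b14 a15 b15; f_equal; ring.
Qed.

Local Lemma attraction2 : attraction 5 mass (position c) 1 =
  (- mu * a12 + mu * a23 + m1 * (a24 + a25), - mu * b12 + mu * b23 + m1 * (b24 + b25)).
Proof.
  sum_pulls; rewrite Rminus_0_r, (fx_sym x2 y2 x1 y1), (fy_sym x2 y2 x1 y1).
  unfold padd, m2; cbn [fst snd]; fold a12 b12 a23 b23 a24 b24 a25 b25; f_equal; ring.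
Qed.

Local Lemma attraction3 : attraction 5 mass (position c) 2 =
  (- mu * a13 - mu * a23 + m1 * (a34 + a35), - mu * b13 - mu * b23 + m1 * (b34 + b35)).
Proof.
  sum_pulls; rewrite Rminus_0_r, (fx_sym x3 y3 x1 y1), (fy_sym x3 y3 x1 y1),
    (fx_sym x3 y3 x2 y2), (fy_sym x3 y3 x2 y2).
  unfold padd, m2; cbn [fst snd]; fold a13 b13 a23 b23 a34 b34 a35 b35; f_equal; ring.
Qed.

Local Lemma attraction4 : attraction 5 mass (position c) 3 =
  (- mu * (a14 + a24 + a34) + m1 * a45, - mu * (b14 + b24 + b34) + m1 * b45).
Proof.
  sum_pulls.
  rewrite (fx_sym Q 0 x1 y1), (fy_sym Q 0 x1 y1), (fx_sym Q 0 x2 y2), (fy_sym Q 0 x2 y2),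
    (fx_sym Q 0 x3 y3), (fy_sym Q 0 x3 y3), !Rminus_0_r, !Rminus_0_l.
  unfold padd, m2; cbn [fst snd]; fold a14 b14 a24 b24 a34 b34 a45 b45; f_equal; ring.
Qed.

Local Lemma attraction5 : attraction 5 mass (position c) 4 =
  (- mu * (a15 + a25 + a35) - m1 * a45, - mu * (b15 + b25 + b35) - m1 * b45).
Proof.
  sum_pulls.
  rewrite (fx_sym E F x1 y1), (fy_sym E F x1 y1), (fx_sym E F x2 y2), (fy_sym E F x2 y2),
    (fx_sym E F x3 y3), (fy_sym E F x3 y3), (fx_sym E F Q 0), (fy_sym E F Q 0), !Rminus_0_l.
  unfold padd, m2; cbn [fst snd]; fold a15 b15 a25 b25 a35 b35 a45 b45; f_equal; ring.
Qed.

Local Lemma m1_gt0 : 0 < m1.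
Proof. rewrite m1_eq; lra. Qed.

Local Lemma heavy_eq_atoms :
  heavy_eq Q E F x1 y1 x2 y2 x3 y3 <-> Q = - mu * (a14 + a24 + a34) + m1 * a45.
Proof.
  unfold heavy_eq.
  assert (HQ : forall a b, fx (Q - a) (- b) = - fx (a - Q) b)
    by (intros a b; rewrite <- fx_opp; f_equal; ring).
  rewrite (HQ x1), (HQ x2), (HQ x3); fold a14 a24 a34 a45; split; lra.
Qed.

Lemma ncc_reduced :
  normalized_central_configuration 5 mass (position c) ->
  0 < rad (x1 - x2) (y1 - y2) /\ 0 < rad (x1 - x3) (y1 - y3) /\ 0 < rad (x2 - x3) (y2 - y3) /\
  E = heavy2x Q (x1 + x2 + x3) /\ F = heavy2y (y1 + y2 + y3) /\
  light_eq Q E F x1 y1 x2 y2 x3 y3 /\ light_eq Q E F x2 y2 x1 y1 x3 y3 /\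
  light_eq Q E F x3 y3 x1 y1 x2 y2 /\ heavy_eq Q E F x1 y1 x2 y2 x3 y3.
Proof.
  intros [_ [HD HE]].
  assert (A1 := HE 0%nat ltac:(lia)); assert (A2 := HE 1%nat ltac:(lia)).
  assert (A3 := HE 2%nat ltac:(lia)); assert (A4 := HE 3%nat ltac:(lia)).
  assert (A5 := HE 4%nat ltac:(lia)).
  rewrite attraction1 in A1; rewrite attraction2 in A2; rewrite attraction3 in A3.
  rewrite attraction4 in A4; rewrite attraction5 in A5.
  injection A1 as X1 Y1; injection A2 as X2 Y2; injection A3 as X3 Y3.
  injection A4 as X4 Y4; injection A5 as X5 Y5.
  assert (D12 := proj1 (point_neq_iff _ _ _ _) (HD 0%nat 1%nat ltac:(lia) ltac:(lia) ltac:(lia))).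
  assert (D13 := proj1 (point_neq_iff _ _ _ _) (HD 0%nat 2%nat ltac:(lia) ltac:(lia) ltac:(lia))).
  assert (D23 := proj1 (point_neq_iff _ _ _ _) (HD 1%nat 2%nat ltac:(lia) ltac:(lia) ltac:(lia))).
  assert (Hm := m1_gt0).
  (* The equations weighted by the masses and added: the pairwise attractions cancel, so the centre
     of mass is the origin. Division by the common heavy mass leaves the ratio [nu]. *)
  assert (CX : m1 * E = m1 * heavy2x Q (x1 + x2 + x3)).
  { unfold heavy2x; rewrite Rmult_minus_distr_l, <- (Rmult_assoc m1 nu), nu_eq.
    assert (S1 := f_equal (Rmult mu) X1); assert (S2 := f_equal (Rmult mu) X2).
    assert (S3 := f_equal (Rmult mu) X3); assert (S4 := f_equal (Rmult m1) X4).
    assert (S5 := f_equal (Rmult m1) X5); lra. }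
  assert (CY : m1 * F = m1 * heavy2y (y1 + y2 + y3)).
  { unfold heavy2y; rewrite Ropp_mult_distr_r_reverse, <- (Rmult_assoc m1 nu), nu_eq.
    assert (S1 := f_equal (Rmult mu) Y1); assert (S2 := f_equal (Rmult mu) Y2).
    assert (S3 := f_equal (Rmult mu) Y3); assert (S4 := f_equal (Rmult m1) Y4).
    assert (S5 := f_equal (Rmult m1) Y5); lra. }
  apply Rmult_eq_reg_l in CX, CY; try lra.
  split; [exact D12|]; split; [exact D13|]; split; [exact D23|].
  split; [exact CX|]; split; [exact CY|].
  unfold light_eq, Gx, Gy.
  rewrite (fx_sym x2 y2 x1 y1), (fx_sym x3 y3 x1 y1), (fx_sym x3 y3 x2 y2).
  rewrite (fy_sym x2 y2 x1 y1), (fy_sym x3 y3 x1 y1), (fy_sym x3 y3 x2 y2).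
  fold a12 b12 a13 b13 a23 b23 a14 b14 a24 b24 a34 b34 a15 b15 a25 b25 a35 b35.
  split; [split; lra|]; split; [split; lra|]; split; [split; lra|].
  now apply heavy_eq_atoms.
Qed.

(* The total force and the total torque of the mutual attractions vanish, which yields
   the three equations of the heavy bodies that are not among the hypotheses. *)
Lemma reduced_ncc :
  0 < rad (x1 - x2) (y1 - y2) -> 0 < rad (x1 - x3) (y1 - y3) -> 0 < rad (x2 - x3) (y2 - y3) ->
  0 < y1 -> 0 < y2 -> 0 < y3 -> F <= 0 -> Q <> E ->
  E = heavy2x Q (x1 + x2 + x3) -> F = heavy2y (y1 + y2 + y3) ->
  light_eq Q E F x1 y1 x2 y2 x3 y3 -> light_eq Q E F x2 y2 x1 y1 x3 y3 ->
  light_eq Q E F x3 y3 x1 y1 x2 y2 -> heavy_eq Q E F x1 y1 x2 y2 x3 y3 ->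
  normalized_central_configuration 5 mass (position c).
Proof.
  intros D12 D13 D23 P1 P2 P3 HF HQE CX CY L1 L2 L3 HH.
  apply heavy_eq_atoms in HH.
  unfold light_eq, Gx, Gy in L1, L2, L3.
  rewrite (fx_sym x2 y2 x1 y1), (fy_sym x2 y2 x1 y1) in L2.
  rewrite (fx_sym x3 y3 x1 y1), (fx_sym x3 y3 x2 y2), (fy_sym x3 y3 x1 y1), (fy_sym x3 y3 x2 y2) in L3.
  fold a12 b12 a13 b13 a23 b23 a14 b14 a24 b24 a34 b34 a15 b15 a25 b25 a35 b35 in L1, L2, L3.
  destruct L1 as [L1 L1'], L2 as [L2 L2'], L3 as [L3 L3'].
  assert (Hm := m1_gt0).
  assert (CX' : m1 * E = - (m1 * Q) - mu * (x1 + x2 + x3)).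
  { rewrite CX at 1; unfold heavy2x; rewrite <- nu_eq; ring. }
  assert (CY' : m1 * F = - (mu * (y1 + y2 + y3))).
  { rewrite CY at 1; unfold heavy2y; rewrite <- nu_eq; ring. }
  assert (C12 := cross_f (x1 - x2) (y1 - y2)); assert (C13 := cross_f (x1 - x3) (y1 - y3)).
  assert (C23 := cross_f (x2 - x3) (y2 - y3)); assert (C14 := cross_f (x1 - Q) y1).
  assert (C24 := cross_f (x2 - Q) y2); assert (C34 := cross_f (x3 - Q) y3).
  assert (C15 := cross_f (x1 - E) (y1 - F)); assert (C25 := cross_f (x2 - E) (y2 - F)).
  assert (C35 := cross_f (x3 - E) (y3 - F)); assert (C45 := cross_f (Q - E) (- F)).
  fold a12 b12 in C12; fold a13 b13 in C13; fold a23 b23 in C23; fold a14 b14 in C14.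
  fold a24 b24 in C24; fold a34 b34 in C34; fold a15 b15 in C15; fold a25 b25 in C25.
  fold a35 b35 in C35; fold a45 b45 in C45.
  set (A4 := - mu * (b14 + b24 + b34) + m1 * b45).
  set (A5x := - mu * (a15 + a25 + a35) - m1 * a45).
  set (A5 := - mu * (b15 + b25 + b35) - m1 * b45).
  assert (SX : m1 * Q + m1 * A5x = - (mu * (x1 + x2 + x3))).
  { unfold A5x; assert (S1 := f_equal (Rmult mu) L1); assert (S2 := f_equal (Rmult mu) L2).
    assert (S3 := f_equal (Rmult mu) L3); assert (S4 := f_equal (Rmult m1) HH); lra. }
  assert (SY : m1 * A4 + m1 * A5 = - (mu * (y1 + y2 + y3))).
  { unfold A4, A5; assert (S1 := f_equal (Rmult mu) L1'); assert (S2 := f_equal (Rmult mu) L2').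
    assert (S3 := f_equal (Rmult mu) L3'); lra. }
  assert (EX : A5x = E) by (apply (Rmult_eq_reg_l m1); lra).
  assert (EY : A5 = F - A4) by (apply (Rmult_eq_reg_l m1); lra).
  assert (T : Q * A4 + E * A5 - F * A5x = 0).
  { apply (Rmult_eq_reg_l m1); [|lra].
    assert (V1 : mu * (x1 * (y1 - m1 * (b14 + b15)) - y1 * (x1 - m1 * (a14 + a15)))
      = mu * (x1 * (mu * (b12 + b13)) - y1 * (mu * (a12 + a13)))) by (rewrite L1, L1'; ring).
    assert (V2 : mu * (x2 * (y2 - m1 * (b24 + b25)) - y2 * (x2 - m1 * (a24 + a25)))
      = mu * (x2 * (mu * (- b12 + b23)) - y2 * (mu * (- a12 + a23)))) by (rewrite L2, L2'; ring).
    assert (V3 : mu * (x3 * (y3 - m1 * (b34 + b35)) - y3 * (x3 - m1 * (a34 + a35)))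
      = mu * (x3 * (mu * (- b13 + - b23)) - y3 * (mu * (- a13 + - a23)))) by (rewrite L3, L3'; ring).
    unfold A4, A5, A5x.
    (* Each pair is weighted by the product of its masses; with these multiples the balance of
       torques is linear in the monomials that occur. *)
    apply (f_equal (Rmult (mu * mu))) in C12, C13, C23.
    apply (f_equal (Rmult (mu * m1))) in C14, C24, C34, C15, C25, C35.
    apply (f_equal (Rmult (m1 * m1))) in C45.
    lra. }
  (* Substituting A5x = E and A5 = F - A4 in the torque leaves (Q - E) A4 = 0. *)
  assert (E4 : A4 = 0).
  { apply (Rmult_eq_reg_l (Q - E)); [|lra]; rewrite EX, EY in T; lra. }
  rewrite E4 in EY.
  split; [|split].
  - intros [|[|[|[|[|i]]]]] Hi; try lia; unfold mass, m2; cbn [nth];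
      rewrite ?m1_eq, ?mu_eq; lra.
  - assert (N : forall i j, (i < j < 5)%nat -> position c i <> position c j).
    { assert (N4 : forall x y, 0 < y -> (x, y) <> (Q, 0)) by (intros x y Hy H; injection H; lra).
      assert (N5 : forall x y, 0 < y -> (x, y) <> (E, F)) by (intros x y Hy H; injection H; lra).
      intros [|[|[|[|i]]]] [|[|[|[|[|j]]]]] H; try lia; unfold position; cbn [nth p1 p2 p3 q1 q2 c];
        try (now apply point_neq_iff); try (now apply N4); try (now apply N5).
      intros H'; injection H'; congruence. }
    intros i j Hi Hj Hij; destruct (Nat.lt_total i j) as [L|[L|L]]; [now apply N|contradiction|].
    apply not_eq_sym, N; lia.
  - intros [|[|[|[|[|i]]]]] Hi; try lia.
    + rewrite attraction1; unfold position; cbn [nth p1 c]; f_equal; lra.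
    + rewrite attraction2; unfold position; cbn [nth p2 c]; f_equal; lra.
    + rewrite attraction3; unfold position; cbn [nth p3 c]; f_equal; lra.
    + rewrite attraction4; fold A4; unfold position; cbn [nth q1 c]; f_equal; lra.
    + rewrite attraction5; fold A5 A5x; unfold position; cbn [nth q2 c]; f_equal; lra.
Qed.

End FiveBodies.

(** * Counting *)

Definition target (c : config5) : Prop :=
  normalized_central_configuration 5 mass (position c) /\
  in_box (-0.2) 0.2 0.7 1.0 (p1 c) /\
  in_box (-0.2) 0.2 0.7 1.0 (p2 c) /\
  in_box (-0.2) 0.2 0.7 1.0 (p3 c) /\
  in_box 0.49 0.65 0 0 (q1 c).

Definition config_coords (c : config5) : list R :=
  coords (fst (p1 c)) (snd (p1 c)) (fst (p2 c)) (snd (p2 c)) (fst (p3 c)) (snd (p3 c)).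

Definition rot (c : config5) : config5 := Config5 (p2 c) (p3 c) (p1 c) (q1 c) (q2 c).
Definition swap (c : config5) : config5 := Config5 (p1 c) (p3 c) (p2 c) (q1 c) (q2 c).

Definition relabellings (c : config5) : list config5 :=
  [c; rot c; rot (rot c); swap c; swap (rot c); swap (rot (rot c))].

Lemma in_box_light x y : in_box (-0.2) 0.2 0.7 1.0 (x, y) <-> in_light_box x y.
Proof. unfold in_box, in_light_box; cbn [fst snd]; lra. Qed.

Lemma target_shape c :
  target c -> exists x1 y1 x2 y2 x3 y3 Q E F,
    c = Config5 (x1, y1) (x2, y2) (x3, y3) (Q, 0) (E, F) /\
    in_light_box x1 y1 /\ in_light_box x2 y2 /\ in_light_box x3 y3 /\ 49 / 100 <= Q <= 65 / 100.
Proof.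
  destruct c as [[x1 y1] [x2 y2] [x3 y3] [Q z] [E F]]; intros [_ [B1 [B2 [B3 B4]]]].
  cbn [p1 p2 p3 q1 fst snd] in *; unfold in_box in B4; cbn [fst snd] in B4.
  apply in_box_light in B1, B2, B3.
  exists x1, y1, x2, y2, x3, y3, Q, E, F.
  replace z with 0 by lra; repeat split; try apply B1; try apply B2; try apply B3; lra.
Qed.

Lemma target_light_system {x1 y1 x2 y2 x3 y3 Q E F} :
  target (Config5 (x1, y1) (x2, y2) (x3, y3) (Q, 0) (E, F)) ->
  light_system Q E F x1 y1 x2 y2 x3 y3.
Proof.
  intros [HN [B1 [B2 [B3 B4]]]]; cbn [p1 p2 p3 q1] in *.
  apply in_box_light in B1, B2, B3.
  destruct (ncc_reduced _ _ _ _ _ _ _ _ _ HN) as [D12 [D13 [D23 [-> [-> [L1 [L2 [L3 HH]]]]]]]].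
  assert (HQ : 49 / 100 <= Q <= 65 / 100) by (unfold in_box in B4; cbn [fst snd] in B4; lra).
  assert (Hq := heavy_localised _ _ _ _ _ _ _ B1 B2 B3 HQ HH).
  destruct (light_distances _ _ _ _ _ _ _ _ _ Hq B1 B2 B3 L1 L2 L3 D12 D13 D23) as [S1 [S2 S3]].
  split; trivial; now apply (virial_bound _ _ _ _ _ _ _ _ _ Hq B1 B2 B3 L1 L2 L3).
Qed.

Ltac relabel_target f :=
  intros H; destruct (target_shape _ H) as [x1 [y1 [x2 [y2 [x3 [y3 [Q [E [F [-> [B1 [B2 [B3 BQ]]]]]]]]]]]]];
  destruct H as [HN [I1 [I2 [I3 I4]]]]; cbn [p1 p2 p3 q1] in *; unfold f; cbn [p1 p2 p3 q1 q2];
  destruct (ncc_reduced _ _ _ _ _ _ _ _ _ HN) as [D12 [D13 [D23 [CE [CF [L1 [L2 [L3 HH]]]]]]]];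
  split; [|cbn [p1 p2 p3 q1]; auto];
  destruct B1, B2, B3;
  apply reduced_ncc; try lra; trivial; try (rewrite rad_sym; assumption); try (apply light_eq_sym; assumption);
  [ rewrite CF; unfold heavy2y, nu; lra
  | rewrite CE; unfold heavy2x, nu; lra
  | rewrite CE; f_equal; ring
  | rewrite CF; f_equal; ring
  | unfold heavy_eq in *; lra ].

(** Relabelling passes through the reduced system, where it amounts to permuting a few symmetric
    equations, instead of reordering the sums of attractions. *)
Lemma target_rot c : target c -> target (rot c).
Proof. relabel_target rot. Qed.

Lemma target_swap c : target c -> target (swap c).
Proof. relabel_target swap. Qed.

Lemma target_relabel c c' : target c -> In c' (relabellings c) -> target c'.
Proof.
  intros H [<-|[<-|[<-|[<-|[<-|[<-|[]]]]]]]; trivial;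
    repeat first [assumption | apply target_swap | apply target_rot].
Qed.

Lemma relabellings_sym c c' : In c' (relabellings c) -> In c (relabellings c').
Proof.
  destruct c as [a b d e f]; unfold relabellings, swap, rot; cbn [p1 p2 p3 q1 q2].
  intros [<-|[<-|[<-|[<-|[<-|[<-|[]]]]]]]; cbn [p1 p2 p3 q1 q2 In]; tauto.
Qed.

(** The choice of the apex is one of three rotations, and [light_system_box] may ask for the
    exchange of the base bodies; together these are the six labellings. *)
Lemma target_in_some_box c :
  target c -> exists c' h, In c' (relabellings c) /\ In h boxes /\ in_hull h (config_coords c').
Proof.
  intros H; destruct (target_shape c H) as [x1 [y1 [x2 [y2 [x3 [y3 [Q [E [F [-> _]]]]]]]]]].
  assert (L := target_light_system H).
  assert (G : forall c', (exists h, In h boxes /\ in_hull h (config_coords c')) ->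
    In c' (relabellings (Config5 (x1, y1) (x2, y2) (x3, y3) (Q, 0) (E, F))) ->
    exists c' h, In c' (relabellings (Config5 (x1, y1) (x2, y2) (x3, y3) (Q, 0) (E, F)))
      /\ In h boxes /\ in_hull h (config_coords c')).
  { intros c' [h [A B]] C; exists c', h; auto. }
  assert (L' := light_system_rot L).
  assert (L'' := light_system_rot L').
  unfold relabellings, swap, rot in *; cbn [p1 p2 p3 q1 q2] in *.
  destruct (isosceles_label_exists x1 y1 x2 y2 x3 y3) as [I|[I|I]];
    [destruct (light_system_box L I) as [K|K]
    |destruct (light_system_box L' I) as [K|K]
    |destruct (light_system_box L'' I) as [K|K]];
    apply Exists_exists in K.
  - apply (G (Config5 (x1, y1) (x2, y2) (x3, y3) (Q, 0) (E, F)) K); cbn [In]; tauto.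
  - apply (G (Config5 (x1, y1) (x3, y3) (x2, y2) (Q, 0) (E, F)) K); cbn [In]; tauto.
  - apply (G (Config5 (x2, y2) (x3, y3) (x1, y1) (Q, 0) (E, F)) K); cbn [In]; tauto.
  - apply (G (Config5 (x2, y2) (x1, y1) (x3, y3) (Q, 0) (E, F)) K); cbn [In]; tauto.
  - apply (G (Config5 (x3, y3) (x1, y1) (x2, y2) (Q, 0) (E, F)) K); cbn [In]; tauto.
  - apply (G (Config5 (x3, y3) (x2, y2) (x1, y1) (Q, 0) (E, F)) K); cbn [In]; tauto.
Qed.

Lemma in_cells_hull h v Q :
  In h boxes ->
  in_cells (cells h) (v ++ [Q]) <-> in_hull h v /\ Rabs (Q - 1 / 2) <= 1 / 1000000.
Proof.
  intros Hh.
  assert (EQ : 500000 / 1000000 = 1 / 2) by lra.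
  split.
  - intros [HL H].
    assert (Lh : length h = 6%nat) by (now destruct (box_in_boxes h Hh) as [_ [_ ?]]).
    unfold cells in *; rewrite !length_app, length_map, Lh in HL; cbn in HL.
    destruct v as [|v0 [|v1 [|v2 [|v3 [|v4 [|v5 [|v6 v]]]]]]]; cbn in HL; try lia.
    destruct Hh as [<-|[<-|[<-|[<-|[]]]]]; cbn in H;
      assert (H0 := H 0%nat ltac:(lia)); assert (H1 := H 1%nat ltac:(lia));
      assert (H2 := H 2%nat ltac:(lia)); assert (H3 := H 3%nat ltac:(lia));
      assert (H4 := H 4%nat ltac:(lia)); assert (H5 := H 5%nat ltac:(lia));
      assert (H6 := H 6%nat ltac:(lia)); clear H; cbn in *;
      unfold centre_R, radius_R in *; cbn [ccentre cradius cden] in *; rewrite EQ in H6;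
      (split; [do 6 (constructor; [assumption|]); constructor | assumption]).
  - intros [H HQ]; rewrite <- EQ in HQ.
    assert (LH := Forall2_length H); split.
    + unfold cells; rewrite !length_app, length_map, LH; reflexivity.
    + destruct Hh as [<-|[<-|[<-|[<-|[]]]]]; unfold in_hull in H;
        destruct v as [|v0 [|v1 [|v2 [|v3 [|v4 [|v5 [|v6 v]]]]]]]; try discriminate LH;
        split_forall2 H;
        intros [|[|[|[|[|[|[|j]]]]]]] Hj; cbn in Hj; try lia; assumption.
Qed.

Lemma target_residual {x1 y1 x2 y2 x3 y3 Q E F h} :
  In h boxes -> target (Config5 (x1, y1) (x2, y2) (x3, y3) (Q, 0) (E, F)) ->
  in_hull h (coords x1 y1 x2 y2 x3 y3) ->
  E = heavy2x Q (x1 + x2 + x3) /\ F = heavy2y (y1 + y2 + y3) /\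
  in_cells (cells h) (coords x1 y1 x2 y2 x3 y3 ++ [Q]) /\
  residual (coords x1 y1 x2 y2 x3 y3 ++ [Q]) = repeat 0 7.
Proof.
  intros Hh H HB; assert (L := target_light_system H).
  destruct H as [HN _].
  destruct (ncc_reduced _ _ _ _ _ _ _ _ _ HN) as [D12 [D13 [D23 [CE [CF [L1 [L2 [L3 HH]]]]]]]].
  split; [exact CE|]; split; [exact CF|]; split.
  - apply in_cells_hull; [exact Hh|]; split; [exact HB|].
    destruct (ls_heavy L) as [HQ _]; apply Rabs_le; lra.
  - apply residual_zero_iff; trivial; rewrite <- CE, <- CF; auto.
Qed.

Lemma coords_inj x1 y1 x2 y2 x3 y3 x1' y1' x2' y2' x3' y3' :
  coords x1 y1 x2 y2 x3 y3 = coords x1' y1' x2' y2' x3' y3' ->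
  x1 = x1' /\ y1 = y1' /\ x2 = x2' /\ y2 = y2' /\ x3 = x3' /\ y3 = y3'.
Proof.
  unfold coords, jx, jm; intros H; injection H as H1 H2 H3 H4 H5 H6; repeat split; lra.
Qed.

Lemma box_target_unique h c c' :
  In h boxes -> target c -> target c' ->
  in_hull h (config_coords c) -> in_hull h (config_coords c') -> c = c'.
Proof.
  intros Hh T T' HB HB'.
  destruct (target_shape c T) as [x1 [y1 [x2 [y2 [x3 [y3 [Q [E [F [-> _]]]]]]]]]].
  destruct (target_shape c' T') as [x1' [y1' [x2' [y2' [x3' [y3' [Q' [E' [F' [-> _]]]]]]]]]].
  destruct (target_residual Hh T HB) as [CE [CF [C R1]]].
  destruct (target_residual Hh T' HB') as [CE' [CF' [C' R2]]].
  assert (X := box_solution_unique h _ _ Hh C C' R1 R2).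
  apply app_inj_tail in X as [X EQ].
  apply coords_inj in X as [-> [-> [-> [-> [-> ->]]]]]; subst; reflexivity.
Qed.

Lemma box_target h : In h boxes -> exists c, target c /\ in_hull h (config_coords c).
Proof.
  intros Hh; destruct (box_solution h Hh) as [X [HX HR]].
  assert (LX : length X = 7%nat).
  { destruct HX as [LX _]; rewrite LX; unfold cells; rewrite length_app, length_map.
    destruct (box_in_boxes h Hh) as [_ [_ ->]]; reflexivity. }
  destruct X as [|x [|y [|xi [|et [|cx [|cy [|Q [|? X]]]]]]]]; try discriminate LX.
  set (x1 := light_x1 xi cx); set (y1 := Y0 + light_x1 et cy).
  set (x2 := light_x2 x xi cx); set (y2 := Y0 + light_x2 y et cy).
  set (x3 := light_x3 x xi cx); set (y3 := Y0 + light_x3 y et cy).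
  assert (EC : coords x1 y1 x2 y2 x3 y3 = [x; y; xi; et; cx; cy]) by apply coords_light.
  change ([x; y; xi; et; cx; cy; Q]) with ([x; y; xi; et; cx; cy] ++ [Q]) in HX, HR.
  apply in_cells_hull in HX as [HB HQ]; [|exact Hh].
  rewrite <- EC in HB, HR.
  set (E := heavy2x Q (x1 + x2 + x3)); set (F := heavy2y (y1 + y2 + y3)).
  exists (Config5 (x1, y1) (x2, y2) (x3, y3) (Q, 0) (E, F)); split; [|exact HB].
  rewrite EC in HB; apply Rabs_le_inv in HQ.
  assert (K : in_light_box x1 y1 /\ in_light_box x2 y2 /\ in_light_box x3 y3 /\
    0 < rad (x1 - x2) (y1 - y2) /\ 0 < rad (x1 - x3) (y1 - y3) /\ 0 < rad (x2 - x3) (y2 - y3)).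
  { clear HR EC E F; unfold x1, x2, x3, y1, y2, y3, in_light_box, light_x1, light_x2, light_x3, Y0.
    (* In each box every pair of light bodies is separated by one coordinate: the abscissa or the
       ordinate along the line in the collinear boxes, and in the isosceles ones the abscissa for
       the legs and the ordinate for the base. *)
    assert (NX : forall a b, a <> 0 -> 0 < rad a b)
      by (intros a b Ha; apply rad_gt0; assert (P1 := Rsqr_pos_lt a Ha);
          assert (P2 := Rle_0_sqr b); unfold Rsqr in *; lra).
    assert (NY : forall a b, b <> 0 -> 0 < rad a b)
      by (intros a b Hb; apply rad_gt0; assert (P1 := Rsqr_pos_lt b Hb);
          assert (P2 := Rle_0_sqr a); unfold Rsqr in *; lra).
    destruct Hh as [<-|[<-|[<-|[<-|[]]]]]; unfold in_hull in HB; split_forall2 HB;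
      repeat match goal with H : Rabs _ <= _ |- _ => apply Rabs_le_inv in H end;
      (split; [split; lra|]; split; [split; lra|]; split; [split; lra|]).
    - split; [apply NX; lra|]; split; [apply NX; lra|]; apply NX; lra.
    - split; [apply NY; lra|]; split; [apply NY; lra|]; apply NY; lra.
    - split; [apply NX; lra|]; split; [apply NX; lra|]; apply NY; lra.
    - split; [apply NX; lra|]; split; [apply NX; lra|]; apply NY; lra. }
  destruct K as [B1 [B2 [B3 [D12 [D13 D23]]]]].
  apply residual_zero_iff in HR as [L1 [L2 [L3 HH]]]; trivial.
  split; [|cbn [p1 p2 p3 q1]; repeat split; cbn [fst snd]; destruct B1, B2, B3; lra].
  destruct B1, B2, B3; apply reduced_ncc; trivial; try lra.
  - unfold F, heavy2y, nu; lra.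
  - unfold E, heavy2x, nu; lra.
Qed.

Lemma relabellings_NoDup c : target c -> NoDup (relabellings c).
Proof.
  intros T; destruct (target_shape c T) as [x1 [y1 [x2 [y2 [x3 [y3 [Q [E [F [-> _]]]]]]]]]].
  destruct T as [[_ [HD _]] _].
  assert (N12 := HD 0%nat 1%nat ltac:(lia) ltac:(lia) ltac:(lia)).
  assert (N13 := HD 0%nat 2%nat ltac:(lia) ltac:(lia) ltac:(lia)).
  assert (N23 := HD 1%nat 2%nat ltac:(lia) ltac:(lia) ltac:(lia)).
  unfold position in *; cbn [nth p1 p2 p3] in *.
  unfold relabellings, swap, rot; cbn [p1 p2 p3 q1 q2].
  repeat (constructor; [cbn [In]; intuition congruence|]); constructor.
Qed.

(** A common relabelling would identify the light bodies of the two triangles up to a permutation.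
    Box membership is a system of linear bounds, so each of the 36 ways to match the labels is
    refuted by linear arithmetic. *)
Lemma boxes_disjoint i j c c' d :
  (i < j < 4)%nat -> in_hull (nth i boxes []) (config_coords c) ->
  in_hull (nth j boxes []) (config_coords c') ->
  In d (relabellings c) -> In d (relabellings c') -> False.
Proof.
  intros Hij H H' Hd Hd'.
  destruct c as [[x1 y1] [x2 y2] [x3 y3] q q'], c' as [[u1 v1] [u2 v2] [u3 v3] r r'].
  unfold config_coords, coords, jx, jm in H, H'; cbn [p1 p2 p3 fst snd] in H, H'.
  unfold relabellings, swap, rot in Hd, Hd'; cbn [p1 p2 p3 q1 q2] in Hd, Hd'.
  destruct i as [|[|[|i]]], j as [|[|[|[|j]]]]; try lia; cbn [nth boxes] in H, H';
    unfold in_hull in H, H'; split_forall2 H; split_forall2 H';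
    repeat match goal with K : Rabs _ <= _ |- _ => apply Rabs_le_inv in K end;
    clear Hij;
    destruct Hd as [<-|[<-|[<-|[<-|[<-|[<-|[]]]]]]];
    destruct Hd' as [K|[K|[K|[K|[K|[K|[]]]]]]]; injection K as; lra.
Qed.

Theorem mainTheorem5 :
  has_exactly
    (fun c : config5 =>
       normalized_central_configuration 5 mass (position c) /\
       in_box (-0.2) 0.2 0.7 1.0 (p1 c) /\
       in_box (-0.2) 0.2 0.7 1.0 (p2 c) /\
       in_box (-0.2) 0.2 0.7 1.0 (p3 c) /\
       in_box 0.49 0.65 0 0 (q1 c))
    24.
Proof.
  change (has_exactly target 24).
  assert (B : forall i, (i < 4)%nat -> In (nth i boxes []) boxes) by (intros; now apply nth_In).
  destruct (box_target _ (B 0%nat ltac:(lia))) as [c0 [T0 H0]].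
  destruct (box_target _ (B 1%nat ltac:(lia))) as [c1 [T1 H1]].
  destruct (box_target _ (B 2%nat ltac:(lia))) as [c2 [T2 H2]].
  destruct (box_target _ (B 3%nat ltac:(lia))) as [c3 [T3 H3]].
  exists (flat_map relabellings [c0; c1; c2; c3]).
  split; [|split; [reflexivity|]].
  - assert (A : forall l l' : list config5, NoDup l -> NoDup l' ->
      (forall d, In d l -> In d l' -> False) -> NoDup (l ++ l')).
    { intros l l' N N' D; apply NoDup_app; trivial; intros d Hd Hd'; exact (D d Hd Hd'). }
    cbn [flat_map]; apply A; [now apply relabellings_NoDup| |].
    + apply A; [now apply relabellings_NoDup| |].
      * apply A; [now apply relabellings_NoDup| |].
        -- apply A; [now apply relabellings_NoDup|constructor|intros d _ []].
        -- intros d Hd; rewrite !in_app_iff; intros [Hd'|[]].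
           apply (boxes_disjoint 2 3 c2 c3 d); trivial; lia.
      * intros d Hd; rewrite !in_app_iff; intros [Hd'|[Hd'|[]]].
        -- apply (boxes_disjoint 1 2 c1 c2 d); trivial; lia.
        -- apply (boxes_disjoint 1 3 c1 c3 d); trivial; lia.
    + intros d Hd; rewrite !in_app_iff; intros [Hd'|[Hd'|[Hd'|[]]]].
      * apply (boxes_disjoint 0 1 c0 c1 d); trivial; lia.
      * apply (boxes_disjoint 0 2 c0 c2 d); trivial; lia.
      * apply (boxes_disjoint 0 3 c0 c3 d); trivial; lia.
  - intros c; rewrite in_flat_map; split.
    + intros [c' [Hc' Hc]]; apply (target_relabel c'); [|exact Hc].
      destruct Hc' as [<-|[<-|[<-|[<-|[]]]]]; assumption.
    (* Some relabelling c' of c lies in a box, hence by uniqueness it is the configuration chosen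
       for that box, and c is in turn a relabelling of it. *)
    + intros T; destruct (target_in_some_box c T) as [c' [h [Hc' [Hh HB]]]].
      exists c'; split; [|now apply relabellings_sym].
      assert (T' := target_relabel c c' T Hc').
      destruct Hh as [<-|[<-|[<-|[<-|[]]]]].
      * left; now apply (box_target_unique (nth 0 boxes [])); try apply B; try lia.
      * right; left; now apply (box_target_unique (nth 1 boxes [])); try apply B; try lia.
      * right; right; left; now apply (box_target_unique (nth 2 boxes [])); try apply B; try lia.
      * right; right; right; left; now apply (box_target_unique (nth 3 boxes [])); try apply B; try lia.
Qed.
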